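(* Let $A>2.5$, and let $M(x)=\sum_{n\le x}f(n)$ be the summatory function of a Rademacher random multiplicative function $f$. Then it almost surely holds that $$M(x)\ne O\bigl(\sqrt{x}\,(\log\log x)^{-A}\bigr)\qquad\text{as }x\to\infty,$$ that is, almost surely $\limsup_{x\to\infty}\dfrac{|M(x)|(\log\log x)^{A}}{\sqrt{x}}=\infty$.
   Context: Let $(\varepsilon_p)_{p\text{ prime}}$ be independent Rademacher random variables, i.e. $\mathbb{P}(\varepsilon_p=1)=\mathbb{P}(\varepsilon_p=-1)=1/2$. The Rademacher random multiplicative function is defined on positive integers by $f(n):=\prod_{p\mid n}\varepsilon_p$ if $n$ is squarefree, and $f(n):=0$ otherwise (so $f(1)=1$). *)

(* Defs.v *)
(* MathComp-Analysis *)
From HB Require Import structures.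
From mathcomp Require Import all_boot all_order all_algebra finmap.
From mathcomp Require Import all_classical all_reals all_analysis.

Set Implicit Arguments.
Unset Strict Implicit.
Unset Printing Implicit Defensive.

Import Order.TTheory GRing.Theory Num.Theory.
Import numFieldNormedType.Exports.

Local Open Scope classical_set_scope.
Local Open Scope ring_scope.

Definition rademacher {d} {T : measurableType d} {R : realType}
    (P : probability T R) (X : {RV P >-> R}) : Prop :=
  P (X @^-1` [set 1]) = (2^-1)%:E /\ P (X @^-1` [set -1]) = (2^-1)%:E.

(* Mutual independence of the subfamily indexed by D: the product rule holds
   for every finite subfamily. *)
Definition independent_on {d} {T : measurableType d} {R : realType}
    (P : probability T R) {I : choiceType} (D : set I)
    (X : I -> {RV P >-> R}) : Prop :=
  forall (J : {fset I}) (B : I -> set R),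
    [set` J] `<=` D ->
    (forall i, i \in J -> measurable (B i)) ->
    P (\bigcap_(i in [set` J]) (X i @^-1` B i)) =
    (\prod_(i <- J) P (X i @^-1` B i))%E.

(* In particular 0 is not squarefree. *)
Definition squarefree (n : nat) : Prop :=
  forall m : nat, (m ^ 2 %| n)%N -> m = 1%N.

(* Only the values of eps at prime indices are used. *)
Definition rademacher_mult {T : Type} {R : realType} (eps : nat -> T -> R)
    (w : T) (n : nat) : R :=
  if `[< squarefree n >] then \prod_(p <- primes n) eps p w else 0.

(* For x < 0, Num.truncn x = 0 and the sum is empty. *)
Definition summatory {R : realType} (f : nat -> R) (x : R) : R :=
  \sum_(1 <= n < (Num.truncn x).+1) f n.

(* The Landau notations need a canonical filter for F in "f =O_ F g". *)
Canonical pinfty_nbhs_filter_on (R : numFieldType) :=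
  FilterType (pinfty_nbhs R) (filter_filter (F := pinfty_nbhs R)).

(* Main.v *)
(** For signs [e] and [s = 1/2 + sg + it], the Euler product [F(s)] over the
    primes up to [N] is the Dirichlet series of the multiplicative function up to
    a negligible remainder.  If [|M(n)| <= C sqrt n (ln ln n)^-A] held for
    [x0 <= n <= N], then with [sg = 1/q], [L = ln q] and [t] running over [q / 80]
    points of spacing [1/q], partial summation and a large sieve (in its dual
    form) would bound the grid mean of [|F|^2] by [O(L (sqrt q + L^(-2A) q))].

    The randomness makes [|F|^2] large somewhere.  The primes above [q] contribute
    a deterministic factor of order [q / L] times the martingale [W2 = prod (1 +
    e_p theta_p)], the primes between [m] and [q] a similar product [W1], and the
    primes below [m] a factor bounded below.  Under the measure with density [W2]
    the sum [sum theta_p (e_p - theta_p)] is a random walk; killing it at a barrier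
    turns [W2] into [Z = mean (W2 h)], [h] the height above the barrier, whose
    second moment is bounded because distinct grid points decorrelate.  By
    AM-GM [W2 h <= b W1 W2 + W2 h^2 / (4 b W1)], where the last term has mean
    [O(L^3)], so [b] of order [L^3] suffices.  Hence on the event above [Z] would
    be at most about [1/8] as soon as [L^5 (sqrt q + L^(-2A) q)] is small against
    [q], that is for [A > 5/2], while [E Z >= 1] and [E Z^2 = O(1)].
    So, whatever the signs at the primes below [m], the event fails with
    probability at least [c > 0], and iterating over disjoint ranges of primes
    shows that it is almost surely impossible. *)

Require Import Defs.
From HB Require Import structures.
From mathcomp Require Import all_boot all_order all_algebra finmap.
From mathcomp Require Import all_classical all_reals all_analysis.
From mathcomp Require Import ring lra zify complex.

Set Implicit Arguments.
Unset Strict Implicit.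
Unset Printing Implicit Defensive.

Import Order.TTheory GRing.Theory Num.Theory.
Import numFieldNormedType.Exports.
Import Normc.

Local Open Scope classical_set_scope.
Local Open Scope ring_scope.

Local Notation Re := complex.Re.
Local Notation Im := complex.Im.

(** * Means over independent signs *)

(** The grid has of the order of [q] points and [sum theta_p^2 / 2] is about [ln (q / L)]: this is
    the critical case of multiplicative chaos. The plain mean of [W2] has an unbounded second
    moment, as [E W2^2] is of order [(q / L)^2] at a single point; [W2 h] is a truncated derivative
    martingale. Where the walk is alive, the second moment costs only [exp (sum theta_p^2 / 2)]
    instead of its square. Two ordinates at distance [g / q] share the primes from [q] to
    [exp (q / g)], which costs [q / (g L)]; summed over the grid, [1 / g] yields [L], which cancels
    the [1 / L]. This is why the walk starts at [q], while the primes between [m] and [q] enter only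
    through the mean of [1 / W1], of order [L^2].

    The exponent 5 collects [L^2] from [1 / W1], [L] from [h^2], [L] from the sieve and [L] from the
    factor [q / L]; the assumed bound enters squared, as [L^(-2A)], whence [2 A > 5].

    Means are taken over finite lists of signs, by recursion on the list; measure theory enters only
    when the final estimate is transferred to the given space. *)

Fixpoint sign_mean {R : realType} (m : nat) (f : seq R -> R) : R :=
  if m is m'.+1 then
    (sign_mean m' (fun es => f (1 :: es)) + sign_mean m' (fun es => f (-1 :: es))) / 2
  else f [::].

Definition signs {R : realType} (es : seq R) : bool :=
  all (fun e => (e == 1) || (e == -1)) es.

Lemma sign_mean_le (R : realType) m (f g : seq R -> R) :
  (forall es, signs es -> size es = m -> f es <= g es) ->
  sign_mean m f <= sign_mean m g.
Proof.
elim: m f g => [|m IH] f g fg /=; first exact: fg.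
rewrite ler_pM2r ?invr_gt0// lerD//; apply: IH => es hes sz.
- by apply: fg => /=; rewrite ?eqxx ?sz.
- by apply: fg => /=; rewrite ?eqxx ?orbT ?sz.
Qed.

Lemma eq_sign_mean (R : realType) m (f g : seq R -> R) :
  (forall es, signs es -> size es = m -> f es = g es) ->
  sign_mean m f = sign_mean m g.
Proof.
by move=> fg; apply/eqP; rewrite eq_le; apply/andP; split;
  apply: sign_mean_le => es h1 h2; rewrite fg.
Qed.

Lemma sign_meanD (R : realType) m (f g : seq R -> R) :
  sign_mean m (fun es => f es + g es) = sign_mean m f + sign_mean m g.
Proof.
elim: m f g => [//|m IH] f g /=.
by rewrite !IH -mulrDl addrACA.
Qed.

Lemma sign_meanZ (R : realType) m (k : R) (f : seq R -> R) :
  sign_mean m (fun es => k * f es) = k * sign_mean m f.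
Proof.
elim: m f => [//|m IH] f /=.
by rewrite !IH -mulrDr mulrA.
Qed.

Lemma sign_meanZr (R : realType) m (k : R) (f : seq R -> R) :
  sign_mean m (fun es => f es * k) = sign_mean m f * k.
Proof.
by rewrite mulrC -sign_meanZ; apply: eq_sign_mean => es _ _; rewrite mulrC.
Qed.

Lemma sign_mean_cst (R : realType) m (k : R) : sign_mean m (fun=> k) = k.
Proof. by elim: m => [//|m IH] /=; rewrite !IH; field. Qed.

Lemma sign_mean_eq0 (R : realType) m (f : seq R -> R) :
  (forall es, f es = 0) -> sign_mean m f = 0.
Proof.
by move=> f0; rewrite -[RHS](sign_mean_cst m 0); apply: eq_sign_mean => es _ _; exact: f0.
Qed.

Lemma sign_mean_ge0 (R : realType) m (f : seq R -> R) :
  (forall es, signs es -> size es = m -> 0 <= f es) -> 0 <= sign_mean m f.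
Proof. by move=> f0; rewrite -(sign_mean_cst m 0); exact: sign_mean_le. Qed.

Lemma sign_mean_sum (R : realType) m (I : Type) (r : seq I) (f : I -> seq R -> R) :
  sign_mean m (fun es => \sum_(i <- r) f i es) = \sum_(i <- r) sign_mean m (f i).
Proof.
elim: r => [|i r IH].
  by rewrite big_nil -[RHS](sign_mean_cst m 0); apply: eq_sign_mean => es _ _; rewrite big_nil.
rewrite big_cons -IH -sign_meanD.
by apply: eq_sign_mean => es _ _; rewrite big_cons.
Qed.

Lemma sign_mean_add (R : realType) m n (f : seq R -> R) :
  sign_mean (m + n) f =
  sign_mean m (fun es1 => sign_mean n (fun es2 => f (es1 ++ es2))).
Proof. by elim: m f => [//|m IH] f; rewrite addSn /= !IH. Qed.

(* The barrier process: [walk_weight] is a mean-one product martingale, and under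
   the measure it defines [height] is a martingale killed on reaching [0]. *)
Fixpoint walk_weight {R : realType} (ths es : seq R) : R :=
  match ths, es with
  | th :: ths', e :: es' => (1 + e * th) * walk_weight ths' es'
  | _, _ => 1
  end.

Fixpoint height {R : realType} (ths es : seq R) (h : R) : R :=
  if h <= 0 then 0 else
  match ths, es with
  | th :: ths', e :: es' => height ths' es' (h - th * (e - th))
  | _, _ => h
  end.

Definition small {R : realType} (ths : seq R) : bool := all (fun th => `|th| <= 2^-1) ths.

Lemma height0 (R : realType) (ths es : seq R) h : h <= 0 -> height ths es h = 0.
Proof. by case: ths es => [|? ?] [|? ?] /= ->. Qed.

Lemma height_cat (R : realType) (ths1 ths2 es1 es2 : seq R) h :
  size es1 = size ths1 ->
  height (ths1 ++ ths2) (es1 ++ es2) h = height ths2 es2 (height ths1 es1 h).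
Proof.
elim: ths1 es1 h => [|th ths IH] [|e es] h //=.
  by move=> _; case: (leP h 0) => h0 //; rewrite !height0.
by case=> sz; case: (leP h 0) => h0; [rewrite height0|exact: IH].
Qed.

Lemma walk_weight_cat (R : realType) (ths1 ths2 es1 es2 : seq R) :
  size es1 = size ths1 ->
  walk_weight (ths1 ++ ths2) (es1 ++ es2) =
  walk_weight ths1 es1 * walk_weight ths2 es2.
Proof.
elim: ths1 es1 => [|th ths IH] [|e es] //=; first by rewrite mul1r.
by case=> sz; rewrite IH// mulrA.
Qed.

Lemma walk_weight_ge0 (R : realType) (ths es : seq R) :
  small ths -> signs es -> 0 <= walk_weight ths es.
Proof.
elim: ths es => [|th ths IH] [|e es] //= /andP[hth hths] /andP[he hes].
apply: mulr_ge0; last exact: IH.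
move: hth; rewrite ler_norml => /andP[h1 h2].
by case/orP: he => /eqP ->; lra.
Qed.

(** The tilt [1 + e * th] gives the sign [e] the mean [th], so the step [th * (e - th)] is centred;
    killing replaces a nonpositive height by 0 and can only raise the mean. *)
Lemma mean_height_ge (R : realType) (ths : seq R) h : small ths ->
  h <= sign_mean (size ths) (fun es => walk_weight ths es * height ths es h).
Proof.
elim: ths h => [|th ths IH] h /=; first by case: (leP h 0) => h0; rewrite ?mulr0 ?mul1r.
case/andP => hth hths; case: (leP h 0) => h0.
  by rewrite !sign_mean_eq0 ?addr0 ?mul0r// => es; rewrite mulr0.
move: hth; rewrite ler_norml => /andP[h1 h2].
under eq_sign_mean => es _ _ do rewrite -mulrA.
under [X in _ + X]eq_sign_mean => es _ _ do rewrite -mulrA.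
rewrite !sign_meanZ.
have := IH (h - th * (1 - th)) hths; have := IH (h - th * (-1 - th)) hths.
set A := sign_mean _ _; set B := sign_mean _ _ => hA hB.
have : (1 + 1 * th) * (h - th * (1 - th)) <= (1 + 1 * th) * B by rewrite ler_wpM2l//; lra.
have : (1 + -1 * th) * (h - th * (-1 - th)) <= (1 + -1 * th) * A by rewrite ler_wpM2l//; lra.
by move=> e1 e2; lra.
Qed.

Lemma mean_height_sqr_le (R : realType) (ths : seq R) h : small ths ->
  sign_mean (size ths) (fun es => walk_weight ths es * height ths es h ^+ 2)
  <= h ^+ 2 + \sum_(th <- ths) th ^+ 2.
Proof.
elim: ths h => [|th ths IH] h /=.
  by rewrite big_nil addr0; case: (leP h 0) => h0; rewrite ?expr0n ?mulr0 ?mul1r ?sqr_ge0.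
case/andP => hth hths; case: (leP h 0) => h0.
  rewrite !sign_mean_eq0 ?addr0 ?mul0r; first last.
  - by move=> es; rewrite expr0n mulr0.
  - by move=> es; rewrite expr0n mulr0.
  by rewrite addr_ge0 ?sqr_ge0// sumr_ge0// => i _; exact: sqr_ge0.
move: hth; rewrite ler_norml => /andP[h1 h2].
under eq_sign_mean => es _ _ do rewrite -mulrA.
under [X in _ + X]eq_sign_mean => es _ _ do rewrite -mulrA.
rewrite !sign_meanZ big_cons.
have := IH (h - th * (1 - th)) hths; have := IH (h - th * (-1 - th)) hths.
set A := sign_mean _ _; set B := sign_mean _ _; set S := \sum_(_ <- _) _ => hA hB.
have e2 : (1 + 1 * th) * B <= (1 + 1 * th) * ((h - th * (1 - th)) ^+ 2 + S) by rewrite ler_wpM2l//; lra.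
have e1 : (1 + -1 * th) * A <= (1 + -1 * th) * ((h - th * (-1 - th)) ^+ 2 + S) by rewrite ler_wpM2l//; lra.
(* [th ^+ 2 * (1 - th ^+ 2)] is the variance of the step [th * (e - th)] under the tilt. *)
apply: (@le_trans _ _ (h ^+ 2 + th ^+ 2 * (1 - th ^+ 2) + S)).
  apply: le_trans (_ : ((1 + 1 * th) * ((h - th * (1 - th)) ^+ 2 + S) +
    (1 + -1 * th) * ((h - th * (-1 - th)) ^+ 2 + S)) / 2 <= _).
    by rewrite ler_pM2r ?invr_gt0// lerD.
  by rewrite le_eqVlt; apply/orP; left; apply/eqP; field.
rewrite addrA lerD2r lerD2l mulrBr mulr1 lerBlDr lerDl.
by rewrite mulr_ge0 ?sqr_ge0.
Qed.

(* Under the two-point tilt, [far_mean th th'] is the drift of the first height and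
   [far_cov th th'] the covariance of the two increments. *)
Definition far_mean {R : realType} (th th' : R) : R := th * th' * (1 - th ^+ 2) / (1 + th * th').

Definition far_cov {R : realType} (th th' : R) : R :=
  th * th' * (1 - ((th + th') / (1 + th * th')) ^+ 2).

(** The common tilt [(1 + e * a) * (1 + e * b)] has mean [1 + a * b] and gives [e] the mean
    [(a + b) / (1 + a * b)]. A product of shifted heights keeps its form under it, and only the
    shifts [d], [d'], [z] move: this is what the induction in the far range propagates. *)
Lemma far_step (R : realType) (a b h k d d' z : R) : 1 + a * b != 0 ->
  ((1 + 1 * a) * (1 + 1 * b) * ((h - a * (1 - a) + d) * (k - b * (1 - b) + d') + z) +
   (1 + -1 * a) * (1 + -1 * b) * ((h - a * (-1 - a) + d) * (k - b * (-1 - b) + d') + z)) / 2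
  = (1 + a * b) * ((h + (d - far_mean a b)) * (k + (d' - far_mean b a)) + (z + far_cov a b)).
Proof. by rewrite /far_mean /far_cov (mulrC b a) => h0; field. Qed.

(** Killing is handled by a majorant: the shifts [D] and [Q] keep the right-hand side nonnegative at
    every intermediate time, as long as the heights are at least -1, so that it also dominates where
    a walk is dead. A live walk cannot jump below -1, since [small] bounds a step by 3/4. The
    conditions on all suffixes [drop k l] express this nonnegativity along the induction. *)
Lemma two_point_far (R : realType) (l : seq (R * R)) (D Q h h' : R) :
  small (map fst l) -> small (map snd l) ->
  (forall k, 1 <= D - \sum_(x <- drop k l) far_mean x.1 x.2) ->
  (forall k, 1 <= D - \sum_(x <- drop k l) far_mean x.2 x.1) ->
  (forall k, 0 <= Q + \sum_(x <- drop k l) far_cov x.1 x.2) ->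
  -1 <= h -> -1 <= h' ->
  sign_mean (size l) (fun es =>
    (walk_weight (map fst l) es * height (map fst l) es h) *
    (walk_weight (map snd l) es * height (map snd l) es h'))
  <= \prod_(x <- l) (1 + x.1 * x.2) *
     ((h + (D - \sum_(x <- l) far_mean x.1 x.2)) *
      (h' + (D - \sum_(x <- l) far_mean x.2 x.1)) +
      (Q + \sum_(x <- l) far_cov x.1 x.2)).
Proof.
elim: l h h' => [|[a b] l IH] h h' /=.
  move=> _ _ /(_ 0%N) D1 _ /(_ 0%N) Q0 hh hh'.
  move: D1 Q0; rewrite !big_nil !addr0 !subr0 !mul1r => D1 Q0.
  case: (leP h 0) => h0; case: (leP h' 0) => h0'; rewrite ?mulr0 ?mul0r; nra.
case/andP => ha hs /andP[hb hs'] H1 H2 H3 hh hh'.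
have P0 : 0 <= \prod_(x <- l) (1 + x.1 * x.2).
  move: hs hs'; elim: l {IH H1 H2 H3} => [|[c d] l IH] /=; first by rewrite big_nil.
  case/andP => hc hs /andP[hd hs']; rewrite big_cons mulr_ge0 ?IH//=.
  by move: hc hd; rewrite !ler_norml => /andP[? ?] /andP[? ?]; nra.
have rhs0 : 0 <= (h + (D - \sum_(x <- (a, b) :: l) far_mean x.1 x.2)) *
      (h' + (D - \sum_(x <- (a, b) :: l) far_mean x.2 x.1)) +
      (Q + \sum_(x <- (a, b) :: l) far_cov x.1 x.2).
  have := H1 0%N; have := H2 0%N; have := H3 0%N; rewrite !drop0.
  by move=> e3 e2 e1; rewrite addr_ge0// mulr_ge0//; lra.
move: ha hb; rewrite !ler_norml => /andP[a1 a2] /andP[b1 b2].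
have ab0 : 0 < 1 + a * b by nra.
have rhs1 : 0 <= (1 + a * b) * \prod_(x <- l) (1 + x.1 * x.2) by rewrite mulr_ge0// ltW.
case: (leP h 0) => h0.
  rewrite !sign_mean_eq0 ?addr0 ?mul0r; first by rewrite [X in X * _]big_cons mulr_ge0.
    by move=> es; rewrite mulr0 mul0r.
  by move=> es; rewrite mulr0 mul0r.
case: (leP h' 0) => h0'.
  rewrite !sign_mean_eq0 ?addr0 ?mul0r; first by rewrite [X in X * _]big_cons mulr_ge0.
    by move=> es; rewrite !mulr0.
  by move=> es; rewrite !mulr0.
have E e : sign_mean (size l) (fun es =>
   (1 + e * a) * walk_weight [seq i.1 | i <- l] es * height [seq i.1 | i <- l] es (h - a * (e - a)) *
   ((1 + e * b) * walk_weight [seq i.2 | i <- l] es * height [seq i.2 | i <- l] es (h' - b * (e - b))))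
  = (1 + e * a) * (1 + e * b) * sign_mean (size l) (fun es =>
    (walk_weight (map fst l) es * height (map fst l) es (h - a * (e - a))) *
    (walk_weight (map snd l) es * height (map snd l) es (h' - b * (e - b)))).
  by rewrite -sign_meanZ; apply: eq_sign_mean => es _ _; ring.
rewrite !E {E}.
have J e : (e == 1) || (e == -1) -> (1 + e * a) * (1 + e * b) * sign_mean (size l) (fun es =>
    (walk_weight (map fst l) es * height (map fst l) es (h - a * (e - a))) *
    (walk_weight (map snd l) es * height (map snd l) es (h' - b * (e - b)))) <=
   \prod_(x <- l) (1 + x.1 * x.2) * ((1 + e * a) * (1 + e * b) *
     ((h - a * (e - a) + (D - \sum_(x <- l) far_mean x.1 x.2)) *
      (h' - b * (e - b) + (D - \sum_(x <- l) far_mean x.2 x.1)) +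
      (Q + \sum_(x <- l) far_cov x.1 x.2))).
  move=> he; rewrite mulrCA; apply: ler_wpM2l.
    by case/orP: he => /eqP ->; rewrite mulr_ge0//; lra.
  apply: IH => //.
  - by move=> k; have := H1 k.+1.
  - by move=> k; have := H2 k.+1.
  - by move=> k; have := H3 k.+1.
  - by case/orP: he => /eqP ->; nra.
  - by case/orP: he => /eqP ->; nra.
have J1 := J 1 _; rewrite eqxx in J1; have {}J1 := J1 isT.
have J2 := J (-1) _; rewrite eqxx orbT in J2; have {}J2 := J2 isT.
have i2 : (0 : R) <= 2^-1 by rewrite invr_ge0.
apply: (le_trans (ler_wpM2r i2 (lerD J1 J2))).
rewrite -mulrDr -mulrA far_step ?gt_eqF// !big_cons /=.
by rewrite le_eqVlt; apply/orP; left; apply/eqP; ring.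
Qed.

(** * Exponential estimate for one killed walk *)

Definition barrier_exp {R : realType} (h : R) : R := if h <= 0 then 0 else expR h.

(** An error of third order is wanted: the cubes of the increments are summable over primes, the
    squares are not. *)
Lemma ln1Dx_le_cubic (R : realType) (x : R) : `|x| <= 2^-1 ->
  1 + x <= expR (x - x ^+ 2 / 2 + 3 * `|x| ^+ 3).
Proof.
(* The derivative of [g] is [y ^+ 2 * expR (- y + y ^+ 2 / 2)], so [g] exceeds [g 0 = 1] by at most
   a cubic error. *)
move=> hx; pose g (y : R) : R := (1 + y) * expR (- y + y ^+ 2 / 2).
have dg (y : R) : is_derive y 1 g (y ^+ 2 * expR (- y + y ^+ 2 / 2)).
  rewrite /g; apply: is_derive_eq.
  by rewrite /GRing.scale /=; field.
have cg (a b : R) : {within `[a, b], continuous g}.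
  apply: derivable_within_continuous => y _; exact: ex_derive.
have bound (y : R) : `|y| <= 2^-1 -> y ^+ 2 * expR (- y + y ^+ 2 / 2) <= 3 * y ^+ 2.
  rewrite ler_norml => /andP[y1 y2]; rewrite mulrC ler_wpM2r ?sqr_ge0//.
  have h1 : 1 + (y - y ^+ 2 / 2) <= expR (y - y ^+ 2 / 2) := expR_ge1Dx _.
  rewrite (_ : - y + y ^+ 2 / 2 = - (y - y ^+ 2 / 2)); last by ring.
  rewrite expRN -[leRHS]invrK lef_pV2 ?posrE ?expR_gt0 ?invr_gt0//.
  by apply: le_trans h1; nra.
have main : g x <= 1 + 3 * `|x| ^+ 3.
  have g0 : g 0 = 1 by rewrite /g addr0 mul1r expr0n /= mul0r oppr0 addr0 expR0.
  move: hx; case: (ltgtP x 0) => x0 hx.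
  - have [c /itvP cc e] := MVT x0 (fun y _ => dg y) (@cg x 0).
    have p0 : 0 <= c ^+ 2 * expR (- c + c ^+ 2 / 2) by rewrite mulr_ge0 ?sqr_ge0 ?expR_ge0.
    have p1 : 0 <= `|x| ^+ 3 by rewrite exprn_ge0.
    have x0' : 0 <= - x by rewrite oppr_ge0 ltW.
    have := mulr_ge0 p0 x0'; move: e; rewrite g0; lra.
  - have [c cc e] := MVT x0 (fun y _ => dg y) (@cg 0 x).
    have cx : c < x by move: cc; rewrite in_itv /= => /andP[].
    have c0 : 0 < c by move: cc; rewrite in_itv /= => /andP[].
    have := bound c; rewrite gtr0_norm// in hx *; rewrite gtr0_norm// => /(_ _).
    move=> /(_ (ltW (lt_le_trans cx hx))) bc.
    have cx2 : c ^+ 2 <= x ^+ 2 by rewrite ler_pXn2r ?nnegrE// ltW.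
    have := ler_wpM2r (ltW x0) (le_trans bc (ler_wpM2l _ cx2)).
    move=> /(_ (ler0n _ _)); move: e; rewrite g0 subr0 => <-.
    by rewrite lerBlDl => /le_trans; apply; rewrite -mulrA -exprSr.
  - by rewrite x0 g0 normr0 expr0n mulr0 addr0.
have : 1 + x = g x * expR (x - x ^+ 2 / 2).
  rewrite /g -mulrA -expRD (_ : - x + x ^+ 2 / 2 + (x - x ^+ 2 / 2) = 0) ?expR0 ?mulr1//; ring.
move=> ->; rewrite [leRHS]expRD [leLHS]mulrC ler_wpM2l ?expR_ge0//.
exact: le_trans main (expR_ge1Dx _).
Qed.

Lemma near_step (R : realType) (th : R) : `|th| <= 2^-1 ->
  ((1 + 1 * th) ^+ 2 * expR (- (th * (1 - th))) +
   (1 + -1 * th) ^+ 2 * expR (- (th * (-1 - th)))) / 2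
  <= expR (th ^+ 2 / 2 + 3 * `|th| ^+ 3).
Proof.
move=> hth.
have K e : (e == 1) || (e == -1) ->
  (1 + e * th) ^+ 2 * expR (- (th * (e - th))) <= (1 + e * th) * expR (th ^+ 2 / 2 + 3 * `|th| ^+ 3).
  move=> he; rewrite expr2 -mulrA; apply: ler_wpM2l.
    by move: hth; rewrite ler_norml => /andP[? ?]; case/orP: he => /eqP ->; lra.
  have e2 : e ^+ 2 = 1 by case/orP: he => /eqP ->; rewrite ?expr1n ?sqrrN ?expr1n.
  have en : `|e * th| = `|th|.
    by rewrite normrM; case/orP: he => /eqP ->; rewrite ?normrN normr1 mul1r.
  have := @ln1Dx_le_cubic _ (e * th); rewrite en => /(_ hth) h1.
  apply: (le_trans (ler_wpM2r (expR_ge0 _) h1)).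
  rewrite -expRD ler_expR exprMn e2; lra.
have K1 := K 1 _; rewrite eqxx in K1; have {}K1 := K1 isT.
have K2 := K (-1) _; rewrite eqxx orbT in K2; have {}K2 := K2 isT.
lra.
Qed.

(** One copy of the weight serves as the tilt. In the other, [1 + e * th] is close to
    [expR (e * th - th ^+ 2 / 2)]; multiplied by the exponential of the height increment
    [- th * (e - th)], it loses its dependence on [e] and leaves [expR (th ^+ 2 / 2)]. A live walk
    has [barrier_exp] at least 1, so the exponent is half that of the plain second moment. *)
Lemma mean_barrier_exp_le (R : realType) (ths : seq R) h : small ths ->
  sign_mean (size ths) (fun es => walk_weight ths es ^+ 2 * barrier_exp (height ths es h))
  <= expR (h + \sum_(th <- ths) (th ^+ 2 / 2 + 3 * `|th| ^+ 3)).
Proof.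
elim: ths h => [|th ths IH] h /=.
  rewrite big_nil addr0 /barrier_exp expr1n mul1r => _.
  case: (leP h 0) => h0; first by rewrite lexx expR_ge0.
  by rewrite (lt_geF h0).
case/andP => hth hths; case: (leP h 0) => h0.
  by rewrite !sign_mean_eq0 ?addr0 ?mul0r ?expR_ge0// => es; rewrite /barrier_exp lexx mulr0.
have E e : sign_mean (size ths) (fun es => ((1 + e * th) * walk_weight ths es) ^+ 2 *
    barrier_exp (height ths es (h - th * (e - th)))) = (1 + e * th) ^+ 2 *
    sign_mean (size ths) (fun es => walk_weight ths es ^+ 2 *
    barrier_exp (height ths es (h - th * (e - th)))).
  by rewrite -sign_meanZ; apply: eq_sign_mean => es _ _; rewrite exprMn mulrA.
rewrite !E {E} big_cons; set S := \sum_(_ <- _) _.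
apply: (le_trans (_ : _ <= ((1 + 1 * th) ^+ 2 * (expR (- (th * (1 - th))) * expR (h + S)) +
   (1 + -1 * th) ^+ 2 * (expR (- (th * (-1 - th))) * expR (h + S))) / 2)).
  rewrite ler_pM2r ?invr_gt0//; apply: lerD; rewrite ler_wpM2l ?sqr_ge0// -expRD;
  by rewrite (le_trans (IH _ hths))// ler_expR /S; lra.
rewrite (_ : h + (th ^+ 2 / 2 + 3 * `|th| ^+ 3 + S) = (th ^+ 2 / 2 + 3 * `|th| ^+ 3) + (h + S));
  last by ring.
rewrite [leRHS]expRD; apply: le_trans (ler_wpM2r (expR_ge0 _) (near_step hth)).
by rewrite le_eqVlt; apply/orP; left; apply/eqP; field.
Qed.

Lemma tilt_ge0 (R : realType) (a b : R) : `|a| <= 2^-1 -> `|b| <= 2^-1 -> 0 <= 1 + a * b.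
Proof. by rewrite !ler_norml => /andP[? ?] /andP[? ?]; nra. Qed.

(** The correlation on [l1] is not exploited. The far bound grows like [expR ((a + b) / 2)], and
    AM-GM splits [w * w' * expR ((a + b) / 2)] into the one-point quantities [w ^+ 2 * expR a] and
    [w' ^+ 2 * expR b]. *)
Lemma two_point_near (R : realType) (l1 l2 : seq (R * R)) (K h h' : R) :
  0 <= K -> small (map fst l1) -> small (map snd l1) ->
  (forall a b, 0 < a -> 0 < b -> sign_mean (size l2) (fun es =>
    (walk_weight (map fst l2) es * height (map fst l2) es a) *
    (walk_weight (map snd l2) es * height (map snd l2) es b))
    <= K * expR ((a + b) / 2)) ->
  sign_mean (size (l1 ++ l2)) (fun es =>
    (walk_weight (map fst (l1 ++ l2)) es * height (map fst (l1 ++ l2)) es h) *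
    (walk_weight (map snd (l1 ++ l2)) es * height (map snd (l1 ++ l2)) es h'))
  <= K / 2 * (expR (h + \sum_(th <- map fst l1) (th ^+ 2 / 2 + 3 * `|th| ^+ 3)) +
              expR (h' + \sum_(th <- map snd l1) (th ^+ 2 / 2 + 3 * `|th| ^+ 3))).
Proof.
move=> K0 s1 s2 far; rewrite size_cat sign_mean_add !map_cat.
set f1 := map fst l1 in s1 *; set f2 := map snd l1 in s2 *.
have z1 : size f1 = size l1 by rewrite size_map.
have z2 : size f2 = size l1 by rewrite size_map.
apply: (@le_trans _ _ (K / 2 * (
   sign_mean (size l1) (fun es => walk_weight f1 es ^+ 2 * barrier_exp (height f1 es h)) +
   sign_mean (size l1) (fun es => walk_weight f2 es ^+ 2 * barrier_exp (height f2 es h'))))).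
  rewrite -sign_meanD -sign_meanZ; apply: sign_mean_le => es hes sz.
  under eq_sign_mean => es2 _ _ do
    rewrite !walk_weight_cat ?height_cat ?z1 ?z2// -!mulrA.
  set a := height f1 es h; set b := height f2 es h'.
  set w := walk_weight f1 es; set w' := walk_weight f2 es.
  have w0 : 0 <= w by exact: walk_weight_ge0.
  have w0' : 0 <= w' by exact: walk_weight_ge0.
  rewrite (@eq_sign_mean _ _ _ (fun es2 => (w * w') *
     ((walk_weight (map fst l2) es2 * height (map fst l2) es2 a) *
      (walk_weight (map snd l2) es2 * height (map snd l2) es2 b)))); last first.
    by move=> es2 _ _; ring.
  rewrite sign_meanZ /barrier_exp.
  have K20 : 0 <= K / 2 by rewrite divr_ge0.
  case: (leP a 0) => a0.
    rewrite sign_mean_eq0; last by move=> es2; rewrite height0// mulr0 mul0r.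
    rewrite mulr0 mulr0 add0r !mulr_ge0 ?sqr_ge0//.
    by case: ifP => _; rewrite ?expR_ge0.
  case: (leP b 0) => b0.
    rewrite sign_mean_eq0; last by move=> es2; rewrite (height0 _ _ b0) !mulr0.
    by rewrite mulr0 mulr0 addr0 !mulr_ge0 ?sqr_ge0// expR_ge0.
  apply: (le_trans (ler_wpM2l (mulr_ge0 w0 w0') (far _ _ a0 b0))).
  have -> : expR ((a + b) / 2) = expR (a / 2) * expR (b / 2) by rewrite -expRD mulrDl.
  have -> : expR a = expR (a / 2) ^+ 2 by rewrite expr2 -expRD -splitr.
  have -> : expR b = expR (b / 2) ^+ 2 by rewrite expr2 -expRD -splitr.
  set x := expR _; set y := expR _.
  rewrite -subr_ge0 (_ : _ - _ = K / 2 * (w * x - w' * y) ^+ 2); last by field.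
  by rewrite mulr_ge0 ?sqr_ge0.
rewrite ler_wpM2l ?divr_ge0// -[in leLHS]z1.
have := mean_barrier_exp_le h s1; have := mean_barrier_exp_le h' s2.
by rewrite z1 z2 => e2 e1; rewrite lerD.
Qed.

(** Fourth powers of the increments are summable over primes, so drift and covariance may be
    replaced by [a * b], whose partial sums oscillate. *)
Lemma far_mean_approx (R : realType) (a b : R) : `|a| <= 2^-1 -> `|b| <= 2^-1 ->
  `|far_mean a b - a * b| <= 4 * (a ^+ 4 + b ^+ 4).
Proof.
rewrite !ler_norml => /andP[a1 a2] /andP[b1 b2].
have sm := sqr_ge0 (a - b); have sp := sqr_ge0 (a + b).
have ab : 3 / 4 <= 1 + a * b by nra.
have ab0 : 0 < 1 + a * b by lra.
rewrite /far_mean (_ : _ - _ = a * b * - (a ^+ 2 + a * b) / (1 + a * b)); last by field; rewrite gt_eqF.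
rewrite -ler_norml normrM normfV (gtr0_norm ab0) ler_pdivrMr//.
have : `|a * b * - (a ^+ 2 + a * b)| <= 3 * (a ^+ 4 + b ^+ 4).
  have p1 : `|a * b| <= (a ^+ 2 + b ^+ 2) / 2 by rewrite ler_norml; apply/andP; split; nra.
  have p2 : `|- (a ^+ 2 + a * b)| <= (3 * a ^+ 2 + b ^+ 2) / 2.
    by rewrite ler_norml; apply/andP; split; nra.
  rewrite normrM; apply: (le_trans (ler_pM (normr_ge0 _) (normr_ge0 _) p1 p2)).
  have := sqr_ge0 (a ^+ 2 - b ^+ 2); nra.
move=> h; apply: (le_trans h).
have q0 : 0 <= a ^+ 4 + b ^+ 4 by nra.
nra.
Qed.

Lemma far_cov_approx (R : realType) (a b : R) : `|a| <= 2^-1 -> `|b| <= 2^-1 ->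
  `|far_cov a b - a * b| <= 4 * (a ^+ 4 + b ^+ 4).
Proof.
rewrite !ler_norml => /andP[a1 a2] /andP[b1 b2].
have sm := sqr_ge0 (a - b); have sp := sqr_ge0 (a + b).
have ab : 3 / 4 <= 1 + a * b by nra.
have ab0 : 0 < 1 + a * b by lra.
rewrite /far_cov (_ : _ - _ = - (a * b) * (a + b) ^+ 2 / (1 + a * b) ^+ 2); last by field; rewrite gt_eqF.
have s0 : 0 < (1 + a * b) ^+ 2 by rewrite exprn_gt0.
have s1 : 9 / 16 <= (1 + a * b) ^+ 2 by nra.
rewrite -ler_norml normrM normfV (gtr0_norm s0) ler_pdivrMr//.
have q0 : 0 <= a ^+ 4 + b ^+ 4 by nra.
have : `|- (a * b) * (a + b) ^+ 2| <= 2 * (a ^+ 4 + b ^+ 4).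
  have p1 : (a + b) ^+ 2 <= 2 * (a ^+ 2 + b ^+ 2) by nra.
  have p2 : `|- (a * b)| <= (a ^+ 2 + b ^+ 2) / 2 by rewrite ler_norml; apply/andP; split; nra.
  rewrite normrM (ger0_norm (sqr_ge0 _)).
  apply: (le_trans (ler_pM (normr_ge0 _) (sqr_ge0 _) p2 p1)).
  have := sqr_ge0 (a ^+ 2 - b ^+ 2); nra.
move=> h; apply: (le_trans h); nra.
Qed.

(* The walks share the steps [l1], on which only the one-point barrier estimate is
   used, and are nearly uncorrelated on the steps [l2]. *)
Lemma two_point_le (R : realType) (C : R) : 0 <= C -> exists2 K : R, 0 <= K &
  forall l1 l2 : seq (R * R),
  small (map fst (l1 ++ l2)) -> small (map snd (l1 ++ l2)) ->
  (forall k, `|\sum_(x <- drop k l2) x.1 * x.2| <= C) ->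
  \sum_(x <- l2) (x.1 ^+ 4 + x.2 ^+ 4) <= C ->
  \sum_(x <- l1) (3 * `|x.1| ^+ 3) <= C ->
  \sum_(x <- l1) (3 * `|x.2| ^+ 3) <= C ->
  sign_mean (size (l1 ++ l2)) (fun es =>
    (walk_weight (map fst (l1 ++ l2)) es * height (map fst (l1 ++ l2)) es 1) *
    (walk_weight (map snd (l1 ++ l2)) es * height (map snd (l1 ++ l2)) es 1))
  <= K * (expR (\sum_(x <- l1) (x.1 ^+ 2 / 2)) + expR (\sum_(x <- l1) (x.2 ^+ 2 / 2))).
Proof.
move=> C0; pose M := 3 + 10 * C.
pose K := expR C * (M ^+ 2 + 10 * C).
have M0 : 0 <= M by rewrite /M; lra.
have K0 : 0 <= K by rewrite mulr_ge0 ?expR_ge0// addr_ge0 ?sqr_ge0//; lra.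
exists (K / 2 * expR (1 + C)); first by rewrite mulr_ge0 ?expR_ge0// divr_ge0.
move=> l1 l2; rewrite /small !map_cat !all_cat => /andP[s1 t1] /andP[s2 t2] hC h4 h31 h32.
have st : {in l2, forall x, `|x.1| <= 2^-1 /\ `|x.2| <= 2^-1}.
  move=> x xl; move: t1 t2 => /allP t1 /allP t2.
  by split; [apply: t1|apply: t2]; apply/mapP; exists x.
have sub (F : R -> R -> R) : (forall a b, `|a| <= 2^-1 -> `|b| <= 2^-1 ->
    `|F a b - a * b| <= 4 * (a ^+ 4 + b ^+ 4)) ->
    forall k, `|\sum_(x <- drop k l2) F x.1 x.2| <= 5 * C.
  move=> hF k.
  rewrite (_ : \sum_(_ <- _) _ = \sum_(x <- drop k l2) (F x.1 x.2 - x.1 * x.2) +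
     \sum_(x <- drop k l2) x.1 * x.2); last first.
    by rewrite -big_split/=; apply: eq_bigr => x _; rewrite subrK.
  apply: (le_trans (ler_normD _ _)).
  have d1 : `|\sum_(x <- drop k l2) (F x.1 x.2 - x.1 * x.2)| <=
     4 * \sum_(x <- l2) (x.1 ^+ 4 + x.2 ^+ 4).
    apply: (le_trans (ler_norm_sum _ _ _)).
    rewrite -[in leRHS](cat_take_drop k l2) big_cat /= mulrDr.
    apply: (@le_trans _ _ (4 * \sum_(x <- drop k l2) (x.1 ^+ 4 + x.2 ^+ 4))).
      rewrite mulr_sumr big_seq [leRHS]big_seq; apply: ler_sum => x xl.
      by have [? ?] := st x (mem_drop xl); exact: hF.
    rewrite lerDr mulr_ge0// sumr_ge0// => x _; by apply: addr_ge0; exact: exprn_even_ge0.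
  have := hC k; move: d1 h4; lra.
have fm := sub far_mean (@far_mean_approx R).
have fm' : forall k, `|\sum_(x <- drop k l2) far_mean x.2 x.1| <= 5 * C.
  apply: (sub (fun a b => far_mean b a)) => a b ha hb.
  by rewrite (mulrC a) (addrC (a ^+ 4)); exact: far_mean_approx.
have fc := sub far_cov (@far_cov_approx R).
have far a b : 0 < a -> 0 < b -> sign_mean (size l2) (fun es =>
    (walk_weight (map fst l2) es * height (map fst l2) es a) *
    (walk_weight (map snd l2) es * height (map snd l2) es b))
    <= K * expR ((a + b) / 2).
  move=> a0 b0.
  (* Partial sums of drift and covariance are at most [5 * C] in absolute value, of which [4 * C]
     comes from the fourth powers; [D] and [Q] are chosen accordingly. *)
  apply: (le_trans (@two_point_far R l2 (1 + 5 * C) (5 * C) a b t1 t2 _ _ _ _ _)).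
  - by move=> k; have := fm k; rewrite ler_norml => /andP[_ ?]; lra.
  - by move=> k; have := fm' k; rewrite ler_norml => /andP[_ ?]; lra.
  - by move=> k; have := fc k; rewrite ler_norml => /andP[? _]; lra.
  - lra.
  - lra.
  have p1 : \prod_(x <- l2) (1 + x.1 * x.2) <= expR C.
    apply: (@le_trans _ _ (expR (\sum_(x <- l2) x.1 * x.2))).
      rewrite expR_sum big_seq [leRHS]big_seq; apply: ler_prod => x xl.
      rewrite expR_ge1Dx andbT; have [] := st x xl.
      exact: tilt_ge0.
    by rewrite ler_expR; have := hC 0%N; rewrite drop0 ler_norml => /andP[].
  have := fm 0%N; have := fm' 0%N; have := fc 0%N; rewrite !drop0 !ler_norml.
  move=> /andP[q1 q2] /andP[m1' m2'] /andP[m1 m2].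
  set d := 1 + 5 * C - _; set d' := 1 + 5 * C - _; set q := 5 * C + _.
  (* The far bound is linear in each height; [1 + t / 2 <= expR (t / 2)] converts it into the
     exponential form that the shared range requires. *)
  have E (t e : R) : 0 < t -> 0 <= t + e -> e <= 1 + 10 * C -> t + e <= M * expR (t / 2).
    move=> t0 te0 eC; apply: (@le_trans _ _ (M * (1 + t / 2))).
      by rewrite /M; nra.
    by rewrite ler_wpM2l// expR_ge1Dx.
  have Ea : a + d <= M * expR (a / 2) by apply: E => //; rewrite /d; lra.
  have Eb : b + d' <= M * expR (b / 2) by apply: E => //; rewrite /d'; lra.
  have ad0 : 0 <= a + d by rewrite /d; lra.
  have bd0 : 0 <= b + d' by rewrite /d'; lra.
  have e1 : 1 <= expR ((a + b) / 2) by apply: le_trans (expR_ge1Dx _); lra.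
  have qC : q <= 10 * C * expR ((a + b) / 2) by rewrite /q; nra.
  have q0 : 0 <= q by rewrite /q; lra.
  have ee : expR ((a + b) / 2) = expR (a / 2) * expR (b / 2) by rewrite -expRD mulrDl.
  rewrite /K -mulrA; apply: ler_pM => //.
  - rewrite big_seq prodr_ge0// => x xl; have [] := st x xl.
    exact: tilt_ge0.
  - by rewrite addr_ge0// mulr_ge0.
  - rewrite [leRHS]mulrDl; apply: lerD => //.
    rewrite ee expr2 mulrACA; exact: ler_pM.
have := two_point_near 1 1 K0 s1 s2 far; rewrite !map_cat => /le_trans; apply.
rewrite -[leRHS]mulrA ler_wpM2l ?divr_ge0// mulrDr !big_map -!expRD.
by apply: lerD; rewrite ler_expR big_split /=; move: h31 h32; lra.
Qed.

(** * Complex powers of integers *)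

Lemma sin_sub_le (R : realType) (a b : R) : `|sin b - sin a| <= `|b - a|.
Proof.
wlog ab : a b / a <= b => [H|].
  by have [/H//|/ltW/H] := leP a b; rewrite distrC (distrC a).
have [x _ ->] := MVT_segment ab (fun y _ => is_derive_sin y)
  (derivable_within_continuous (fun y _ => @ex_derive _ _ _ _ _ _ _ (is_derive_sin y))).
by rewrite normrM -[leRHS]mul1r ler_wpM2r// cos_max.
Qed.

Lemma norm_sin_le (R : realType) (b : R) : `|sin b| <= `|b|.
Proof. by have := sin_sub_le 0 b; rewrite sin0 !subr0. Qed.

Lemma cos_ge_sqr (R : realType) (b : R) : 1 - cos b <= b ^+ 2 / 2.
Proof.
have -> : cos b = 1 - 2 * sin (b / 2) ^+ 2.
  by rewrite {1}(splitr b) cosD -!expr2 cos2sin2; ring.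
have : `|sin (b / 2)| ^+ 2 <= `|b / 2| ^+ 2 by rewrite ler_pXn2r ?nnegrE// norm_sin_le.
rewrite !real_normK ?num_real//; lra.
Qed.

Lemma cos_ge_lin (R : realType) (b : R) : 1 - cos b <= `|b|.
Proof.
have -> : cos b = 1 - 2 * sin (b / 2) ^+ 2.
  by rewrite {1}(splitr b) cosD -!expr2 cos2sin2; ring.
have h1 : `|sin (b / 2)| <= `|b| / 2.
  by apply: (le_trans (norm_sin_le _)); rewrite normrM normfV (ger0_norm (ler0n _ 2)).
have h2 : `|sin (b / 2)| <= 1 := sin_max _.
rewrite -(real_normK (num_real (sin _))); have := normr_ge0 (sin (b / 2)); nra.
Qed.

Lemma sin_sub_id_le (R : realType) (b : R) : `|sin b - b| <= b ^+ 2.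
Proof.
wlog b0 : b / 0 <= b => [H|].
  have [/H//|/ltW b0] := leP 0 b.
  by have := H (- b); rewrite oppr_ge0 b0 sinN sqrrN -opprB opprK addrC normrN => /(_ isT);
    rewrite distrC.
have ds (y : R) : is_derive y 1 (fun y => sin y - y) (cos y - 1).
  by apply: is_derive_eq.
have [x] := MVT_segment b0 (fun y _ => ds y)
  (derivable_within_continuous (fun y _ => @ex_derive _ _ _ _ _ _ _ (ds y))).
rewrite in_itv /= sin0 !subr0 => /andP[x0 xb] ->.
rewrite normrM expr2 (ger0_norm b0) ler_wpM2r//.
rewrite -normrN opprB ger0_norm ?subr_ge0 ?cos_le1//.
by apply: (le_trans (cos_ge_lin _)); rewrite ger0_norm.
Qed.

Lemma expR_le_quad (R : realType) (a : R) : a <= 2^-1 -> expR a <= 1 + a + 2 * a ^+ 2.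
Proof.
move=> ha; have h1 : 1 - a <= expR (- a) := expR_ge1Dx _.
have p0 : 0 < 1 + a + 2 * a ^+ 2 by nra.
rewrite -[leRHS]invrK -[expR a]invrK -expRN lef_pV2 ?posrE ?invr_gt0 ?expR_gt0//.
apply: le_trans h1; rewrite -div1r ler_pdivrMr//; nra.
Qed.

Definition cnorm {R : realType} (z : R[i]%C) : R := normc z.

Lemma cnormM (R : realType) (z w : R[i]%C) : cnorm (z * w) = cnorm z * cnorm w.
Proof. exact: normcM. Qed.

Lemma cnormD (R : realType) (z w : R[i]%C) : cnorm (z + w) <= cnorm z + cnorm w.
Proof. exact: le_normcD. Qed.

Lemma cnormN (R : realType) (z : R[i]%C) : cnorm (- z) = cnorm z.
Proof. exact: normcN. Qed.

Lemma cnormB (R : realType) (z w : R[i]%C) : cnorm (z - w) <= cnorm z + cnorm w.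
Proof. by rewrite -(cnormN w) cnormD. Qed.

Lemma cnorm_ge0 (R : realType) (z : R[i]%C) : 0 <= cnorm z.
Proof. by case: z => a b; exact: sqrtr_ge0. Qed.

Lemma cnorm0 (R : realType) : cnorm (0 : R[i]%C) = 0.
Proof. exact: normc0. Qed.

Lemma cnorm1 (R : realType) : cnorm (1 : R[i]%C) = 1.
Proof. exact: normc1. Qed.

Lemma cnorm_real (R : realType) (x : R) : cnorm (real_complex R x) = `|x|.
Proof. by rewrite /cnorm /= expr0n /= addr0 sqrtr_sqr. Qed.

Lemma cnorm_sqr (R : realType) (z : R[i]%C) : cnorm z ^+ 2 = Re z ^+ 2 + Im z ^+ 2.
Proof. by case: z => a b; rewrite sqr_sqrtr// addr_ge0 ?sqr_ge0. Qed.

Lemma cnorm_le (R : realType) (z : R[i]%C) : cnorm z <= `|Re z| + `|Im z|.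
Proof.
rewrite -(@ler_pXn2r _ 2) ?nnegrE ?cnorm_ge0 ?addr_ge0// cnorm_sqr.
rewrite sqrrD !real_normK ?num_real// -addrA lerD2l lerDr mulrn_wge0// mulr_ge0//.
Qed.

Lemma normr_Re_le (R : realType) (z : R[i]%C) : `|Re z| <= cnorm z.
Proof.
rewrite -(@ler_pXn2r _ 2) ?nnegrE ?cnorm_ge0// cnorm_sqr real_normK ?num_real//.
by rewrite lerDl sqr_ge0.
Qed.

Lemma normr_Im_le (R : realType) (z : R[i]%C) : `|Im z| <= cnorm z.
Proof.
rewrite -(@ler_pXn2r _ 2) ?nnegrE ?cnorm_ge0// cnorm_sqr real_normK ?num_real//.
by rewrite lerDr sqr_ge0.
Qed.

Lemma cnorm_sum (R : realType) (I : Type) (r : seq I) (P : pred I) (F : I -> R[i]%C) :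
  cnorm (\sum_(i <- r | P i) F i) <= \sum_(i <- r | P i) cnorm (F i).
Proof.
elim/big_rec2: _ => [|i x y _ h]; first by rewrite cnorm0.
by rewrite (le_trans (cnormD _ _))// lerD2l.
Qed.

Definition cexp {R : realType} (z : R[i]%C) : R[i]%C :=
  Complex (expR (Re z) * cos (Im z)) (expR (Re z) * sin (Im z)).

Lemma cexpD (R : realType) (z w : R[i]%C) : cexp (z + w) = cexp z * cexp w.
Proof.
case: z w => [a b] [c d]; apply/eqP; rewrite eq_complex /= expRD cosD sinD.
by apply/andP; split; apply/eqP; ring.
Qed.

Lemma cexp0 (R : realType) : cexp (0 : R[i]%C) = 1.
Proof. by rewrite /cexp /= expR0 cos0 sin0 !mul1r. Qed.

Lemma cnorm_cexp (R : realType) (z : R[i]%C) : cnorm (cexp z) = expR (Re z).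
Proof.
rewrite -[LHS]ger0_norm ?cnorm_ge0// -sqrtr_sqr cnorm_sqr /= !exprMn -mulrDr cos2Dsin2 mulr1.
by rewrite sqrtr_sqr ger0_norm ?expR_ge0.
Qed.

Lemma cexp_taylor (R : realType) (z : R[i]%C) : -1 <= Re z <= 2^-1 ->
  cnorm (cexp z - 1 - z) <= 4 * cnorm z ^+ 2.
Proof.
move=> hz; apply: (le_trans (cnorm_le _)); rewrite cnorm_sqr.
case: z hz => a b /= /andP[a1 a2].
have q := expR_le_quad a2; have l := expR_ge1Dx a.
have e2 : expR a <= 2 by nra.
have c1 := cos_ge_sqr b; have c2 := cos_le1 b.
have s1 := norm_sin_le b; have s2 := sin_sub_id_le b.
have r1 : `|expR a * cos b - 1 - a| <= 2 * a ^+ 2 + b ^+ 2.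
  have e0 := expR_ge0 a.
  by rewrite ler_norml; apply/andP; split; nra.
have ea : `|expR a - 1| <= 3 * `|a|.
  have an := normr_ge0 a; have aa := real_normK (num_real a).
  have [? ?] : a <= `|a| /\ - a <= `|a| by rewrite !ler_norm -normrN ler_norm.
  have : `|a| <= 1 by rewrite ler_norml; apply/andP; split; lra.
  by move=> ?; rewrite ler_norml; apply/andP; split; nra.
have r2 : `|expR a * sin b - 0 - b| <= 3 * (`|a| * `|b|) + b ^+ 2.
  rewrite (_ : _ - b = (expR a - 1) * sin b + (sin b - b)); last by ring.
  apply: (le_trans (ler_normD _ _)); apply: lerD => //.
  by rewrite normrM mulrA; exact: ler_pM.
have ab : `|a| * `|b| <= (a ^+ 2 + b ^+ 2) / 2.
  have := sqr_ge0 (`|a| - `|b|); rewrite sqrrB !real_normK ?num_real//; lra.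
have := lerD r1 r2; rewrite [X in `|X| + _]addrAC; move/le_trans; apply; lra.
Qed.

(** This is [n ^ (- w)]; since [ln 0 = 0], the value at [n = 0] is 1. *)
Definition npow {R : realType} (n : nat) (w : R[i]%C) : R[i]%C :=
  cexp (- (w * real_complex R (ln n%:R))).

Lemma Re_mul_real (R : realType) (w : R[i]%C) (x : R) : Re (w * real_complex R x) = Re w * x.
Proof. by case: w => a b /=; rewrite mulr0 subr0. Qed.

Lemma Im_mul_real (R : realType) (w : R[i]%C) (x : R) : Im (w * real_complex R x) = Im w * x.
Proof. by case: w => a b /=; rewrite mulr0 add0r. Qed.

Lemma ReN (R : realType) (w : R[i]%C) : Re (- w) = - Re w. Proof. by case: w. Qed.

Lemma ImN (R : realType) (w : R[i]%C) : Im (- w) = - Im w. Proof. by case: w. Qed.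

Lemma cnorm_npow (R : realType) n (w : R[i]%C) : cnorm (npow n w) = expR (- (Re w * ln n%:R)).
Proof. by rewrite cnorm_cexp ReN Re_mul_real. Qed.

Lemma ln_succ_bounds (R : realType) (n : nat) : (0 < n)%N ->
  let d := ln n.+1%:R - ln n%:R :> R in
  [/\ 0 <= d, d <= (n%:R : R)^-1, (n.+1%:R : R)^-1 <= d & (n%:R : R)^-1 - d <= (n%:R : R)^-1 ^+ 2].
Proof.
move=> n0 d; have n0' : (0 : R) < n%:R by rewrite ltr0n.
have dE : d = ln (1 + n%:R^-1).
  rewrite /d -ln_div ?posrE ?ltr0n//; congr ln.
  by rewrite -natr1; field; rewrite gt_eqF.
have x0 : 0 < n%:R^-1 :> R by rewrite invr_gt0.
have n1' : (0 : R) < n.+1%:R by rewrite ltr0n.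
have d1 : n.+1%:R^-1 <= d.
  have : ln (1 + - n.+1%:R^-1) <= - n.+1%:R^-1 :> R.
    by apply: le_ln1Dx; rewrite ltrN2 invf_lt1// ltr1n ltnS.
  rewrite (_ : 1 + - n.+1%:R^-1 = n%:R / n.+1%:R :> R); last first.
    by rewrite -natr1; field; rewrite natr1 gt_eqF.
  by rewrite ln_div ?posrE// -opprB -/d lerN2.
split.
- by rewrite dE ln_ge0// lerDl ltW.
- by rewrite dE le_ln1Dx//; lra.
- exact: d1.
- apply: (le_trans (lerB (lexx _) d1)).
  rewrite (_ : _ - _ = n%:R^-1 * n.+1%:R^-1); last first.
    by rewrite -natr1; field; rewrite natr1 !gt_eqF.
  by rewrite expr2 ler_wpM2l ?invr_ge0// lef_pV2 ?posrE// ler_nat.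
Qed.

Lemma rcB (R : realType) (x y : R) :
  real_complex R (x - y) = real_complex R x - real_complex R y.
Proof. exact: rmorphB. Qed.

Lemma rcD (R : realType) (x y : R) :
  real_complex R (x + y) = real_complex R x + real_complex R y.
Proof. exact: rmorphD. Qed.

Lemma rcM (R : realType) (x y : R) :
  real_complex R (x * y) = real_complex R x * real_complex R y.
Proof. exact: rmorphM. Qed.

(** A difference stands for the derivative of [x ^ (- w)]. The error is summable in [n], which lets
    sums of [n ^ (- 1 - w)] telescope once multiplied by [w]. *)
Lemma npow_diff (R : realType) (n : nat) (w : R[i]%C) : (0 < n)%N -> 0 <= Re w <= 1 ->
  cnorm (npow n w - npow n.+1 w - w * real_complex R n%:R^-1 * npow n w)
  <= (cnorm w + 4 * cnorm w ^+ 2) * (n%:R^-1 ^+ 2 * expR (- (Re w * ln n%:R))).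
Proof.
move=> n0 /andP[w0 w1]; have [d0 d1 _ d2] := ln_succ_bounds R n0.
set d := _ - _ in d0 d1 d2; set x := n%:R^-1 in d1 d2 *.
have x1 : x <= 1 by rewrite invf_le1 ?ltr0n// ler1n.
have npS : npow n.+1 w = npow n w * cexp (- (w * real_complex R d)).
  rewrite /npow -cexpD; congr cexp.
  by rewrite /d rcB; ring.
have h : cnorm (cexp (- (w * real_complex R d)) - 1 - - (w * real_complex R d))
    <= 4 * cnorm (- (w * real_complex R d)) ^+ 2.
  apply: cexp_taylor; rewrite ReN Re_mul_real.
  by apply/andP; split; nra.
rewrite (_ : _ - _ - _ = - npow n w * ((cexp (- (w * real_complex R d)) - 1 - - (w * real_complex R d))
   + w * real_complex R (x - d))); last first.
  by rewrite npS (rcB x d); ring.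
rewrite cnormM cnormN cnorm_npow mulrA [leRHS]mulrC ler_wpM2l ?expR_ge0//.
apply: (le_trans (cnormD _ _)); rewrite addrC mulrDl; apply: lerD.
  rewrite cnormM cnorm_real ger0_norm ?subr_ge0// ler_wpM2l ?cnorm_ge0//.
apply: (le_trans h); rewrite cnormN cnormM cnorm_real (ger0_norm d0) exprMn mulrA.
by rewrite ler_wpM2l ?mulr_ge0 ?cnorm_ge0// ler_pXn2r ?nnegrE ?invr_ge0.
Qed.

(** * Chebyshev and Mertens estimates *)

Lemma sum_inv_sqr_le (R : realType) (a b : nat) : (0 < a)%N ->
  \sum_(a.+1 <= n < b.+1) (n%:R^-1 ^+ 2 : R) <= a%:R^-1.
Proof.
move=> a0; case: (leqP b a) => ba; first by rewrite big_geq ?ltnS// invr_ge0.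
apply: (@le_trans _ _ (\sum_(a.+1 <= n < b.+1) ((fun n => - n.-1%:R^-1) n.+1 - (fun n => - n.-1%:R^-1) n : R))).
  rewrite big_nat [leRHS]big_nat; apply: ler_sum => n /andP[an _] /=.
  case: n an => [//|n] an /=; have n0 : (0 : R) < n%:R by rewrite ltr0n (leq_trans a0).
  have n1 : (0 : R) < n.+1%:R by rewrite ltr0n.
  rewrite (_ : _ - _ = n%:R^-1 * n.+1%:R^-1); last first.
    by rewrite -natr1; field; rewrite natr1 !gt_eqF.
  by rewrite expr2 ler_wpM2r ?invr_ge0// lef_pV2 ?posrE// ler_nat.
rewrite telescope_sumr ?ltnS 1?ltnW//= opprK addrC gerDl oppr_le0 invr_ge0//.
Qed.

Lemma sum_inv_sqr_le2 (R : realType) (b : nat) :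
  \sum_(1 <= n < b.+1) (n%:R^-1 ^+ 2 : R) <= 2.
Proof.
case: b => [|b]; first by rewrite big_geq.
rewrite big_ltn// invr1 expr1n (_ : 2 = 1 + 1^-1); last by rewrite invr1.
by rewrite lerD2l; exact: (@sum_inv_sqr_le R 1 b.+1).
Qed.

Lemma sum_inv_32_le (R : realType) (b : nat) :
  \sum_(1 <= n < b.+1) ((n%:R * Num.sqrt n%:R)^-1 : R) <= 3.
Proof.
case: b => [|b]; first by rewrite big_geq.
rewrite big_ltn// sqrtr1 mulr1 invr1 (_ : 3 = 1 + 2); last by ring.
rewrite lerD2l.
apply: (@le_trans _ _ (\sum_(2 <= n < b.+2) ((fun n => - (2 / Num.sqrt n.-1%:R)) n.+1 -
   (fun n => - (2 / Num.sqrt n.-1%:R)) n : R))).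
  rewrite big_nat [leRHS]big_nat; apply: ler_sum => n /andP[an _] /=.
  case: n an => [//|n] an /=; have n0 : (0 : R) < n%:R by rewrite ltr0n.
  have n1 : (0 : R) < n.+1%:R by rewrite ltr0n.
  have := sqr_sqrtr (ltW n0); have := sqr_sqrtr (ltW n1).
  have := ltr0n R n.+1; rewrite /= -sqrtr_gt0; have := n0; rewrite -sqrtr_gt0.
  rewrite -natr1; set x := Num.sqrt _; set y := Num.sqrt _ => x0 y0 hy hx.
  rewrite -hy (_ : - (2 / y) - - (2 / x) = 2 * (y - x) / (x * y)); last first.
    by field; rewrite !gt_eqF.
  have xy : 0 < x * y by rewrite mulr_gt0.
  rewrite ler_pdivlMr// mulrC ler_pdivrMr; last by rewrite mulr_gt0// exprn_gt0.
  have e1 : y ^+ 2 - x ^+ 2 = 1 by rewrite hx hy; ring.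
  have lxy : x <= y by rewrite -(@ler_pXn2r _ 2) ?nnegrE ?ltW//; lra.
  have : (y - x) * (y + x) = 1 by rewrite -e1; ring.
  (* Multiplying by [(y - x) * (y + x) = 1] makes the inequality homogeneous, and the difference
     then factors. *)
  move=> hd; have hh : x * y = x * y * ((y - x) * (y + x)) by rewrite hd mulr1.
  rewrite hh -subr_ge0.
  rewrite (_ : _ - _ = y * (y - x) ^+ 2 * (2 * y + x)); last by ring.
  by apply: mulr_ge0; [apply: mulr_ge0; [exact: ltW|exact: sqr_ge0]|lra].
rewrite telescope_sumr//= sqrtr1 invr1 mulr1 opprK addrC gerDl oppr_le0.
by rewrite divr_ge0// sqrtr_ge0.
Qed.

Lemma sum_multiples (V : nmodType) (N d : nat) (F : nat -> V) : (0 < d)%N ->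
  \sum_(1 <= n < N.+1 | (d %| n)%N) F n = \sum_(1 <= m < (N %/ d).+1) F (d * m)%N.
Proof.
move=> d0; elim: N => [|N IH]; first by rewrite div0n !big_geq.
rewrite big_mkcond big_nat_recr//= -big_mkcond IH divnS//.
case: ifP => dN; last by rewrite add0n addr0.
rewrite add1n [RHS]big_nat_recr//=; congr (_ + F _).
by rewrite -(divnK dN) mulnC divnS// dN.
Qed.

(** The exponent [logn p n] counts the [k >= 1] with [p ^ k] dividing [n], so this is the
    convolution identity for von Mangoldt's function. Real values serve the estimates of Chebyshev
    and Mertens, complex ones the twisted sums. A bound [M] beyond [N] allows two different [N] to
    be compared over the same primes. *)
Lemma sum_log_weights (K : comNzRingType) (N M : nat) (lg a : nat -> K) : (N <= M)%N ->
  (forall n, (0 < n <= N)%N ->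
    lg n = \sum_(1 <= p < M.+1 | prime p) (logn p n)%:R * lg p) ->
  \sum_(1 <= n < N.+1) lg n * a n =
  \sum_(1 <= p < M.+1 | prime p) lg p *
    \sum_(1 <= k < M.+1) \sum_(1 <= m < (N %/ p ^ k).+1) a (p ^ k * m)%N.
Proof.
move=> NM hlg.
transitivity (\sum_(1 <= n < N.+1) \sum_(1 <= p < M.+1 | prime p)
   lg p * \sum_(1 <= k < M.+1) (if (p ^ k %| n)%N then a n else 0)).
  rewrite big_nat [RHS]big_nat; apply: eq_bigr => n /andP[n0 nN].
  rewrite hlg ?n0// mulr_suml; apply: eq_bigr => p pp.
  rewrite mulrAC mulrC; congr (_ * _).
  rewrite logn_count_dvd// natr_sum mulr_suml.
  rewrite (@big_cat_nat _ _ _ n 1 M.+1)//=; last by rewrite (leq_trans (ltnW nN)).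
  rewrite [X in _ = _ + X]big_nat [X in _ = _ + X]big1 ?addr0.
    by apply: eq_bigr => k _; case: ifP => _; rewrite ?mul1r ?mul0r.
  move=> k /andP[nk _]; case: ifP => // /(dvdn_leq n0).
  by rewrite leqNgt (leq_ltn_trans nk)// ltn_expl// prime_gt1.
rewrite exchange_big_nat/=; apply: eq_bigr => p pp; rewrite -mulr_sumr; congr (_ * _).
rewrite exchange_big_nat/=; apply: eq_bigr => k _.
by rewrite -big_mkcond sum_multiples// expn_gt0 prime_gt0.
Qed.

Lemma ln_prime_decomp (R : realType) (M n : nat) : (0 < n <= M)%N ->
  ln n%:R = \sum_(1 <= p < M.+1 | prime p) (logn p n)%:R * ln p%:R :> R.
Proof.
case/andP => n0 nM.
have key m : ln (\prod_(1 <= p < m) p ^ logn p n)%:R =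
    \sum_(1 <= p < m | prime p) (logn p n)%:R * ln p%:R :> R.
  rewrite [RHS]big_mkcond; elim: m => [|m IH]; first by rewrite !big_geq// ln1.
  case: m IH => [|m] IH; first by rewrite !big_geq// ln1.
  have pos : (0 < \prod_(1 <= i < m.+1) i ^ logn i n)%N.
    by rewrite big_nat prodn_cond_gt0// => i /andP[i0 _].
  rewrite [in LHS]big_nat_recr//= [in RHS]big_nat_recr//= natrM lnM ?posrE ?ltr0n ?expn_gt0//.
  rewrite IH; congr (_ + _); case: ifP => pp.
    by rewrite natrX lnXn ?ltr0n// mulr_natl.
  by rewrite lognE pp/= expn0 ln1.
rewrite -key -{1}(partnT n0) (widen_partn _ nM).
rewrite (eq_bigl xpredT)// big_ltn// lognE/= expn0 mul1n//.
Qed.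

Lemma ln_le_2sqrt (R : realType) (n : nat) : ln n%:R <= 2 * Num.sqrt n%:R :> R.
Proof.
case: n => [|n]; first by rewrite ln0// sqrtr0 mulr0.
have n0 : (0 : R) < n.+1%:R by rewrite ltr0n.
rewrite -{1}(sqr_sqrtr (ltW n0)) lnXn ?sqrtr_gt0// -[leLHS]mulr_natl ler_wpM2l//.
by rewrite ltW// ln_sublinear// sqrtr_gt0.
Qed.

Lemma ln_nat_ge0 (R : realType) (n : nat) : 0 <= ln n%:R :> R.
Proof. by case: n => [|n]; [rewrite ln0|rewrite ln_ge0// ler1n]. Qed.

Lemma sum_ln_ge (R : realType) (N : nat) :
  N%:R * ln N%:R - N%:R <= \sum_(1 <= n < N.+1) ln n%:R :> R.
Proof.
elim: N => [|N IH]; first by rewrite big_geq// mul0r subr0.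
rewrite big_nat_recr//= -lerBlDr; apply: le_trans IH.
case: N => [|N]; first by rewrite mul1r mul0r ln1; lra.
have [d0 d1 d2 d3] := @ln_succ_bounds R N.+1 isT.
have N0 : (0 : R) < N.+1%:R by rewrite ltr0n.
have : N.+1%:R * (ln N.+2%:R - ln N.+1%:R) <= 1 :> R.
  by rewrite -[leRHS](divff (lt0r_neq0 N0)) ler_wpM2l// ltW.
rewrite -[N.+2%:R]natr1; lra.
Qed.

Lemma sum_ln_le (R : realType) (N : nat) : (0 < N)%N ->
  \sum_(1 <= n < N.+1) ln n%:R <= N%:R * ln N%:R - N%:R + ln N%:R + 1 :> R.
Proof.
elim: N => [//|N IH] _; rewrite big_nat_recr//=.
case: N IH => [|N] IH; first by rewrite big_geq// ln1; lra.
have [d0 d1 d2 d3] := @ln_succ_bounds R N.+1 isT.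
have N0 : (0 : R) < N.+2%:R by rewrite ltr0n.
have : 1 <= N.+2%:R * (ln N.+2%:R - ln N.+1%:R) :> R.
  by rewrite -[leLHS](divff (lt0r_neq0 N0)) ler_wpM2l// ltW.
have := IH isT; rewrite -[N.+2%:R]natr1; lra.
Qed.

Lemma sum_ln_primes (R : realType) (N M : nat) : (N <= M)%N ->
  \sum_(1 <= n < N.+1) ln n%:R =
  \sum_(1 <= p < M.+1 | prime p) ln p%:R * \sum_(1 <= k < M.+1) (N %/ p ^ k)%:R :> R.
Proof.
move=> NM; transitivity (\sum_(1 <= n < N.+1) ln n%:R * 1 : R).
  by apply: eq_bigr => n _; rewrite mulr1.
rewrite (@sum_log_weights _ N M (fun n => ln n%:R : R) (fun=> 1) NM).
  apply: eq_bigr => p _; congr (_ * _); apply: eq_bigr => k _.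
  by rewrite sumr_const_nat subn1.
by move=> n /andP[n0 nN]; apply: ln_prime_decomp; rewrite n0 (leq_trans nN).
Qed.

(** The logarithm of the central binomial coefficient of [2 m] is at most [4 m], and by Legendre's
    formula every prime in [(m, 2 m]] contributes its logarithm to it. *)
Lemma chebyshev_step (R : realType) (m : nat) : (0 < m)%N ->
  \sum_(1 <= p < m.*2.+1 | prime p) ln p%:R <=
  \sum_(1 <= p < m.+1 | prime p) ln p%:R + 4 * m%:R :> R.
Proof.
move=> m0.
have m2 : (m <= m.*2)%N by rewrite -addnn leq_addr.
have h1 := sum_ln_primes R m2; have h2 := sum_ln_primes R (leqnn m.*2).
have key : \sum_(1 <= p < m.*2.+1 | prime p) ln p%:R - \sum_(1 <= p < m.+1 | prime p) ln p%:R
   <= \sum_(1 <= n < m.*2.+1) ln n%:R - 2 * \sum_(1 <= n < m.+1) ln n%:R :> R.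
  rewrite h1 h2 (@big_cat_nat _ _ _ m.+1 1 m.*2.+1)//= addrAC subrr add0r.
  rewrite mulr_sumr -sumrB.
  rewrite [leRHS](@big_cat_nat _ _ _ m.+1 1 m.*2.+1)//=.
  have tge p k : (2 * (m %/ p ^ k)%:R <= (m.*2 %/ p ^ k)%:R :> R).
    rewrite -natrM ler_nat -mul2n; have [->|d0] := posnP (p ^ k); first by rewrite !divn0.
    by rewrite leq_divRL// -mulnA leq_mul2l leq_trunc_div.
  apply: ler_wpDl.
    apply: sumr_ge0 => p _; rewrite mulrCA -mulrBr mulr_ge0 ?ln_nat_ge0//.
    by rewrite mulr_sumr -sumrB sumr_ge0// => k _; rewrite subr_ge0.
  rewrite big_nat_cond [leRHS]big_nat_cond; apply: ler_sum => p /andP[/andP[p1 p2] pp].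
  rewrite mulrCA -mulrBr ler_peMr ?ln_nat_ge0// mulr_sumr -sumrB big_ltn ?ltnS ?double_gt0//.
  have -> : (m %/ p ^ 1 = 0)%N by rewrite expn1 divn_small.
  rewrite expn1 mulr0 subr0 -[leLHS]addr0; apply: lerD.
    by rewrite ler1n divn_gt0 ?prime_gt0.
  by rewrite sumr_ge0// => k _; rewrite subr_ge0.
rewrite -lerBlDl; apply: (le_trans key).
have u := @sum_ln_le R m.*2; rewrite double_gt0 in u; have {}u := u m0.
have l := sum_ln_ge R m.
have mr : (0 : R) < m%:R by rewrite ltr0n.
have e2 : m.*2%:R = 2 * m%:R :> R by rewrite -mul2n natrM.
have l2 : ln (2 * m%:R) = ln 2 + ln m%:R :> R by rewrite lnM ?posrE.
have ln2 : ln 2 <= 1 :> R by rewrite (_ : 2 = 1 + 1)//; exact: le_ln1Dx.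
have lm : ln m%:R <= m%:R - 1 :> R.
  by rewrite [X in ln X](_ : _ = 1 + (m%:R - 1)); [apply: le_ln1Dx; lra|ring].
have m1 : (1 : R) <= m%:R by rewrite ler1n.
move: u; rewrite e2 l2.
have : m%:R * ln 2 <= m%:R :> R by rewrite ler_piMr// ltW.
lra.
Qed.

Lemma chebyshev (R : realType) (n : nat) :
  \sum_(1 <= p < n.+1 | prime p) ln p%:R <= 8 * n%:R :> R.
Proof.
elim/ltn_ind: n => n IH; case: (leqP n 2) => n2.
  case: n n2 {IH} => [|[|[|//]]] _.
  - by rewrite big_geq// mulr0.
  - by rewrite big_mkcond big_nat1 /= mulr1.
  - rewrite big_mkcond big_ltn// big_nat1 /= add0r.
    have : ln 2 <= 1 :> R by rewrite (_ : 2 = 1 + 1)//; exact: le_ln1Dx.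
    by lra.
have u2 : (uphalf n < n)%N by rewrite ltn_uphalf_double -addnn; lia.
have nu : (n <= (uphalf n).*2)%N by rewrite -leq_uphalf_double.
have u0 : (0 < uphalf n)%N by rewrite uphalf_gt0; lia.
apply: (@le_trans _ _ (\sum_(1 <= p < (uphalf n).*2.+1 | prime p) ln p%:R)).
  rewrite [leRHS](@big_cat_nat _ _ _ n.+1)//= lerDl sumr_ge0// => p _; exact: ln_nat_ge0.
apply: (le_trans (chebyshev_step R u0)).
have := IH _ u2.
(* Passing from [n] to its half [u], rounded up, gives [8 * u + 4 * u]; the rounding is harmless
   from [n = 3] on. *)
have : (12 * uphalf n <= 8 * n)%N.
  rewrite uphalf_half; move: (odd_double_half n) n2; case: (odd n) => /=; lia.
rewrite -(ler_nat R) !natrM; lra.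
Qed.

(** Since [ln p <= 2 sqrt p] and the geometric tail is at most [2 / p ^ 2], each prime contributes
    at most [4 p ^ (-3/2)]. *)
Lemma sum_prime_powers_le (R : realType) (M K : nat) :
  \sum_(1 <= p < M.+1 | prime p) ln p%:R * \sum_(2 <= k < K) ((p ^ k)%:R)^-1 <= 12 :> R.
Proof.
apply: (@le_trans _ _ (4 * \sum_(1 <= n < M.+1) ((n%:R * Num.sqrt n%:R)^-1 : R))); last first.
  by have := sum_inv_32_le R M; lra.
rewrite big_mkcond mulr_sumr big_nat [leRHS]big_nat; apply: ler_sum => p /andP[p0 _].
have p0' : (0 : R) < p%:R by rewrite ltr0n.
have s0 : 0 < Num.sqrt p%:R :> R by rewrite sqrtr_gt0.
case: ifP => pp; last by rewrite mulr_ge0// invr_ge0 mulr_ge0// ltW.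
have p2 : (2 : R) <= p%:R by rewrite ler_nat prime_gt1.
have inner : \sum_(2 <= k < K) ((p ^ k)%:R)^-1 <= 2 * (p%:R ^+ 2)^-1 :> R.
  case: (leqP K 2) => K2; first by rewrite big_geq// mulr_ge0// invr_ge0 exprn_ge0// ltW.
  apply: (@le_trans _ _ (\sum_(2 <= k < K) (- (2 * (p%:R ^+ k.+1)^-1) - - (2 * (p%:R ^+ k)^-1)) : R)).
    apply: ler_sum => k _; rewrite natrX exprS.
    have q0 : 0 < (p%:R ^+ k : R) by rewrite exprn_gt0.
    rewrite invfM -subr_ge0.
    rewrite [X in 0 <= X](_ : _ = (p%:R ^+ k)^-1 * (1 - 2 * p%:R^-1)); last by ring.
    by rewrite mulr_ge0 ?invr_ge0 ?(ltW q0)// subr_ge0 ler_pdivrMr// mul1r.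
  rewrite (@telescope_sumr _ 2 K (fun k => - (2 * (p%:R ^+ k)^-1)))// 1?ltnW//.
  by rewrite opprK addrC gerDl oppr_le0 mulr_ge0// invr_ge0 exprn_ge0// ltW.
apply: (le_trans (ler_pM (ln_nat_ge0 _ _) _ (ln_le_2sqrt R p) inner)).
  by apply: sumr_ge0 => k _; rewrite invr_ge0.
rewrite le_eqVlt; apply/orP; left; apply/eqP.
have := sqr_sqrtr (ltW p0'); set s := Num.sqrt _ in s0 * => <-.
by field; rewrite gt_eqF.
Qed.

(** Legendre's formula for [ln N!] is split as [N * A - B + C]: [B] is the effect of rounding
    [N / p], controlled by Chebyshev, and [C] collects the higher prime powers. *)
Lemma mertens (R : realType) (N : nat) : (0 < N)%N ->
  `|\sum_(1 <= p < N.+1 | prime p) ln p%:R / p%:R - ln N%:R| <= 13 :> R.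
Proof.
move=> N0; have h := sum_ln_primes R (leqnn N).
have Nr : (0 : R) < N%:R by rewrite ltr0n.
have u := sum_ln_le R N0; have l := sum_ln_ge R N.
have u' : \sum_(1 <= n < N.+1) ln n%:R <= N%:R * ln N%:R :> R.
  apply: (@le_trans _ _ (\sum_(1 <= n < N.+1) ln N%:R)); last first.
    by rewrite sumr_const_nat subn1 mulr_natl.
  rewrite big_nat [leRHS]big_nat.
  by apply: ler_sum => n /andP[n0 nN]; rewrite ler_ln ?posrE ?ltr0n// ler_nat.
set A := \sum_(1 <= p < N.+1 | prime p) ln p%:R / p%:R.
pose B : R := \sum_(1 <= p < N.+1 | prime p) ln p%:R * (N%:R / p%:R - (N %/ p)%:R).
pose C : R := \sum_(1 <= p < N.+1 | prime p) ln p%:R * \sum_(2 <= k < N.+1) (N %/ p ^ k)%:R.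
have E : \sum_(1 <= n < N.+1) ln n%:R = N%:R * A - B + C :> R.
  rewrite h /A /B /C mulr_sumr -sumrB -big_split /=; apply: eq_bigr => p pp.
  by rewrite big_ltn// expn1; ring.
have B0 : 0 <= B.
  rewrite /B big_nat_cond sumr_ge0// => p /andP[/andP[p0 _] _].
  rewrite mulr_ge0 ?ln_nat_ge0// subr_ge0 ler_pdivlMr ?ltr0n// -natrM ler_nat.
  exact: leq_trunc_div.
have B8 : B <= 8 * N%:R.
  apply: le_trans (chebyshev R N); rewrite /B big_nat_cond [leRHS]big_nat_cond.
  apply: ler_sum => p /andP[/andP[p0 _] _]; rewrite ler_piMr ?ln_nat_ge0//.
  rewrite lerBlDr ler_pdivrMr ?ltr0n// addrC natr1 -natrM ler_nat.
  by rewrite ltnW// ltn_ceil.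
have C0 : 0 <= C.
  by rewrite sumr_ge0// => p _; rewrite mulr_ge0 ?ln_nat_ge0// sumr_ge0.
have C12 : C <= 12 * N%:R.
  apply: (@le_trans _ _ (N%:R * \sum_(1 <= p < N.+1 | prime p)
      ln p%:R * \sum_(2 <= k < N.+1) ((p ^ k)%:R)^-1)).
    rewrite /C mulr_sumr big_nat_cond [leRHS]big_nat_cond; apply: ler_sum => p /andP[/andP[p0 _] _].
    rewrite mulrCA ler_wpM2l ?ln_nat_ge0// mulr_sumr; apply: ler_sum => k _.
    rewrite ler_pdivlMr ?ltr0n ?expn_gt0 ?p0// -natrM ler_nat; exact: leq_trunc_div.
  by rewrite [leLHS]mulrC ler_wpM2r ?(ltW Nr) ?sum_prime_powers_le.
have Nn : N%:R * A - N%:R * ln N%:R = N%:R * (A - ln N%:R) by rewrite mulrBr.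
by rewrite ler_norml; apply/andP; split; rewrite -(ler_pM2l Nr); lra.
Qed.

(** * Twisted sums over primes *)

Definition npow_err {R : realType} (w : R[i]%C) (n : nat) : R[i]%C :=
  npow n w - npow n.+1 w - w * real_complex R n%:R^-1 * npow n w.

Definition twisted_harmonic {R : realType} (w : R[i]%C) (z : nat) : R[i]%C :=
  \sum_(1 <= n < z.+1) real_complex R n%:R^-1 * npow n w.

Lemma npow1 (R : realType) (w : R[i]%C) : npow 1 w = 1.
Proof. by rewrite /npow ln1 /real_complex_def /= mulr0 oppr0 cexp0. Qed.

Lemma npowM (R : realType) (m n : nat) (w : R[i]%C) : (0 < m)%N -> (0 < n)%N ->
  npow (m * n) w = npow m w * npow n w.
Proof.
move=> m0 n0; rewrite /npow -cexpD; congr cexp.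
by rewrite natrM lnM ?posrE ?ltr0n// rcD; ring.
Qed.

Lemma cnorm_npow_le1 (R : realType) n (w : R[i]%C) : 0 <= Re w -> cnorm (npow n w) <= 1.
Proof.
by move=> w0; rewrite cnorm_npow expR_le1 oppr_le0 mulr_ge0// ln_nat_ge0.
Qed.

(** A partial-sum version of [zeta (1 + w) = 1 / w + O (1)]; the truncation appears as the power of
    [z + 1]. *)
Lemma twisted_harmonicE (R : realType) (w : R[i]%C) (z : nat) :
  w * twisted_harmonic w z = 1 - npow z.+1 w - \sum_(1 <= n < z.+1) npow_err w n.
Proof.
rewrite /twisted_harmonic; elim: z => [|z IH]; first by rewrite !big_geq// npow1 mulr0; ring.
rewrite [in LHS]big_nat_recr//= [in RHS]big_nat_recr//= mulrDr IH /npow_err; ring.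
Qed.

Lemma cnorm_sum_err (R : realType) (w : R[i]%C) (a b : nat) :
  0 <= Re w <= 1 -> cnorm w <= 1 -> (0 < a)%N ->
  cnorm (\sum_(a <= n < b) npow_err w n) <= 5 * cnorm w * \sum_(a <= n < b) n%:R^-1 ^+ 2.
Proof.
move=> w01 w1 a0; apply: (le_trans (cnorm_sum _ _ _)); rewrite mulr_sumr.
rewrite big_nat [leRHS]big_nat; apply: ler_sum => n /andP[an _].
have n0 := leq_trans a0 an; apply: (le_trans (npow_diff n0 w01)).
have q := cnorm_ge0 w.
have s0 : 0 <= n%:R^-1 ^+ 2 :> R by rewrite sqr_ge0.
have e1 : expR (- (Re w * ln n%:R)) <= 1 :> R.
  by case/andP: w01 => ? _; rewrite expR_le1 oppr_le0 mulr_ge0// ln_nat_ge0.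
have e0 := expR_ge0 (- (Re w * ln n%:R)).
apply: ler_pM; [nra|exact: mulr_ge0|nra|by rewrite ler_piMr].
Qed.

Lemma twisted_harmonic_le (R : realType) (w : R[i]%C) (z : nat) :
  0 <= Re w <= 1 -> cnorm w <= 1 -> cnorm (w * twisted_harmonic w z) <= 12.
Proof.
move=> w01 w1; rewrite twisted_harmonicE.
have h1 := cnorm_sum_err z.+1 w01 w1 (isT : (0 < 1)%N).
have h2 := sum_inv_sqr_le2 R z.
have w0 : 0 <= Re w by case/andP: w01.
have h3 := cnorm_npow_le1 z.+1 w0.
have q := cnorm_ge0 w.
have h4 : 5 * cnorm w * \sum_(1 <= n < z.+1) n%:R^-1 ^+ 2 <= 5 * 2 :> R.
  by apply: ler_pM => //; [rewrite mulr_ge0|rewrite sumr_ge0// => i _; rewrite sqr_ge0|lra].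
apply: (le_trans (cnormB _ _)); have := cnormB 1 (npow z.+1 w); rewrite cnorm1; lra.
Qed.

Lemma cos_sub_le (R : realType) (a b : R) : `|cos b - cos a| <= `|b - a|.
Proof.
rewrite -!sinDpihalf; apply: (le_trans (sin_sub_le _ _)).
by rewrite opprD addrACA subrr addr0.
Qed.

Lemma npow_imag (R : realType) (u : R) (k : nat) :
  npow k (Complex 0 u) = Complex (cos (- (u * ln k%:R))) (sin (- (u * ln k%:R))).
Proof.
by rewrite /npow /cexp ReN ImN Re_mul_real Im_mul_real /= mul0r oppr0 expR0 !mul1r.
Qed.

Lemma npow_imag_sub (R : realType) (u : R) (m n : nat) :
  cnorm (npow m (Complex 0 u) - npow n (Complex 0 u)) <= 2 * (`|u| * `|ln m%:R - ln n%:R|).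
Proof.
rewrite !npow_imag; apply: (le_trans (cnorm_le _)) => /=.
have h : `|- (u * ln m%:R) - - (u * ln n%:R)| = `|u| * `|ln m%:R - ln n%:R|.
  by rewrite -normrM -normrN; congr `|_|; ring.
have := cos_sub_le (- (u * ln n%:R)) (- (u * ln m%:R)).
have := sin_sub_le (- (u * ln n%:R)) (- (u * ln m%:R)).
rewrite h; lra.
Qed.

Lemma sum_ln_sqr_le (R : realType) (N : nat) :
  \sum_(1 <= n < N.+1) ln n%:R * n%:R^-1 ^+ 2 <= 6 :> R.
Proof.
have := sum_inv_32_le R N.
suff : \sum_(1 <= n < N.+1) ln n%:R * n%:R^-1 ^+ 2 <=
   2 * \sum_(1 <= n < N.+1) ((n%:R * Num.sqrt n%:R)^-1 : R) by lra.
rewrite mulr_sumr big_nat [leRHS]big_nat; apply: ler_sum => n /andP[n0 _].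
have n0' : (0 : R) < n%:R by rewrite ltr0n.
apply: (le_trans (ler_wpM2r (sqr_ge0 _) (ln_le_2sqrt R n))).
have s0 : 0 < Num.sqrt n%:R :> R by rewrite sqrtr_gt0.
rewrite le_eqVlt; apply/orP; left; apply/eqP.
have := sqr_sqrtr (ltW n0'); set s := Num.sqrt _ in s0 * => <-.
by field; rewrite gt_eqF.
Qed.

(** Summation by parts against [ln n], whose increments are [1 / n + O (1 / n ^ 2)]. Apart from the
    truncation term in [ln N], this mirrors the fact that [- w zeta' (1 + w)] is close to
    [zeta (1 + w)] near the pole. *)
Lemma sum_ln_npow (R : realType) (u : R) (N : nat) : 0 < u <= 1 -> (0 < N)%N ->
  cnorm (Complex 0 u * \sum_(1 <= n < N.+1)
      real_complex R (ln n%:R) * (real_complex R n%:R^-1 * npow n (Complex 0 u))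
    + real_complex R (ln N%:R) * npow N (Complex 0 u)
    - twisted_harmonic (Complex 0 u) N) <= 39.
Proof.
case/andP => u0 u1 N0; set w := Complex 0 u.
have cw : cnorm w = u by rewrite /cnorm /= expr0n add0r sqrtr_sqr gtr0_norm.
have Rw : Re w = 0 by [].
have w01 : 0 <= Re w <= 1 by rewrite Rw lexx ler01.
pose d n : R := ln n.+1%:R - ln n%:R.
have E1 M : \sum_(1 <= n < M.+1) real_complex R (ln n%:R) * (npow n w - npow n.+1 w) =
   \sum_(1 <= n < M.+1) real_complex R (d n) * npow n.+1 w - real_complex R (ln M.+1%:R) * npow M.+1 w.
  elim: M => [|M IH].
    by rewrite !big_geq// ln1 /real_complex_def /= mul0r subr0.
  by rewrite [in LHS]big_nat_recr//= [in RHS]big_nat_recr//= IH /d rcB; ring.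
have E2 : w * \sum_(1 <= n < N.+1) real_complex R (ln n%:R) * (real_complex R n%:R^-1 * npow n w)
   = \sum_(1 <= n < N.+1) real_complex R (ln n%:R) * (npow n w - npow n.+1 w)
     - \sum_(1 <= n < N.+1) real_complex R (ln n%:R) * npow_err w n.
  rewrite mulr_sumr -sumrB; apply: eq_bigr => n _; rewrite /npow_err; ring.
rewrite E2 E1.
set A := \sum_(1 <= n < N.+1) real_complex R (d n) * _.
set B := \sum_(1 <= n < N.+1) _ * npow_err w n.
have hB : cnorm B <= 30 * u.
  apply: (le_trans (cnorm_sum _ _ _)).
  apply: (@le_trans _ _ (5 * u * \sum_(1 <= n < N.+1) ln n%:R * n%:R^-1 ^+ 2)); last first.
    by have := sum_ln_sqr_le R N; nra.
  rewrite mulr_sumr big_nat [leRHS]big_nat; apply: ler_sum => n /andP[n0 _].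
  rewrite cnormM cnorm_real ger0_norm ?ln_nat_ge0// mulrCA ler_wpM2l ?ln_nat_ge0//.
  apply: (le_trans (npow_diff n0 w01)); rewrite Rw mul0r oppr0 expR0 mulr1 cw.
  by rewrite ler_wpM2r ?sqr_ge0//; nra.
have hA : cnorm (A - twisted_harmonic w N) <= 2 * (2 * u + 1).
  rewrite /A /twisted_harmonic -sumrB; apply: (le_trans (cnorm_sum _ _ _)).
  apply: (@le_trans _ _ ((2 * u + 1) * \sum_(1 <= n < N.+1) n%:R^-1 ^+ 2)); last first.
    by rewrite mulrC ler_wpM2r ?sum_inv_sqr_le2//; lra.
  rewrite mulr_sumr big_nat [leRHS]big_nat; apply: ler_sum => n /andP[n0 _].
  have [d0 d1 _ d2] := ln_succ_bounds R n0; rewrite -/(d n) in d0 d1 d2.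
  rewrite (_ : _ - _ = real_complex R (d n) * (npow n.+1 w - npow n w) -
     real_complex R (n%:R^-1 - d n) * npow n w); last by rewrite (rcB n%:R^-1 (d n)); ring.
  apply: (le_trans (cnormB _ _)); rewrite !cnormM !cnorm_real mulrDl; apply: lerD.
    have := npow_imag_sub u n.+1 n; rewrite -/w -/(d n) gtr0_norm// (ger0_norm d0) => h.
    apply: (le_trans (ler_wpM2l d0 h)).
    rewrite (_ : d n * _ = 2 * u * d n ^+ 2); last by ring.
    by rewrite ler_wpM2l ?mulr_ge0 ?(ltW u0)// ler_pXn2r ?nnegrE ?invr_ge0.
  rewrite cnorm_npow Rw mul0r oppr0 expR0 mulr1 mul1r ger0_norm ?subr_ge0//.
have hN : cnorm (real_complex R (ln N.+1%:R) * npow N.+1 w - real_complex R (ln N%:R) * npow N w) <= 1 + 2 * u.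
  have [d0 d1 _ d2] := ln_succ_bounds R N0; rewrite -/(d N) in d0 d1 d2.
  rewrite (_ : _ - _ = real_complex R (d N) * npow N.+1 w +
     real_complex R (ln N%:R) * (npow N.+1 w - npow N w)); last by rewrite /d rcB; ring.
  have N0' : (0 : R) < N%:R by rewrite ltr0n.
  have N1 : N%:R^-1 <= 1 :> R by rewrite invf_le1// ler1n.
  apply: (le_trans (cnormD _ _)); rewrite !cnormM !cnorm_real; apply: lerD.
    by rewrite cnorm_npow Rw mul0r oppr0 expR0 mulr1 ger0_norm//; lra.
  have := npow_imag_sub u N.+1 N; rewrite -/w -/(d N) gtr0_norm// (ger0_norm d0) => h.
  rewrite ger0_norm ?ln_nat_ge0//; apply: (le_trans (ler_wpM2l (ln_nat_ge0 _ _) h)).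
  have lN : ln N%:R * d N <= 1.
    apply: (@le_trans _ _ (N%:R * N%:R^-1)); last by rewrite divff// gt_eqF.
    by apply: ler_pM => //; [exact: ln_nat_ge0|rewrite ltW// ln_sublinear].
  rewrite (_ : ln N%:R * (2 * (u * d N)) = 2 * u * (ln N%:R * d N)); last by ring.
  by rewrite ler_piMr// mulr_ge0// ltW.
rewrite (_ : _ - twisted_harmonic w N = (A - twisted_harmonic w N) - B -
   (real_complex R (ln N.+1%:R) * npow N.+1 w - real_complex R (ln N%:R) * npow N w)); last by ring.
apply: (le_trans (cnormB _ _)); have := cnormB (A - twisted_harmonic w N) B; lra.
Qed.

Lemma ln_sub_le (R : realType) (a b : nat) : (0 < a)%N -> (a <= b)%N ->
  ln b%:R - ln a%:R <= (b%:R - a%:R) / a%:R :> R.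
Proof.
move=> a0 ab; have a0' : (0 : R) < a%:R by rewrite ltr0n.
have b0' : (0 : R) < b%:R by rewrite ltr0n (leq_trans a0).
rewrite -ln_div ?posrE// (_ : b%:R / a%:R = 1 + (b%:R - a%:R) / a%:R).
  by apply: le_ln1Dx; rewrite (lt_le_trans (_ : -1 < 0))// divr_ge0// subr_ge0 ler_nat.
by field; rewrite gt_eqF.
Qed.

(** A twisted form of Mertens' argument, which uses nothing about the zeros of zeta. Expanding
    [ln n] over prime powers turns the sum of [ln n * n ^ (- 1 - w)] into a sum over [p] involving
    [S (N %/ p)], and [w * S z] is [c - (z + 1) ^ (- w)] up to [O (u / z)]. As [p * (z + 1)] is
    close to [N], the last power combines with [p ^ (- w)] to nearly [N ^ (- w)], so the prime sum
    [A] appears with the constant coefficient [c]. *)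
Lemma twisted_prime_sum (R : realType) (u : R) (N : nat) : 0 < u <= 20^-1 ->
  `|\sum_(1 <= p < N.+1 | prime p) ln p%:R / p%:R * cos (u * ln p%:R)| <= 608 / u.
Proof.
case/andP => u0 u20; case: (posnP N) => [->|N0].
  by rewrite big_geq// normr0 (divr_ge0 (ler0n R 608) (ltW u0)).
set w := Complex 0 u.
have cw : cnorm w = u by rewrite /cnorm /= expr0n add0r sqrtr_sqr gtr0_norm.
have Rw : Re w = 0 by [].
have w01 : 0 <= Re w <= 1 by rewrite Rw lexx ler01.
have w1 : cnorm w <= 1 by rewrite cw; lra.
have nn n : cnorm (npow n w) = 1 by rewrite cnorm_npow Rw mul0r oppr0 expR0.
have N0' : (0 : R) < N%:R by rewrite ltr0n.
pose rc := real_complex R.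
pose A := \sum_(1 <= p < N.+1 | prime p) rc (ln p%:R) * (rc p%:R^-1 * npow p w).
pose T : R := \sum_(1 <= p < N.+1 | prime p) ln p%:R / p%:R.
have ReA : Re A = \sum_(1 <= p < N.+1 | prime p) ln p%:R / p%:R * cos (u * ln p%:R).
  rewrite /A; elim/big_rec2: _ => [//|p x y _ IH].
  rewrite -IH /w npow_imag cosN; case: y {IH} => y1 y2 /=.
  by congr (_ + _); ring.
rewrite -ReA; apply: (le_trans (normr_Re_le _)).
have T13 := mertens R N0; rewrite -/T in T13.
pose S z := twisted_harmonic w z.
pose Er z := \sum_(1 <= n < z.+1) npow_err w n.
pose c := 1 - Er N.
have wS z : (0 < z <= N)%N -> cnorm (w * S z - c + npow z.+1 w) <= 5 * u / z%:R.
  case/andP => z0 zN; rewrite /S twisted_harmonicE /c.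
  rewrite (_ : _ + npow z.+1 w = \sum_(z.+1 <= n < N.+1) npow_err w n); last first.
    by rewrite /Er (@big_cat_nat _ _ _ z.+1 1 N.+1)//=; ring.
  apply: (le_trans (cnorm_sum_err _ w01 w1 _))=> //; rewrite cw ler_wpM2l ?mulr_ge0 ?(ltW u0)//.
  exact: sum_inv_sqr_le.
have main : cnorm (w * \sum_(1 <= p < N.+1 | prime p) rc (ln p%:R) *
     (rc p%:R^-1 * npow p w * S (N %/ p)%N) - c * A + npow N w * rc T) <= 96 * u.
  have rcT : rc T = \sum_(1 <= p < N.+1 | prime p) rc (ln p%:R) * rc p%:R^-1.
    by rewrite /rc /T rmorph_sum /=; apply: eq_bigr => p _; rewrite -rcM.
  rewrite rcT /A !mulr_sumr -sumrB -big_split /=.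
  apply: (le_trans (cnorm_sum _ _ _)).
  apply: (@le_trans _ _ (12 * u / N%:R * \sum_(1 <= p < N.+1 | prime p) ln p%:R)); last first.
    have := chebyshev R N; rewrite (_ : 96 * u = 12 * u / N%:R * (8 * N%:R)).
      by move=> h; rewrite ler_wpM2l// divr_ge0 ?mulr_ge0 ?ltW.
    by field; rewrite gt_eqF.
  rewrite mulr_sumr big_nat_cond [leRHS]big_nat_cond; apply: ler_sum => p /andP[/andP[p0 pN] pp].
  have p0' : (0 : R) < p%:R by rewrite ltr0n.
  set z := (N %/ p)%N.
  have z0 : (0 < z)%N by rewrite divn_gt0.
  have zN : (z <= N)%N by rewrite leq_div.
  have z0' : (0 : R) < z%:R by rewrite ltr0n.
  rewrite (_ : _ + _ = rc (ln p%:R) * rc p%:R^-1 * ((npow p w * (w * S z - c + npow z.+1 w)) -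
     (npow (p * z.+1) w - npow N w))); last by rewrite npowM//; ring.
  rewrite !cnormM !cnorm_real (ger0_norm (ln_nat_ge0 _ _)) gtr0_norm ?invr_gt0//.
  rewrite -mulrA [leRHS]mulrC; apply: ler_wpM2l; first exact: ln_nat_ge0.
  have zlt : (N < p * z.+1)%N by rewrite mulnC ltn_ceil.
  have zle : (z * p <= N)%N by rewrite leq_trunc_div.
  have h1 : cnorm (npow p w * (w * S z - c + npow z.+1 w)) <= 10 * u * p%:R / N%:R.
    rewrite cnormM nn mul1r; apply: (le_trans (wS _ _)); first by rewrite z0.
    rewrite ler_pdivrMr// mulrAC ler_pdivlMr//.
    have : (N%:R <= 2 * (z%:R * p%:R) :> R).
      rewrite -!natrM ler_nat; apply: (leq_trans (ltnW zlt)).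
      by rewrite mulnS mul2n -addnn [(p * z)%N]mulnC leq_add2r leq_pmull.
    by move: u0; nra.
  have h2 : cnorm (npow (p * z.+1) w - npow N w) <= 2 * u * p%:R / N%:R.
    apply: (le_trans (npow_imag_sub _ _ _)); rewrite gtr0_norm// -!mulrA ler_wpM2l// ler_wpM2l ?(ltW u0)//.
    rewrite ger0_norm; last by rewrite subr_ge0 ler_ln ?posrE ?ltr0n ?muln_gt0 ?p0// ler_nat ltnW.
    apply: (le_trans (ln_sub_le _ N0 (ltnW zlt))); rewrite ler_wpM2r ?invr_ge0 ?(ltW N0')//.
    rewrite lerBlDr -natrD ler_nat mulnS leq_add2l mulnC//.
  rewrite mulrC ler_pdivrMr//; apply: (le_trans (cnormB _ _)).
  by move: (lerD h1 h2); congr (_ <= _); ring.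
have E3 : cnorm (w * \sum_(1 <= p < N.+1 | prime p) rc (ln p%:R) *
    \sum_(2 <= k < N.+1) rc (p ^ k)%:R^-1 * npow (p ^ k) w * S (N %/ p ^ k)%N) <= 144.
  rewrite mulr_sumr; apply: (le_trans (cnorm_sum _ _ _)).
  apply: (@le_trans _ _ (12 * \sum_(1 <= p < N.+1 | prime p) ln p%:R * \sum_(2 <= k < N.+1) ((p ^ k)%:R)^-1)); last first.
    by have := sum_prime_powers_le R N N.+1; lra.
  rewrite mulr_sumr; apply: ler_sum => p _.
  rewrite mulrCA cnormM cnorm_real (ger0_norm (ln_nat_ge0 _ _)) mulrCA ler_wpM2l ?ln_nat_ge0//.
  rewrite !mulr_sumr; apply: (le_trans (cnorm_sum _ _ _)); apply: ler_sum => k _.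
  rewrite (_ : w * _ = rc (p ^ k)%:R^-1 * npow (p ^ k) w * (w * S (N %/ p ^ k)%N)); last by ring.
  rewrite !cnormM nn mulr1 cnorm_real ger0_norm ?invr_ge0// mulrC ler_wpM2r ?invr_ge0//.
  by rewrite -cnormM; exact: twisted_harmonic_le.
have id : \sum_(1 <= n < N.+1) rc (ln n%:R) * (rc n%:R^-1 * npow n w) =
   \sum_(1 <= p < N.+1 | prime p) rc (ln p%:R) * (rc p%:R^-1 * npow p w * S (N %/ p)%N) +
   \sum_(1 <= p < N.+1 | prime p) rc (ln p%:R) *
    \sum_(2 <= k < N.+1) rc (p ^ k)%:R^-1 * npow (p ^ k) w * S (N %/ p ^ k)%N.
  rewrite (@sum_log_weights _ N N (fun n => rc (ln n%:R)) (fun n => rc n%:R^-1 * npow n w) (leqnn N)).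
    rewrite -big_split /= big_nat_cond [RHS]big_nat_cond; apply: eq_bigr => p /andP[/andP[p0 pN] pp].
    rewrite -mulrDr; congr (_ * _).
    have sm k : \sum_(1 <= m < (N %/ p ^ k).+1) rc (p ^ k * m)%:R^-1 * npow (p ^ k * m) w =
       rc (p ^ k)%:R^-1 * npow (p ^ k) w * S (N %/ p ^ k)%N.
      rewrite /S /twisted_harmonic mulr_sumr big_nat [RHS]big_nat; apply: eq_bigr => m /andP[m0 _].
      rewrite npowM ?expn_gt0 ?p0// natrM invfM /rc rcM; ring.
    by rewrite big_ltn//; under [X in _ + X]eq_bigr => k _ do rewrite sm; rewrite sm expn1.
  move=> n nN; rewrite (ln_prime_decomp R nN) /rc rmorph_sum /=; apply: eq_bigr => p _.
  by rewrite rcM; congr (_ * _); rewrite rmorph_nat.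
have u1 : 0 < u <= 1 by rewrite u0/=; lra.
have L := sum_ln_npow u1 N0; rewrite -/w in L.
have SN : cnorm (S N) <= 12 / u.
  by rewrite ler_pdivlMr// mulrC -cw -cnormM; exact: twisted_harmonic_le.
(* The condition [u <= 20^-1] keeps [c] away from 0. *)
have cge : 2^-1 <= cnorm c.
  have h : cnorm (Er N) <= 10 * u.
    apply: (le_trans (cnorm_sum_err N.+1 w01 w1 (isT : (0 < 1)%N))); rewrite cw.
    by have := sum_inv_sqr_le2 R N; nra.
  have := cnormD c (Er N); rewrite /c subrK cnorm1; lra.
have cA : cnorm (c * A) <= 304 / u.
  move: L main E3; rewrite id mulrDr.
  set X := w * _; set Y := w * _; set L' := X + Y + _ - _; set M' := X - _ + _ => L main E3.
  (* The main terms [ln N * N ^ (- w)], from summation by parts, and [T * N ^ (- w)], from the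
     primes, cancel up to the error of [mertens]; the largest remaining term is [S N], of size
     [12 / u]. *)
  rewrite (_ : c * A = L' - M' - Y + (S N - npow N w * rc (ln N%:R - T))); last first.
    by rewrite /L' /M' /rc rcB /S; ring.
  apply: (le_trans (cnormD _ _)).
  have h1 := cnormB (S N) (npow N w * rc (ln N%:R - T)).
  have h2 := cnormB (L' - M') Y; have h3 := cnormB L' M'.
  have h4 : cnorm (npow N w * rc (ln N%:R - T)) <= 13.
    by rewrite cnormM nn mul1r cnorm_real distrC.
  have : 292 <= 292 / u by rewrite ler_pdivlMr//; lra.
  lra.
move: cA; rewrite cnormM !ler_pdivlMr//.
have := cnorm_ge0 A; nra.
Qed.

(** * Weighted sums over primes by partial summation *)

Lemma abel_sum (R : realType) (g b : nat -> R) (m n : nat) (K : R) : (m <= n)%N ->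
  (forall i, (m <= i <= n)%N -> 0 <= g i) ->
  (forall i, (m <= i < n)%N -> g i.+1 <= g i) ->
  (forall k, (m <= k <= n)%N -> `|\sum_(m <= i < k) b i| <= K) ->
  `|\sum_(m <= i < n) g i * b i| <= g m * K.
Proof.
move=> mn g0 gd hK.
have E k : (m <= k)%N -> \sum_(m <= i < k) g i * b i =
  g k * \sum_(m <= i < k) b i + \sum_(m <= i < k) (g i - g i.+1) * \sum_(m <= j < i.+1) b j.
  elim: k => [|k IH]; first by rewrite leqn0 => /eqP ->; rewrite !big_geq// mulr0 addr0.
  rewrite leq_eqVlt => /predU1P[<-|]; first by rewrite !big_geq// mulr0 addr0.
  rewrite ltnS => mk; rewrite !big_nat_recr//= IH//; ring.
rewrite (E n mn); apply: (le_trans (ler_normD _ _)).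
have gn : 0 <= g n by apply: g0; rewrite mn leqnn.
have tel : g m * K = g n * K + \sum_(m <= i < n) (g i - g i.+1) * K.
  rewrite -mulr_suml -mulrDl; congr (_ * _).
  under eq_bigr => i _ do rewrite -opprB.
  by rewrite sumrN telescope_sumr//; ring.
rewrite tel; apply: lerD.
  by rewrite normrM (ger0_norm gn) ler_wpM2l// hK// mn leqnn.
apply: (le_trans (ler_norm_sum _ _ _)); rewrite big_nat [leRHS]big_nat; apply: ler_sum => i /andP[mi iin].
rewrite normrM ger0_norm; last by rewrite subr_ge0 gd// mi.
by rewrite ler_wpM2l ?subr_ge0 ?gd ?mi// hK// (leq_trans mi).
Qed.

Lemma ln2_ge (R : realType) : 2^-1 <= ln 2 :> R.
Proof. by have [_ _ h _] := @ln_succ_bounds R 1 isT; move: h; rewrite ln1 subr0. Qed.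

Lemma ln_ge_half (R : realType) (n : nat) : (2 <= n)%N -> 2^-1 <= ln n%:R :> R.
Proof.
move=> n2; apply: (le_trans (ln2_ge R)); rewrite ler_ln ?posrE ?ltr0n ?(leq_trans _ n2)//.
by rewrite ler_nat.
Qed.

Lemma mertens_range (R : realType) (m n : nat) : (0 < m <= n)%N ->
  `|\sum_(m <= p < n) ((if prime p then ln p%:R / p%:R else 0) - (ln p.+1%:R - ln p%:R))| <= 28 :> R.
Proof.
case/andP => m0 mn; rewrite sumrB telescope_sumr// -big_mkcond.
have T k : (0 < k)%N -> `|\sum_(1 <= p < k | prime p) ln p%:R / p%:R - ln k%:R| <= 14 :> R.
  case: k => [//|[|k]] _; first by rewrite big_geq// ln1 subr0 normr0.
  have := mertens R (isT : (0 < k.+1)%N).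
  have [d0 d1 _ _] := @ln_succ_bounds R k.+1 isT.
  have d2 : ln k.+2%:R - ln k.+1%:R <= 1 :> R.
    by apply: (le_trans d1); rewrite invf_le1 ?ltr0n// ler1n.
  by rewrite !ler_norml => /andP[? ?]; apply/andP; split; lra.
have := T m m0; have := T n (leq_trans m0 mn).
rewrite [X in `|X - _| <= _ -> _](@big_cat_nat _ _ _ m 1 n)//=.
rewrite !ler_norml => /andP[? ?] /andP[? ?]; apply/andP; split; lra.
Qed.

Lemma sum_inv_nln (R : realType) (m n : nat) : (2 <= m <= n)%N ->
  `|\sum_(m <= k < n) (ln k%:R)^-1 * (ln k.+1%:R - ln k%:R) - (ln (ln n%:R) - ln (ln m%:R))| <= 8 :> R.
Proof.
case/andP => m2 mn; rewrite -(telescope_sumr (fun k : nat => ln (ln k%:R : R)) mn) -sumrB.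
apply: (le_trans (ler_norm_sum _ _ _)).
apply: (@le_trans _ _ (4 * \sum_(m <= k < n) k%:R^-1 ^+ 2)); last first.
  have := sum_inv_sqr_le2 R n; rewrite (@big_cat_nat _ _ _ m)//=; last 2 first.
  - by rewrite (leq_trans _ m2).
  - by rewrite (leq_trans mn).
  rewrite (@big_cat_nat _ _ _ n m)//=.
  have : 0 <= \sum_(1 <= i < m) i%:R^-1 ^+ 2 :> R by rewrite sumr_ge0// => i _; rewrite sqr_ge0.
  have : 0 <= \sum_(n <= i < n.+1) i%:R^-1 ^+ 2 :> R by rewrite sumr_ge0// => i _; rewrite sqr_ge0.
  lra.
rewrite mulr_sumr big_nat [leRHS]big_nat; apply: ler_sum => k /andP[mk _].
have k2 := leq_trans m2 mk; have k0 : (0 < k)%N by rewrite (leq_trans _ k2).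
have lk := ln_ge_half R k2; have [d0 d1 _ _] := ln_succ_bounds R k0.
set a := ln k%:R in lk d0 d1 *; set b := ln k.+1%:R in d0 d1 *.
have a0 : 0 < a by lra.
have b0 : 0 < b by lra.
have k0' : 0 <= k%:R^-1 :> R by rewrite invr_ge0.
set x := a^-1 * (b - a).
have x0 : 0 <= x by rewrite /x mulr_ge0// invr_ge0 ltW.
have x2 : x <= 2 * k%:R^-1.
  rewrite /x; apply: ler_pM => //; first by rewrite invr_ge0 ltW.
  by rewrite -[leRHS]invrK lef_pV2 ?posrE ?invr_gt0.
have e : ln b - ln a = ln (1 + x).
  rewrite -ln_div ?posrE//; congr ln; rewrite /x; field; exact: lt0r_neq0.
have u1 : ln (1 + x) <= x by apply: le_ln1Dx; lra.
have u2 : x - x ^+ 2 <= ln (1 + x).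
  have x1 : 0 < 1 + x by lra.
  have : ln (1 + x)^-1 <= (1 + x)^-1 - 1.
    rewrite {1}(_ : (1 + x)^-1 = 1 + ((1 + x)^-1 - 1)); last by ring.
    by apply: le_ln1Dx; rewrite ltrBrDr addNr invr_gt0.
  rewrite lnV ?posrE// => h.
  have : (1 + x)^-1 - 1 <= - x + x ^+ 2.
    by rewrite lerBlDr -div1r ler_pdivrMr//; nra.
  lra.
rewrite e ger0_norm ?subr_ge0//.
have : x ^+ 2 <= (2 * k%:R^-1) ^+ 2 by rewrite ler_pXn2r// nnegrE mulr_ge0.
move=> xx; apply: (le_trans (y := x ^+ 2)); first by lra.
by apply: (le_trans xx); rewrite exprMn -natrX.
Qed.

(** This is [p ^ (- 1 - 2 s)], the squared modulus of [p ^ (- z)] on the line of real part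
    [1/2 + s]. *)
Definition prime_weight {R : realType} (s : R) (p : nat) : R :=
  p%:R^-1 * expR (- (2 * s * ln p%:R)).

Lemma prime_weight_ge0 (R : realType) (s : R) p : 0 <= prime_weight s p.
Proof. by rewrite mulr_ge0 ?invr_ge0 ?expR_ge0. Qed.

Lemma prime_weight_le (R : realType) (s : R) p : 0 <= s -> prime_weight s p <= p%:R^-1.
Proof.
move=> s0; rewrite /prime_weight ler_piMr ?invr_ge0// expR_le1 oppr_le0.
by rewrite !mulr_ge0 ?ln_nat_ge0.
Qed.

Lemma abel_weight_noninc (R : realType) (s : R) (i : nat) : 0 <= s -> (2 <= i)%N ->
  (ln i.+1%:R)^-1 * expR (- (2 * s * ln i.+1%:R)) <= (ln i%:R)^-1 * expR (- (2 * s * ln i%:R)) :> R.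
Proof.
move=> s0 i2; have l1 := ln_ge_half R i2; have l2 := ln_ge_half R (leqW i2).
have [d0 _ _ _] := ln_succ_bounds R (leq_trans (isT : (0 < 2)%N) i2).
apply: ler_pM; rewrite ?expR_ge0 ?invr_ge0//; [lra| |].
- by rewrite lef_pV2 ?posrE; lra.
- by rewrite ler_expR lerN2 ler_wpM2l ?mulr_ge0//; lra.
Qed.

Lemma prime_weightE (R : realType) (s : R) (p : nat) : (2 <= p)%N ->
  prime_weight s p = (ln p%:R)^-1 * expR (- (2 * s * ln p%:R)) * (ln p%:R / p%:R).
Proof.
move=> p2; have l1 := ln_ge_half R p2.
rewrite /prime_weight; field; rewrite pnatr_eq0 -lt0n (leq_trans _ p2)//= gt_eqF//; lra.
Qed.

Lemma sum_weight_cos (R : realType) (s u : R) (m n : nat) : 0 <= s -> 0 < u <= 20^-1 -> (2 <= m)%N ->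
  `|\sum_(m <= p < n | prime p) prime_weight s p * cos (u * ln p%:R)| <= 2 * (608 / u) / ln m%:R.
Proof.
move=> s0 u01 m2; have u0 : 0 < u by case/andP: u01.
have lm := ln_ge_half R m2.
have K0 : 0 <= 2 * (608 / u).
  by apply: mulr_ge0; [exact: ler0n|apply: divr_ge0; [exact: ler0n|exact: ltW]].
have [K KE] : exists K : R, K = 2 * (608 / u) by exists (2 * (608 / u)).
rewrite -KE in K0 *.
case: (leqP n m) => nm.
  by rewrite big_geq// normr0 divr_ge0//; lra.
pose g i : R := (ln i%:R)^-1 * expR (- (2 * s * ln i%:R)).
pose b i : R := if prime i then ln i%:R / i%:R * cos (u * ln i%:R) else 0.
have -> : \sum_(m <= p < n | prime p) prime_weight s p * cos (u * ln p%:R) = \sum_(m <= p < n) g p * b p.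
  rewrite big_mkcond big_nat [RHS]big_nat; apply: eq_bigr => p /andP[mp _]; rewrite /b.
  case: ifP => _; last by rewrite mulr0.
  by rewrite prime_weightE ?(leq_trans m2 mp)// mulrA.
apply: (le_trans (@abel_sum R g b m n K (ltnW nm) _ _ _)).
- by move=> i _; rewrite mulr_ge0 ?expR_ge0// invr_ge0 ln_nat_ge0.
- by move=> i /andP[mi _]; apply: abel_weight_noninc => //; exact: leq_trans mi.
- move=> k /andP[mk _].
  have P j : `|\sum_(1 <= i < j) b i| <= 608 / u.
    case: j => [|j]; last by rewrite /b -big_mkcond; exact: twisted_prime_sum.
    rewrite big_geq// normr0; apply: divr_ge0; [exact: ler0n|exact: ltW].
  have m1 : (1 <= m)%N by rewrite (leq_trans _ m2).
  rewrite (_ : \sum_(m <= i < k) b i = \sum_(1 <= i < k) b i - \sum_(1 <= i < m) b i); last first.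
    by rewrite (@big_cat_nat _ _ _ m 1 k)//=; ring.
  apply: (le_trans (ler_normB _ _)); rewrite KE; have := P k; have := P m; lra.
rewrite /g [leLHS]mulrC; apply: ler_wpM2l => //.
rewrite ler_piMr ?invr_ge0 ?ln_nat_ge0// expR_le1 oppr_le0 !mulr_ge0 ?ln_nat_ge0//.
Qed.

(** The masses [ln p / p] at the primes and the increments of [ln] have partial sums at bounded
    distance, so Abel summation transfers a nonincreasing weight from one to the other at the cost
    of its first value. *)
Lemma sum_weight_compare (R : realType) (s : R) (m n : nat) : 0 <= s -> (2 <= m <= n)%N ->
  `|\sum_(m <= p < n | prime p) prime_weight s p -
    \sum_(m <= k < n) (ln k%:R)^-1 * expR (- (2 * s * ln k%:R)) * (ln k.+1%:R - ln k%:R)|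
  <= 56.
Proof.
move=> s0 /andP[m2 mn].
pose g i : R := (ln i%:R)^-1 * expR (- (2 * s * ln i%:R)).
pose b i : R := (if prime i then ln i%:R / i%:R else 0) - (ln i.+1%:R - ln i%:R).
rewrite (_ : _ - _ = \sum_(m <= p < n) g p * b p); last first.
  rewrite big_mkcond -sumrB big_nat [RHS]big_nat; apply: eq_bigr => p /andP[mp _]; rewrite /b [RHS]mulrBr.
  congr (_ - _); case: ifP => _; last by rewrite mulr0.
  by rewrite prime_weightE ?(leq_trans m2 mp).
have m0 : (0 < m)%N by rewrite (leq_trans _ m2).
apply: (le_trans (@abel_sum R g b m n 28 mn _ _ _)).
- by move=> i _; rewrite mulr_ge0 ?expR_ge0// invr_ge0 ln_nat_ge0.
- by move=> i /andP[mi _]; apply: abel_weight_noninc => //; exact: leq_trans mi.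
- by move=> k /andP[mk _]; apply: mertens_range; rewrite m0.
have lm := ln_ge_half R m2.
have : (ln m%:R)^-1 <= 2 :> R by rewrite -[leRHS]invrK lef_pV2 ?posrE ?invr_gt0//; lra.
have : expR (- (2 * s * ln m%:R)) <= 1 by rewrite expR_le1 oppr_le0 !mulr_ge0 ?ln_nat_ge0.
have := expR_ge0 (- (2 * s * ln m%:R)).
have : 0 <= (ln m%:R)^-1 :> R by rewrite invr_ge0; lra.
rewrite /g; nra.
Qed.

Lemma mertens2 (R : realType) (m n : nat) : (2 <= m <= n)%N ->
  `|\sum_(m <= p < n | prime p) p%:R^-1 - (ln (ln n%:R) - ln (ln m%:R))| <= 64 :> R.
Proof.
move=> mn; have h1 := @sum_weight_compare R 0 m n (lexx _) mn; have h2 := @sum_inv_nln R m n mn.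
have E : \sum_(m <= p < n | prime p) p%:R^-1 = \sum_(m <= p < n | prime p) prime_weight 0 p :> R.
  by apply: eq_bigr => p _; rewrite /prime_weight mulr0 mul0r oppr0 expR0 mulr1.
have E' : \sum_(m <= k < n) (ln k%:R)^-1 * expR (- (2 * 0 * ln k%:R)) * (ln k.+1%:R - ln k%:R) =
   \sum_(m <= k < n) (ln k%:R)^-1 * (ln k.+1%:R - ln k%:R) :> R.
  by apply: eq_bigr => k _; rewrite mulr0 mul0r oppr0 expR0 mulr1.
move: h1 h2; rewrite E' E !ler_norml => /andP[? ?] /andP[? ?]; apply/andP; split; lra.
Qed.

Lemma exists_nat_ln (R : realType) (x : R) : 0 < x ->
  exists Q : nat, [/\ (2 <= Q)%N, x <= ln Q%:R & ln Q%:R <= x + 1].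
Proof.
move=> x0; have e1 : 1 <= expR x by rewrite ltW// expR_gt1.
have /andP[t1 t2] := truncn_itv (expR_ge0 x).
exists (Num.truncn (expR x)).+1; split.
- by rewrite ltnS truncn_gt0.
- by rewrite -{1}(expRK x) ler_ln ?posrE ?expR_gt0 ?ltr0n// ltW.
- rewrite -[leRHS]expRK ler_ln ?posrE ?expR_gt0 ?ltr0n// expRD.
  have : 2 <= expR 1 :> R by apply: le_trans (expR_ge1Dx 1); lra.
  rewrite -natr1; nra.
Qed.

Lemma ln_le_sub1 (R : realType) (x : R) : 0 < x -> ln x <= x - 1.
Proof. by move=> x0; rewrite {1}(_ : x = 1 + (x - 1)); [apply: le_ln1Dx; lra|ring]. Qed.

Lemma lnln_ge (R : realType) (n : nat) : (2 <= n)%N -> -1 <= ln (ln n%:R) :> R.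
Proof.
move=> n2; have h := ln_ge_half R n2.
apply: (@le_trans _ _ (ln 2^-1)); last by rewrite ler_ln ?posrE//; lra.
rewrite lnV ?posrE// lerN2; have := @ln_le_sub1 R 2; lra.
Qed.

Lemma sum_weight_le (R : realType) (s : R) (m n : nat) : 0 <= s -> (2 <= m <= n)%N ->
  \sum_(m <= p < n | prime p) prime_weight s p <= ln (ln n%:R) - ln (ln m%:R) + 64.
Proof.
move=> s0 mn; have := @mertens2 R m n mn; rewrite ler_norml => /andP[_ h].
suff : \sum_(m <= p < n | prime p) prime_weight s p <= \sum_(m <= p < n | prime p) p%:R^-1 by lra.
by apply: ler_sum => p _; exact: prime_weight_le.
Qed.

(** The factor [p ^ (- 2 / q)] cuts the sum off at [ln p] of order [q]: beyond it [1 / ln k] is at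
    most [1 / q], and the remaining sum of exponentials telescopes to [O (q)]. *)
Lemma sum_weight_tail (R : realType) (q m n : nat) : (4 <= q)%N -> (2 <= m)%N ->
  q%:R <= ln m%:R :> R ->
  \sum_(m <= p < n | prime p) prime_weight (q%:R^-1 : R) p <= 60.
Proof.
move=> q4 m2 qm; case: (leqP n m) => nm; first by rewrite big_geq.
have q0 : (4 : R) <= q%:R by rewrite ler_nat.
set s := q%:R^-1; have s0 : 0 < s by rewrite invr_gt0; lra.
have s4 : s <= 4^-1 by rewrite lef_pV2 ?posrE//; lra.
have h : (2 <= m <= n)%N by rewrite m2 ltnW.
have := sum_weight_compare (ltW s0) h; rewrite ler_norml => /andP[_ hh].
suff : \sum_(m <= k < n) (ln k%:R)^-1 * expR (- (2 * s * ln k%:R)) * (ln k.+1%:R - ln k%:R) <= 4 by lra.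
have lm : 0 < ln m%:R :> R by lra.
apply: (@le_trans _ _ (q%:R / ln m%:R * (\sum_(m <= k < n) ((- expR (- (2 * s * ln k.+1%:R))) - (- expR (- (2 * s * ln k%:R))))))).
  rewrite mulr_sumr big_nat [leRHS]big_nat; apply: ler_sum => k /andP[mk _].
  have k2 := leq_trans m2 mk; have k0 : (0 < k)%N by rewrite (leq_trans _ k2).
  have [d0 d1 _ _] := ln_succ_bounds R k0.
  have d2 : ln k.+1%:R - ln k%:R <= 1 :> R.
    by apply: (le_trans d1); rewrite invf_le1 ?ltr0n// ler1n.
  set b := ln k.+1%:R in d0 d1 d2 *; set a := ln k%:R in d0 d1 d2 *.
  have lmk : ln m%:R <= a by rewrite /a ler_ln ?posrE ?ltr0n ?(leq_trans _ m2)// ler_nat.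
  have e1 : expR (- (2 * s * b)) * (2 * s * (b - a)) <= expR (- (2 * s * a)) - expR (- (2 * s * b)).
    rewrite (_ : - (2 * s * a) = - (2 * s * b) + 2 * s * (b - a)); last by ring.
    by rewrite expRD -subr_ge0; have := expR_ge1Dx (2 * s * (b - a)); have := expR_gt0 (- (2 * s * b)); nra.
  have e2 : expR (- (2 * s * a)) <= 2 * expR (- (2 * s * b)).
    rewrite (_ : - (2 * s * a) = 2 * s * (b - a) + - (2 * s * b)); last by ring.
    rewrite expRD ler_wpM2r ?expR_ge0//.
    have sba : 2 * s * (b - a) <= 2^-1 by nra.
    have sba0 : 0 <= 2 * s * (b - a) by rewrite !mulr_ge0// ltW.
    by apply: (le_trans (expR_le_quad sba)); nra.
  have i1 : a^-1 <= (ln m%:R)^-1 by rewrite lef_pV2 ?posrE//; lra.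
  have qs : q%:R * s = 1 by rewrite divff// gt_eqF//; lra.
  set Ea := expR (- (2 * s * a)) in e1 e2 *; set Eb := expR (- (2 * s * b)) in e1 e2 *.
  have st : Ea * (b - a) <= q%:R * (- Eb - - Ea).
    apply: (@le_trans _ _ (2 * Eb * (b - a))); first by rewrite ler_wpM2r.
    rewrite (_ : 2 * Eb * (b - a) = q%:R * s * (2 * Eb * (b - a))); last by rewrite qs mul1r.
    rewrite (_ : q%:R * s * (2 * Eb * (b - a)) = q%:R * (Eb * (2 * s * (b - a)))); last by ring.
    by apply: ler_wpM2l; [exact: ler0n|lra].
  rewrite -mulrA (mulrC q%:R) -[leRHS]mulrA; apply: ler_pM => //.
  - by rewrite invr_ge0; lra.
  - by rewrite mulr_ge0 ?expR_ge0.
rewrite (telescope_sumr (fun k : nat => - expR (- (2 * s * ln k%:R)))) ?(ltnW nm)//.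
have t0 : - expR (- (2 * s * ln n%:R)) - - expR (- (2 * s * ln m%:R)) <= 1.
  have := expR_ge0 (- (2 * s * ln n%:R)).
  have : expR (- (2 * s * ln m%:R)) <= 1 by rewrite expR_le1 oppr_le0 !mulr_ge0 ?ln_nat_ge0// ltW.
  lra.
have r0 : 0 <= q%:R / ln m%:R :> R by rewrite divr_ge0 ?ler0n// ltW.
have r1 : q%:R / ln m%:R <= 1 :> R by rewrite ler_pdivrMr// mul1r.
apply: (le_trans (ler_wpM2l r0 t0)); lra.
Qed.

(** Up to [Q], about [exp q], the cut-off loses only a bounded amount, by [expR_ge1Dx] and Mertens,
    and there the sum of [1 / p] is [ln q - ln (ln q)] up to [O (1)]. *)
Lemma sum_weight_ge (R : realType) (q n : nat) : (4 <= q)%N -> q%:R + 1 <= ln n%:R :> R ->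
  ln q%:R - ln (ln q%:R) - 100 <= \sum_(q <= p < n | prime p) prime_weight (q%:R^-1 : R) p.
Proof.
move=> q4 qn; have q0 : (4 : R) <= q%:R by rewrite ler_nat.
have q0' : (0 : R) < q%:R by lra.
have [Q [Q2 Q1 Q3]] := exists_nat_ln q0'.
have Q0 : (0 : R) < Q%:R by rewrite ltr0n (leq_trans _ Q2).
have n0 : (0 < n)%N by case: n qn => //; rewrite ln0//; lra.
have Qn : (Q <= n)%N.
  have n0r : (0 : R) < n%:R by rewrite ltr0n.
  by rewrite -(ler_nat R) -ler_ln ?posrE// (le_trans Q3 qn).
have qQ : (q <= Q)%N.
  by rewrite -(ler_nat R) -ler_ln ?posrE//; have := ln_le_sub1 q0'; lra.
have q2 : (2 <= q)%N by rewrite (leq_trans _ q4).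
set s := q%:R^-1; have s0 : 0 < s by rewrite invr_gt0.
have s4 : s <= 4^-1 by rewrite lef_pV2 ?posrE.
have qs : q%:R * s = 1 by rewrite divff// gt_eqF.
apply: (@le_trans _ _ (\sum_(q <= p < Q | prime p) prime_weight s p)); last first.
  by rewrite [leRHS](@big_cat_nat _ _ _ Q)//= lerDl sumr_ge0// => p _; exact: prime_weight_ge0.
apply: (@le_trans _ _ (\sum_(q <= p < Q | prime p) (p%:R^-1 - 2 * s * (ln p%:R / p%:R)))); last first.
  apply: ler_sum => p _; rewrite /prime_weight.
  rewrite (_ : _ - _ = p%:R^-1 * (1 + - (2 * s * ln p%:R))); last by ring.
  by rewrite ler_wpM2l ?invr_ge0// expR_ge1Dx.
rewrite sumrB -mulr_sumr.
have qQ2 : (2 <= q <= Q)%N by rewrite q2.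
have := mertens2 R qQ2; rewrite ler_norml => /andP[m1 _].
have lq : ln q%:R <= ln (ln Q%:R) :> R by rewrite ler_ln ?posrE//; lra.
have Q0n : (0 < Q)%N by rewrite (leq_trans _ Q2).
have := mertens R Q0n; rewrite ler_norml => /andP[_ m2].
have m3 : \sum_(q <= p < Q | prime p) ln p%:R / p%:R <= \sum_(1 <= p < Q.+1 | prime p) ln p%:R / p%:R :> R.
  have pos m k : 0 <= \sum_(m <= p < k | prime p) ln p%:R / p%:R :> R.
    by rewrite sumr_ge0// => p _; rewrite divr_ge0 ?ln_nat_ge0.
  rewrite [leRHS](@big_cat_nat _ _ _ q)//=; [|by rewrite (leq_trans _ q4)|by rewrite leqW].
  rewrite [X in _ <= _ + X](@big_cat_nat _ _ _ Q)//=.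
  by have := pos 1%N q; have := pos Q Q.+1; lra.
have : 2 * s * (\sum_(q <= p < Q | prime p) ln p%:R / p%:R) <= 2 * s * (q%:R + 14).
  by apply: ler_wpM2l; [rewrite mulr_ge0// ltW|lra].
rewrite (_ : 2 * s * (q%:R + 14) = 2 * (q%:R * s) + 28 * s); last by ring.
rewrite qs; lra.
Qed.

Lemma sum_weight_total (R : realType) (q n : nat) : (4 <= q)%N ->
  \sum_(q <= p < n | prime p) prime_weight (q%:R^-1 : R) p <= ln q%:R + 200.
Proof.
move=> q4; have q0 : (4 : R) <= q%:R by rewrite ler_nat.
have q0' : (0 : R) < q%:R by lra.
have [Q [Q2 Q1 Q3]] := exists_nat_ln q0'.
have Q0 : (0 : R) < Q%:R by rewrite ltr0n (leq_trans _ Q2).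
have qQ : (q <= Q)%N.
  by rewrite -(ler_nat R) -ler_ln ?posrE//; have := ln_le_sub1 q0'; lra.
have q2 : (2 <= q)%N by rewrite (leq_trans _ q4).
have s0 : 0 <= q%:R^-1 :> R by rewrite invr_ge0.
apply: (@le_trans _ _ (\sum_(q <= p < maxn n Q | prime p) prime_weight (q%:R^-1 : R) p)).
  case: (leqP q n) => qn; last first.
    by rewrite big_geq ?(ltnW qn)// sumr_ge0// => p _; exact: prime_weight_ge0.
  rewrite [leRHS](@big_cat_nat _ _ _ n)//= ?leq_maxl// lerDl sumr_ge0// => p _.
  exact: prime_weight_ge0.
rewrite (@big_cat_nat _ _ _ Q)//= ?leq_maxr//.
have qQ2 : (2 <= q <= Q)%N by rewrite q2.
have h1 := sum_weight_le s0 qQ2.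
have h2 := @sum_weight_tail R q Q (maxn n Q) q4 Q2 Q1.
have h3 := @lnln_ge R q q2.
have h4 : ln (ln Q%:R) <= ln q%:R + 1 :> R.
  have i0 : 0 < q%:R^-1 :> R by rewrite invr_gt0.
  have i1 : 0 < 1 + q%:R^-1 :> R by lra.
  apply: (@le_trans _ _ (ln (q%:R * (1 + q%:R^-1)))).
    rewrite ler_ln ?posrE//; [|lra|by rewrite mulr_gt0].
    by rewrite mulrDr mulr1 divff ?gt_eqF.
  rewrite lnM ?posrE//.
  rewrite lerD2l; apply: (le_trans (le_ln1Dx _)); first by lra.
  by rewrite invf_le1//; lra.
lra.
Qed.

(** * Euler products and Dirichlet polynomials *)

Fixpoint euler_prod {R : realType} (s : R[i]%C) (ps : seq nat) (es : seq R) : R[i]%C :=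
  match ps, es with
  | p :: ps', e :: es' => (1 + real_complex R e * npow p s) * euler_prod s ps' es'
  | _, _ => 1
  end.

(* [\sum f(n) n^-s] over the [n <= x] composed of distinct primes of [ps], where
   [f] takes the values [es] on [ps]. *)
Fixpoint smooth_sum {R : realType} (s : R[i]%C) (ps : seq nat) (es : seq R) (x : nat) : R[i]%C :=
  match ps, es with
  | p :: ps', e :: es' =>
    smooth_sum s ps' es' x + real_complex R e * npow p s * smooth_sum s ps' es' (x %/ p)
  | _, _ => if (0 < x)%N then 1 else 0
  end.

Lemma cnorm_parallelogram (R : realType) (a b : R[i]%C) :
  cnorm (a + b) ^+ 2 + cnorm (a - b) ^+ 2 = 2 * (cnorm a ^+ 2 + cnorm b ^+ 2).
Proof. by rewrite !cnorm_sqr; case: a b => [a1 a2] [b1 b2] /=; ring. Qed.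

(* Rankin's trick: [n > x] is majorised by [(n / (x + 1)) ^ eta]. *)
Lemma rankin (R : realType) (s : R[i]%C) (eta : R) (ps : seq nat) (x : nat) : 0 <= eta -> all prime ps ->
  sign_mean (size ps) (fun es => cnorm (euler_prod s ps es - smooth_sum s ps es x) ^+ 2)
  <= expR (- (eta * ln x.+1%:R)) * \prod_(p <- ps) (1 + expR ((eta - 2 * Re s) * ln p%:R)).
Proof.
move=> eta0; elim: ps x => [|p ps IH] x /=.
  move=> _; rewrite big_nil mulr1; case: x => [|x].
    by rewrite ltnn subr0 cnorm1 expr1n ln1 mulr0 oppr0 expR0.
  by rewrite ltn0Sn subrr cnorm0 expr0n /= expR_ge0.
case/andP => pp hps; have p0 : (0 < p)%N by exact: prime_gt0.
pose D y es := euler_prod s ps es - smooth_sum s ps es y.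
(* Averaging over the sign at [p] removes the cross term, by the parallelogram law, and leaves the
   remainders at [x] and at [x %/ p]. *)
have E : (sign_mean (size ps) (fun es => cnorm ((1 + 1%:C%C * npow p s) * euler_prod s ps es -
      (smooth_sum s ps es x + 1%:C%C * npow p s * smooth_sum s ps es (x %/ p))) ^+ 2) +
   sign_mean (size ps) (fun es => cnorm ((1 + (-1)%:C%C * npow p s) * euler_prod s ps es -
      (smooth_sum s ps es x + (-1)%:C%C * npow p s * smooth_sum s ps es (x %/ p))) ^+ 2)) / 2 =
   sign_mean (size ps) (fun es => cnorm (D x es) ^+ 2) +
   cnorm (npow p s) ^+ 2 * sign_mean (size ps) (fun es => cnorm (D (x %/ p)%N es) ^+ 2).
  rewrite -sign_meanD -sign_meanZ -sign_meanD -sign_meanZr; apply: eq_sign_mean => es _ _.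
  have c1 : 1%:C%C = 1 :> R[i]%C by [].
  have c2 : (-1)%:C%C = -1 :> R[i]%C by apply/eqP; rewrite eq_complex /= oppr0 !eqxx.
  rewrite c1 c2.
  rewrite (_ : _ - (_ + 1 * _ * _) = D x es + npow p s * D (x %/ p)%N es); last by rewrite /D; ring.
  rewrite (_ : _ - (_ + -1 * _ * _) = D x es - npow p s * D (x %/ p)%N es); last by rewrite /D; ring.
  by rewrite cnorm_parallelogram cnormM exprMn; field.
rewrite E big_cons; have h1 := IH x hps; have h2 := IH (x %/ p)%N hps.
set Q := \prod_(_ <- _) _ in h1 h2 *.
have Q0 : 0 <= Q by rewrite /Q prodr_ge0// => i _; rewrite addr_ge0// expR_ge0.
apply: (le_trans (lerD h1 (ler_wpM2l (sqr_ge0 _) h2))).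
rewrite mulrDl mul1r mulrDr lerD2l !mulrA ler_wpM2r//.
rewrite cnorm_npow expr2 -!expRD ler_expR.
have : ln x.+1%:R <= ln p%:R + ln (x %/ p).+1%:R :> R.
  rewrite -lnM ?posrE ?ltr0n// -natrM ler_ln ?posrE ?ltr0n ?muln_gt0 ?p0// ler_nat mulnC.
  by rewrite ltn_ceil.
move=> h; have := ler_wpM2l eta0 h; lra.
Qed.

Definition sqf_mult {R : realType} (e : nat -> R) (n : nat) : R :=
  if `[< squarefree n >] then \prod_(p <- primes n) e p else 0.

Lemma sqf_mult1 (R : realType) (e : nat -> R) : sqf_mult e 1 = 1.
Proof.
rewrite /sqf_mult asboolT ?big_nil// => m.
by rewrite dvdn1 -[X in (_ == X)%N](exp1n 2) eqn_exp2r// => /eqP.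
Qed.

Lemma squarefree_mulp (p m : nat) : prime p -> ~~ (p %| m)%N -> (0 < m)%N ->
  squarefree (p * m) <-> squarefree m.
Proof.
move=> pp pm m0; split => h k hk; apply: h; first exact: dvdn_mull.
have pk : ~~ (p %| k)%N.
  apply/negP => pk; have := dvdn_trans (dvdn_exp2r 2 pk) hk.
  by rewrite expnS expn1 dvdn_pmul2l ?prime_gt0// (negbTE pm).
have : coprime (k ^ 2) p by rewrite coprimeXl// coprime_sym prime_coprime.
by move=> cop; move: hk; rewrite Gauss_dvdr.
Qed.

Lemma sqf_mult_mulp (R : realType) (e : nat -> R) (p m : nat) :
  prime p -> ~~ (p %| m)%N -> (0 < m)%N -> sqf_mult e (p * m) = e p * sqf_mult e m.
Proof.
move=> pp pm m0; rewrite /sqf_mult (asbool_equiv_eq (squarefree_mulp pp pm m0)).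
case: ifP => _; last by rewrite mulr0.
have P : perm_eq (primes (p * m)) (p :: primes m).
  apply: uniq_perm; rewrite ?primes_uniq//=.
    by rewrite primes_uniq andbT mem_primes pp m0.
  move=> k; rewrite (primesM _ (prime_gt0 pp) m0) in_cons; congr (_ || _).
  by rewrite primes_prime// inE.
by rewrite (perm_big _ P) big_cons.
Qed.

Lemma sqf_mult_mulp0 (R : realType) (e : nat -> R) (p m : nat) :
  prime p -> (p %| m)%N -> sqf_mult e (p * m) = 0.
Proof.
move=> pp /dvdnP[k ->]; rewrite /sqf_mult asboolF// => /(_ p).
rewrite mulnCA dvdn_mull// => /(_ isT) p1; by rewrite p1 in pp.
Qed.

(** The recursion sorts the [n] by divisibility by [p]: the multiples are [p * m] with [m] up to
    [x %/ p], and those with [p] dividing [m] vanish, not being squarefree. *)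
Lemma smooth_sumE (R : realType) (s : R[i]%C) (e : nat -> R) (ps : seq nat) (x : nat) :
  all prime ps -> uniq ps ->
  smooth_sum s ps (map e ps) x =
  \sum_(1 <= n < x.+1 | all (mem ps) (primes n)) real_complex R (sqf_mult e n) * npow n s.
Proof.
elim: ps x => [|p ps IH] x /=.
  move=> _ _; case: x => [|x]; first by rewrite big_geq.
  rewrite big_ltn_cond//= sqf_mult1 npow1 mulr1 big_nat_cond big1 ?addr0//.
  move=> n /andP[/andP[n1 _]]; case: (primes n) (primes_eq0 n) => //=.
  by rewrite eqxx ltnNge => /esym; move: n1; rewrite ltnNge => /negbTE ->.
case/andP => pp hps /andP[pps ups]; have p0 := prime_gt0 pp.
rewrite !IH// [in RHS](bigID (fun n => p %| n)%N)/= [RHS]addrC; congr (_ + _).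
  rewrite big_nat_cond [RHS]big_nat_cond; apply: eq_bigl => n.
  case: (posnP n) => [->//|n0]; case: (ltnP n x.+1) => nx; rewrite ?andbF//=.
  case: (boolP (p %| n)%N) => pn; rewrite ?andbF ?andbT.
    apply/negbTE/negP => /allP/(_ p); rewrite mem_primes pp n0 pn => /(_ isT) /= ps'.
    by rewrite ps' in pps.
  apply: eq_in_all => k; rewrite mem_primes => /and3P[_ _ kn] /=.
  by rewrite inE; case: eqP => [kp|//]; rewrite -kp kn in pn.
under [RHS]eq_bigl => n do rewrite andbC.
rewrite [RHS]big_mkcondr sum_multiples// mulr_sumr [LHS]big_mkcond.
rewrite big_nat_cond [RHS]big_nat_cond; apply: eq_bigr => m /andP[/andP[m0 _] _].
case: (boolP (p %| m)%N) => pm.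
  rewrite ifN; last first.
    by apply/negP => /allP/(_ p); rewrite mem_primes pp m0 pm => /(_ isT) /= ps'; rewrite ps' in pps.
  by rewrite sqf_mult_mulp0// /real_complex_def /= mul0r; case: ifP.
have -> : all (mem (p :: ps)) (primes (p * m)) = all (mem ps) (primes m).
  apply/allP/allP => h k.
    move=> kin; have : k \in primes (p * m) by rewrite primesM// kin orbT.
    move/h; rewrite /= inE; case: eqP => [kp|//]; move: kin; rewrite kp mem_primes (negbTE pm).
    by rewrite !andbF.
  rewrite primesM// primes_prime// inE => /orP[/eqP ->|/h]; rewrite /= inE ?eqxx// => ->.
  by rewrite orbT.
case: ifP => _ //.
by rewrite sqf_mult_mulp// npowM// rcM; ring.
Qed.

Lemma abel_npow (R : realType) (s : R[i]%C) (f : nat -> R) (N : nat) :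
  \sum_(1 <= n < N.+1) real_complex R (f n) * npow n s =
  real_complex R (\sum_(1 <= k < N.+1) f k) * npow N.+1 s +
  \sum_(1 <= n < N.+1) real_complex R (\sum_(1 <= k < n.+1) f k) * (npow n s - npow n.+1 s).
Proof.
elim: N => [|N IH]; first by rewrite !big_geq// /real_complex_def /= mul0r addr0.
rewrite [in LHS]big_nat_recr//= IH [X in _ = _ + X]big_nat_recr//=.
rewrite ![\sum_(1 <= k < N.+2) f k]big_nat_recr//= rcD; ring.
Qed.

Definition primes_in (a b : nat) : seq nat := [seq p <- index_iota a b | prime p].

Lemma primes_in_all a b : all prime (primes_in a b). Proof. exact: filter_all. Qed.

Lemma primes_in_uniq a b : uniq (primes_in a b).
Proof. by rewrite filter_uniq// iota_uniq. Qed.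

Lemma mem_primes_in a b p : (p \in primes_in a b) = prime p && (a <= p < b)%N.
Proof. by rewrite mem_filter mem_index_iota. Qed.

Lemma primes_in_cat a b c : (a <= b)%N -> (b <= c)%N ->
  primes_in a c = primes_in a b ++ primes_in b c.
Proof.
by move=> ab bc; rewrite /primes_in -filter_cat /index_iota -{2}(subnKC ab) -iotaD addnBAC// subnKC ?(leq_trans ab).
Qed.

Lemma smooth_sum_full (R : realType) (s : R[i]%C) (e : nat -> R) (N : nat) :
  smooth_sum s (primes_in 0 N.+1) (map e (primes_in 0 N.+1)) N =
  \sum_(1 <= n < N.+1) real_complex R (sqf_mult e n) * npow n s.
Proof.
rewrite smooth_sumE ?primes_in_all ?primes_in_uniq//.
rewrite big_nat_cond [RHS]big_nat_cond; apply: eq_bigl => n; rewrite andbT.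
apply: andb_idr => /andP[n0 nN]; apply/allP => p; rewrite mem_primes => /and3P[pp _ pn] /=.
by rewrite mem_primes_in pp /= (leq_ltn_trans (dvdn_leq n0 pn)).
Qed.

(** * The dual large sieve on the grid *)

Lemma cnorm_conj (R : realType) (z : R[i]%C) : cnorm (conjc z) = cnorm z.
Proof. by case: z => a b; rewrite /cnorm /= sqrrN. Qed.

Lemma mul_conj (R : realType) (z : R[i]%C) : z * conjc z = real_complex R (cnorm z ^+ 2).
Proof.
by rewrite cnorm_sqr; case: z => a b; apply/eqP; rewrite eq_complex /=; apply/andP; split; apply/eqP; ring.
Qed.

Lemma conj_npow (R : realType) n (w : R[i]%C) : conjc (npow n w) = npow n (conjc w).
Proof.
rewrite /npow /cexp !ReN !ImN !Re_mul_real !Im_mul_real; case: w => a b /=.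
by rewrite mulNr opprK cosN sinN mulrN opprK.
Qed.

Lemma conj_mul (R : realType) (z w : R[i]%C) : conjc (z * w) = conjc z * conjc w.
Proof. exact: rmorphM. Qed.

(** Duality with a weighted Schur test. With [x j] the inner sums, [S] is the sum of [b n * Y n];
    the weighted square sum of [Y] is the quadratic form of the Gram matrix at [x], hence at most
    [B * S] by the bound on its rows. *)
Lemma large_sieve_dual (R : realType) (J N : nat) (om b : nat -> R) (v : nat -> nat -> R[i]%C) (B : R) :
  0 < B -> (forall n, (0 < n)%N -> 0 < om n) ->
  (forall j, (j < J)%N -> \sum_(0 <= k < J)
     cnorm (\sum_(1 <= n < N.+1) real_complex R (om n)^-1 * (v n j * conjc (v n k))) <= B) ->
  \sum_(0 <= j < J) cnorm (\sum_(1 <= n < N.+1) real_complex R (b n) * v n j) ^+ 2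
  <= B * \sum_(1 <= n < N.+1) om n * b n ^+ 2.
Proof.
move=> B0 om0 hB; pose rc := real_complex R.
have cr y : conjc (rc y) = rc y by exact: conjc_real.
pose x j := \sum_(1 <= n < N.+1) rc (b n) * v n j.
pose G j k := \sum_(1 <= n < N.+1) rc (om n)^-1 * (v n j * conjc (v n k)).
pose Y n := \sum_(0 <= j < J) conjc (x j) * v n j.
pose S : R := \sum_(0 <= j < J) cnorm (x j) ^+ 2.
have Gsym j k : cnorm (G j k) = cnorm (G k j).
  rewrite -[RHS]cnorm_conj /G rmorph_sum /=; congr cnorm; apply: eq_bigr => n _.
  by rewrite !conj_mul conjcK cr [v n j * _]mulrC.
have S1 : S <= \sum_(1 <= n < N.+1) `|b n| * cnorm (Y n).
  have e : rc S = \sum_(1 <= n < N.+1) rc (b n) * Y n.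
    rewrite /rc /S rmorph_sum /=.
    under eq_bigr => j _ do rewrite -mul_conj {1}/x mulr_suml.
    rewrite exchange_big_nat /=; apply: eq_bigr => n _.
    by rewrite /Y mulr_sumr; apply: eq_bigr => j _; rewrite /rc; ring.
  have S0 : 0 <= S by rewrite sumr_ge0// => i _; rewrite sqr_ge0.
  rewrite -[S]ger0_norm// -cnorm_real -/rc e; apply: (le_trans (cnorm_sum _ _ _)).
  by apply: ler_sum => n _; rewrite cnormM cnorm_real.
have S2 : \sum_(1 <= n < N.+1) (om n)^-1 * cnorm (Y n) ^+ 2 <= B * S.
  set T : R := \sum_(1 <= n < N.+1) _.
  have T0 : 0 <= T.
    rewrite /T big_nat sumr_ge0// => n /andP[n0 _].
    by rewrite mulr_ge0 ?sqr_ge0// invr_ge0 ltW// om0.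
  have e : rc T = \sum_(0 <= j < J) \sum_(0 <= k < J) conjc (x j) * x k * G j k.
    rewrite /rc /T rmorph_sum /=.
    under eq_bigr => n _ do rewrite rcM -mul_conj {2}/Y rmorph_sum /= {1}/Y mulr_suml mulr_sumr.
    rewrite exchange_big_nat /=; apply: eq_bigr => j _.
    under eq_bigr => n _ do rewrite mulr_sumr mulr_sumr.
    rewrite exchange_big_nat /=; apply: eq_bigr => k _.
    rewrite /G mulr_sumr; apply: eq_bigr => n _; rewrite conj_mul conjcK /rc; ring.
  rewrite -[T]ger0_norm// -cnorm_real -/rc e.
  apply: (@le_trans _ _ (\sum_(0 <= j < J) \sum_(0 <= k < J)
     (cnorm (x j) ^+ 2 / 2 * cnorm (G j k) + cnorm (x k) ^+ 2 / 2 * cnorm (G j k)))).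
    apply: (le_trans (cnorm_sum _ _ _)); apply: ler_sum => j _.
    apply: (le_trans (cnorm_sum _ _ _)); apply: ler_sum => k _.
    rewrite !cnormM cnorm_conj -mulrDl ler_wpM2r ?cnorm_ge0//.
    by have := sqr_ge0 (cnorm (x j) - cnorm (x k)); rewrite sqrrB; lra.
  rewrite (_ : \sum_(0 <= j < J) _ = \sum_(0 <= j < J) \sum_(0 <= k < J) cnorm (x j) ^+ 2 * cnorm (G j k)).
    rewrite /S mulr_sumr big_nat [leRHS]big_nat; apply: ler_sum => j /andP[_ jJ].
    by rewrite -mulr_sumr mulrC ler_wpM2r ?sqr_ge0// hB.
  under eq_bigr => j _ do rewrite big_split /=.
  rewrite big_split /= [X in _ + X]exchange_big_nat /= -big_split /=; apply: eq_bigr => j _.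
  rewrite -big_split /=; apply: eq_bigr => k _.
  by rewrite [cnorm (G k j)]Gsym -mulrDl -splitr.
(* AM-GM with parameter [B] leaves [S / 2] on the right, where it is absorbed; this replaces
   Cauchy-Schwarz and a division by [S]. *)
have S3 : S <= B / 2 * (\sum_(1 <= n < N.+1) om n * b n ^+ 2) + S / 2.
  apply: (le_trans S1); apply: (@le_trans _ _ (B / 2 * (\sum_(1 <= n < N.+1) om n * b n ^+ 2) +
     (2 * B)^-1 * \sum_(1 <= n < N.+1) (om n)^-1 * cnorm (Y n) ^+ 2)).
    rewrite !mulr_sumr -big_split /= big_nat [leRHS]big_nat; apply: ler_sum => n /andP[n0 _].
    have on := om0 n n0; set y := cnorm (Y n).
    rewrite -(real_normK (num_real (b n))); set a := `|b n|.
    rewrite -subr_ge0 (_ : _ - _ = (2 * B * om n)^-1 * (B * om n * a - y) ^+ 2).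
      by rewrite mulr_ge0 ?sqr_ge0// invr_ge0 !mulr_ge0// ltW.
    by field; rewrite !gt_eqF.
  rewrite lerD2l; apply: (le_trans (ler_wpM2l _ S2)); first by rewrite invr_ge0 mulr_ge0// ltW.
  by rewrite le_eqVlt; apply/orP; left; apply/eqP; field; rewrite gt_eqF.
rewrite -/S; lra.
Qed.

(** One of the two truncated differences vanishes, so their sum is the distance of the indices; the
    maximum with 1 accounts for the real part [sg] that survives when the ordinates coincide. *)
Definition gap (j k : nat) : nat := maxn 1 (j - k + (k - j)).

Lemma gap_gt0 j k : (0 < gap j k)%N. Proof. by rewrite leq_max. Qed.

Lemma harmonic_le (R : realType) (m : nat) : \sum_(1 <= n < m.+1) n%:R^-1 <= 1 + ln m%:R :> R.
Proof.
elim: m => [|m IH]; first by rewrite big_geq// ln0// addr0.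
rewrite big_nat_recr//=; case: m IH => [|m] IH; first by rewrite big_geq// ln1 invr1; lra.
have [_ _ d1 _] := @ln_succ_bounds R m.+1 isT.
by apply: (le_trans (lerD IH d1)); lra.
Qed.

Lemma sum_gap_le (R : realType) (J j : nat) : (j < J)%N ->
  \sum_(0 <= k < J) (gap j k)%:R^-1 <= 3 + 2 * ln J%:R :> R.
Proof.
move=> jJ; rewrite (@big_cat_nat _ _ _ j 0 J)//=; last exact: ltnW.
rewrite (@big_ltn _ _ _ j)//=.
have mono m : (m <= J)%N -> \sum_(1 <= n < m.+1) n%:R^-1 <= 1 + ln J%:R :> R.
  move=> mJ; apply: (le_trans (harmonic_le R m)); rewrite lerD2l.
  case: m mJ => [|m] mJ; first by rewrite ln0// ln_nat_ge0.
  by rewrite ler_ln ?posrE ?ltr0n// ?ler_nat// (leq_trans _ mJ).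
have h1 : \sum_(0 <= k < j) (gap j k)%:R^-1 <= 1 + ln J%:R :> R.
  apply: le_trans (mono j (ltnW jJ)); rewrite big_nat_rev /= add0n.
  rewrite [leRHS]big_add1 /= big_nat [leRHS]big_nat; apply: ler_sum => k /andP[_ kj].
  have -> : gap j (j - k.+1) = k.+1 by rewrite /gap; lia.
  by [].
have h2 : \sum_(j.+1 <= k < J) (gap j k)%:R^-1 <= 1 + ln J%:R :> R.
  apply: le_trans (mono (J - j.+1)%N (leq_subr _ _)).
  rewrite -{1}[j.+1]add0n big_addn [leRHS]big_add1 /= big_nat [leRHS]big_nat; apply: ler_sum => k _.
  have -> : gap j (k + j.+1) = k.+1 by rewrite /gap; lia.
  by [].
have -> : gap j j = 1%N by rewrite /gap subnn.
rewrite invr1; lra.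
Qed.

(* With [q = 80 J], the ordinates are [1/80 + j/q], [j < J]: they stay in
   [[1/80, 1/40]], away from [0] and small enough for [twisted_prime_sum]. *)
Definition grid_sigma {R : realType} (J : nat) : R := (80 * J)%:R^-1.

Definition grid_t {R : realType} (J j : nat) : R := 80^-1 + j%:R * grid_sigma J.

Definition grid_s {R : realType} (J j : nat) : R[i]%C :=
  Complex (2^-1 + grid_sigma J) (grid_t J j).

Lemma grid_sigma_bounds (R : realType) (J : nat) : (0 < J)%N ->
  0 < (grid_sigma J : R) <= 80^-1.
Proof.
move=> J0; rewrite /grid_sigma invr_gt0 ltr0n muln_gt0 J0/= lef_pV2 ?posrE ?ltr0n ?muln_gt0//.
by rewrite ler_nat leq_pmulr.
Qed.

Lemma grid_t_bounds (R : realType) (J j : nat) : (j < J)%N -> 80^-1 <= (grid_t J j : R) <= 40^-1.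
Proof.
move=> jJ; have J0 : (0 < J)%N by rewrite (leq_trans _ jJ).
have [s0 _] := andP (grid_sigma_bounds R J0).
have e : j%:R * grid_sigma J <= 80^-1 :> R.
  rewrite /grid_sigma natrM invfM mulrCA ler_piMr// ler_pdivrMr ?ltr0n// mul1r ler_nat.
  exact: ltnW.
have e0 : 0 <= j%:R * grid_sigma J :> R by rewrite mulr_ge0// ltW.
by rewrite /grid_t; apply/andP; split; lra.
Qed.

Lemma cnorm_grid_s (R : realType) (J j : nat) : (j < J)%N -> cnorm (grid_s J j : R[i]%C) <= 1.
Proof.
move=> jJ; have J0 : (0 < J)%N by rewrite (leq_trans _ jJ).
have [s0 s1] := andP (grid_sigma_bounds R J0); have [t0 t1] := andP (grid_t_bounds R jJ).
by apply: (le_trans (cnorm_le _)); rewrite /= !ger0_norm; lra.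
Qed.

Lemma expR_ln_nat (R : realType) (n : nat) : (0 < n)%N -> expR (ln n%:R) = n%:R :> R.
Proof. by move=> n0; rewrite lnK// posrE ltr0n. Qed.

(** The weight [n ^ (2 + sg)] offsets the two factors [1 / n] due to differencing and part of the
    size of [n ^ (- s)], so that the main term becomes [n ^ (- 1 - w)] with [w = sg + i (t - t')]: a
    term of a twisted harmonic sum. *)
Lemma npow_diff_pair (R : realType) (n : nat) (s s' : R[i]%C) (sg : R) : (0 < n)%N ->
  Re s = 2^-1 + sg -> Re s' = 2^-1 + sg -> 0 < sg <= 80^-1 -> cnorm s <= 1 -> cnorm s' <= 1 ->
  cnorm (real_complex R (expR ((2 + sg) * ln n%:R)) *
      ((npow n s - npow n.+1 s) * conjc (npow n s' - npow n.+1 s')) -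
     s * conjc s' * (real_complex R n%:R^-1 * npow n (s + conjc s' - Complex (1 + sg) 0)))
  <= 35 * n%:R^-1 ^+ 2.
Proof.
move=> n0 Rs Rs' /andP[g0 g1] ns ns'; pose rc := real_complex R.
pose m w := w * rc n%:R^-1 * npow n w.
pose e w := npow n w - npow n.+1 w - m w.
have n0' : (0 : R) < n%:R by rewrite ltr0n.
have n1 : n%:R^-1 <= 1 :> R by rewrite invf_le1// ler1n.
set x := n%:R^-1 in n1 *; have x0 : 0 < x by rewrite invr_gt0.
have xE : x = expR (- ln n%:R) by rewrite expRN expR_ln_nat.
have rng w : Re w = 2^-1 + sg -> 0 <= Re w <= 1 by move=> ->; apply/andP; split; lra.
pose h := expR (- ((2^-1 + sg) * ln n%:R)).
have h0 : 0 < h by rewrite expR_gt0.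
have he w : Re w = 2^-1 + sg -> cnorm w <= 1 -> cnorm (e w) <= 5 * (x ^+ 2 * h).
  move=> Rw w1; apply: (le_trans (npow_diff n0 (rng w Rw))); rewrite Rw -/h -/x.
  by rewrite ler_wpM2r ?mulr_ge0 ?sqr_ge0 ?(ltW h0)//; have := cnorm_ge0 w; nra.
have hm w : Re w = 2^-1 + sg -> cnorm w <= 1 -> cnorm (m w) <= x * h.
  move=> Rw w1; rewrite /m !cnormM cnorm_real gtr0_norm// cnorm_npow Rw -/h.
  by rewrite ler_wpM2r ?(ltW h0)// ler_piMl// ltW.
have Main : rc (expR ((2 + sg) * ln n%:R)) * (m s * conjc (m s')) =
    s * conjc s' * (rc x * npow n (s + conjc s' - Complex (1 + sg) 0)).
  rewrite /m !conj_mul conj_npow (_ : conjc (rc n%:R^-1) = rc x); last by exact: conjc_real.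
  rewrite (_ : _ * _ = s * conjc s' * (rc (expR ((2 + sg) * ln n%:R)) * rc x * rc x *
     (npow n s * npow n (conjc s')))); last by rewrite -/x; ring.
  congr (_ * _); rewrite -rcM -rcM.
  rewrite (_ : _ * x * x = x * expR ((1 + sg) * ln n%:R)); last first.
    rewrite [in RHS]xE -expRD xE -!expRD; congr expR; ring.
  rewrite rcM -mulrA; congr (_ * _).
  rewrite (_ : real_complex R (expR ((1 + sg) * ln n%:R)) = npow n (- Complex (1 + sg) 0)); last first.
    rewrite /npow /cexp ReN ImN Re_mul_real Im_mul_real ReN ImN /=.
    by rewrite !mulNr !opprK mul0r cos0 sin0 mulr1 mulr0.
  by rewrite /npow -!cexpD; congr cexp; ring.
rewrite -/rc -Main -mulrBr.
have -> : (npow n s - npow n.+1 s) * conjc (npow n s' - npow n.+1 s') - m s * conjc (m s') =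
   m s * conjc (e s') + e s * conjc (m s') + e s * conjc (e s').
  have c w : npow n w - npow n.+1 w = m w + e w by rewrite /e; ring.
  rewrite !c (_ : conjc (m s' + e s') = conjc (m s') + conjc (e s')); last by exact: rmorphD.
  ring.
rewrite cnormM cnorm_real ger0_norm ?expR_ge0//.
have gen (a b a' b' : R[i]%C) : cnorm a <= x * h -> cnorm a' <= x * h ->
    cnorm b <= 5 * (x ^+ 2 * h) -> cnorm b' <= 5 * (x ^+ 2 * h) ->
    cnorm (a * conjc b' + b * conjc a' + b * conjc b') <= 35 * (x ^+ 3 * h ^+ 2).
  move=> ha ha' hb hb'.
  apply: (le_trans (cnormD _ _)); apply: (le_trans (lerD (cnormD _ _) (lexx _))).
  rewrite !cnormM !cnorm_conj.
  have h4 : x ^+ 4 * h ^+ 2 <= x ^+ 3 * h ^+ 2.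
    by rewrite ler_wpM2r ?sqr_ge0// exprS ler_piMl// exprn_ge0// ltW.
  have h1 := ler_pM (cnorm_ge0 a) (cnorm_ge0 b') ha hb'.
  have h2 := ler_pM (cnorm_ge0 b) (cnorm_ge0 a') hb ha'.
  have h3 := ler_pM (cnorm_ge0 b) (cnorm_ge0 b') hb hb'.
  rewrite (_ : x * h * (5 * (x ^+ 2 * h)) = 5 * (x ^+ 3 * h ^+ 2)) in h1; last by ring.
  rewrite (_ : 5 * (x ^+ 2 * h) * (x * h) = 5 * (x ^+ 3 * h ^+ 2)) in h2; last by ring.
  rewrite (_ : 5 * (x ^+ 2 * h) * (5 * (x ^+ 2 * h)) = 25 * (x ^+ 4 * h ^+ 2)) in h3; last by ring.
  lra.
have bound := gen (m s) (e s) (m s') (e s') (hm s Rs ns) (hm s' Rs' ns') (he s Rs ns) (he s' Rs' ns').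
apply: (le_trans (ler_wpM2l (expR_ge0 _) bound)).
rewrite mulrCA ler_wpM2l ?ler0n//.
rewrite /h xE -!expRM_natr -!expRD ler_expR -subr_ge0.
rewrite (_ : _ - _ = sg * ln n%:R); last by lra.
by rewrite mulr_ge0 ?ln_nat_ge0// ltW.
Qed.

Lemma gap_le (J j k : nat) : (j < J)%N -> (k < J)%N -> (gap j k <= J)%N.
Proof. by rewrite /gap geq_max; lia. Qed.

Lemma natr_dist (R : realType) (j k : nat) : (j - k + (k - j))%:R = `|j%:R - k%:R| :> R.
Proof.
case: (leqP j k) => h; last move/ltnW in h; move: (h); rewrite -subn_eq0 => /eqP ->.
  by rewrite add0n natrB// distrC ger0_norm// subr_ge0 ler_nat.
by rewrite addn0 natrB// ger0_norm// subr_ge0 ler_nat.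
Qed.

(** The main term is a multiple of [twisted_harmonic w], of size [O (1 / |w|)], where [|w|] is at
    least [gap j k / (80 J)]. *)
Lemma gram_le (R : realType) (J N j k : nat) : (j < J)%N -> (k < J)%N ->
  cnorm (\sum_(1 <= n < N.+1) real_complex R (expR ((2 + grid_sigma J) * ln n%:R)) *
    ((npow n (grid_s J j) - npow n.+1 (grid_s J j)) *
     conjc (npow n (grid_s J k) - npow n.+1 (grid_s J k))))
  <= 13 * ((80 * J)%:R * (gap j k)%:R^-1).
Proof.
move=> jJ kJ; have J0 : (0 < J)%N by rewrite (leq_trans _ jJ).
have g := grid_sigma_bounds R J0; have [g0 g1] := andP g.
set sg := grid_sigma J in g g0 g1 *.
set s := grid_s J j; set s' := grid_s J k.
pose w := s + conjc s' - Complex (1 + sg) 0.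
have wE : w = Complex sg ((j%:R - k%:R) * sg).
  rewrite /w /s /s' /grid_s /grid_t -/sg; apply/eqP; rewrite eq_complex /=.
  by apply/andP; split; apply/eqP; [field|ring].
have q0 : (0 : R) < (80 * J)%:R by rewrite ltr0n muln_gt0 J0.
have gq : sg * (80 * J)%:R = 1 by rewrite mulrC divff// gt_eqF.
have jk : `|j%:R - k%:R| <= J%:R :> R.
  by have := jJ; have := kJ; rewrite -!(ltr_nat R) ler_norml => ? ?; have := ler0n R j; have := ler0n R k; move=> ? ?; apply/andP; split; lra.
have w1 : cnorm w <= 1.
  rewrite wE; apply: (le_trans (cnorm_le _)); rewrite /= normrM (gtr0_norm g0).
  have : `|j%:R - k%:R| * sg <= 80^-1.
    apply: (le_trans (ler_wpM2r (ltW g0) jk)); rewrite /sg /grid_sigma natrM invfM mulrCA divff ?mulr1//.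
    by rewrite gt_eqF ?ltr0n.
  lra.
have w01 : 0 <= Re w <= 1 by rewrite wE /=; apply/andP; split; lra.
have wge : (gap j k)%:R * sg <= cnorm w.
  rewrite /gap /maxn; case: ifP => _.
    apply: le_trans (normr_Im_le _); rewrite wE /= normrM (gtr0_norm g0) ler_wpM2r ?(ltW g0)//.
    by rewrite natr_dist.
  by rewrite mul1r; apply: le_trans (normr_Re_le _); rewrite wE /= ler_norm.
have gp : (0 : R) < (gap j k)%:R by rewrite ltr0n gap_gt0.
rewrite (_ : \sum_(1 <= n < N.+1) _ = s * conjc s' * twisted_harmonic w N +
  \sum_(1 <= n < N.+1) (real_complex R (expR ((2 + sg) * ln n%:R)) *
      ((npow n s - npow n.+1 s) * conjc (npow n s' - npow n.+1 s')) -
     s * conjc s' * (real_complex R n%:R^-1 * npow n w))); last first.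
  by rewrite /twisted_harmonic mulr_sumr -big_split /=; apply: eq_bigr => n _; ring.
have e1 : cnorm (s * conjc s' * twisted_harmonic w N) <= 12 * ((80 * J)%:R * (gap j k)%:R^-1).
  have h := twisted_harmonic_le N w01 w1.
  have wp : 0 < cnorm w by apply: lt_le_trans wge; rewrite mulr_gt0.
  rewrite !cnormM cnorm_conj; apply: (@le_trans _ _ (cnorm (twisted_harmonic w N))).
    rewrite -[leRHS]mul1r ler_wpM2r ?cnorm_ge0//.
    rewrite mulr_ile1 ?cnorm_ge0 ?cnorm_grid_s//.
  rewrite mulrA ler_pdivlMr//.
  rewrite -(ler_pM2r g0) -mulrA; apply: (le_trans (ler_wpM2l (cnorm_ge0 _) wge)).
  by rewrite mulrC -cnormM -mulrA [_ * sg]mulrC gq mulr1.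
have e2 : cnorm (\sum_(1 <= n < N.+1) (real_complex R (expR ((2 + sg) * ln n%:R)) *
      ((npow n s - npow n.+1 s) * conjc (npow n s' - npow n.+1 s')) -
     s * conjc s' * (real_complex R n%:R^-1 * npow n w))) <= 70.
  apply: (le_trans (cnorm_sum _ _ _)).
  apply: (@le_trans _ _ (35 * \sum_(1 <= n < N.+1) n%:R^-1 ^+ 2)); last first.
    by have := sum_inv_sqr_le2 R N; lra.
  rewrite mulr_sumr big_nat [leRHS]big_nat; apply: ler_sum => n /andP[n0 _].
  have := @npow_diff_pair R n s s' sg n0 (erefl _) (erefl _) g (cnorm_grid_s R jJ) (cnorm_grid_s R kJ).
  by rewrite -/w.
(* The summable error is at most 70, and [gap j k <= J] makes the right-hand side at least 80. *)
have e3 : 70 <= (80 * J)%:R * (gap j k)%:R^-1 :> R.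
  rewrite ler_pdivlMr// natrM; apply: ler_pM; [exact: ler0n|exact: ler0n|by rewrite (ler_nat R 70 80)|].
  by rewrite ler_nat gap_le.
apply: (le_trans (cnormD _ _)); lra.
Qed.

Lemma grid_sieve (R : realType) (J N : nat) (b : nat -> R) : (0 < J)%N ->
  \sum_(0 <= j < J) cnorm (\sum_(1 <= n < N.+1)
     real_complex R (b n) * (npow n (grid_s J j) - npow n.+1 (grid_s J j))) ^+ 2
  <= 65 * ((80 * J)%:R * ln (80 * J)%:R) *
     \sum_(1 <= n < N.+1) expR (- ((2 + grid_sigma J) * ln n%:R)) * b n ^+ 2.
Proof.
move=> J0; have q0 : (0 : R) < (80 * J)%:R by rewrite ltr0n muln_gt0 J0.
have h4 : (4 : R) <= (80 * J)%:R by rewrite (ler_nat R 4); lia.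
have L1 : 1 <= ln (80 * J)%:R :> R.
  apply: (@le_trans _ _ (ln 4)).
    by rewrite (_ : 4 = 2 ^+ 2) ?lnXn//; [have := ln2_ge R; lra|ring].
  by rewrite ler_ln ?posrE.
have Jr : (0 : R) < J%:R by rewrite ltr0n.
have JL : ln J%:R <= ln (80 * J)%:R :> R by rewrite ler_ln ?posrE// ler_nat leq_pmull.
apply: (@large_sieve_dual R J N (fun n => expR (- ((2 + grid_sigma J) * ln n%:R))) b
  (fun n j => npow n (grid_s J j) - npow n.+1 (grid_s J j))).
- by rewrite !mulr_gt0//; lra.
- by move=> n _; rewrite expR_gt0.
- move=> j jJ; apply: (@le_trans _ _ (\sum_(0 <= k < J) 13 * ((80 * J)%:R * (gap j k)%:R^-1))).
    rewrite big_nat [leRHS]big_nat; apply: ler_sum => k /andP[_ kJ].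
    under eq_bigr => n _ do rewrite -expRN opprK.
    exact: gram_le.
  rewrite -mulr_sumr -mulr_sumr mulrA.
  (* [3 + 2 * ln J] is at most 5 times [ln (80 * J)], whence [65 = 13 * 5]. *)
  have h := sum_gap_le R jJ.
  apply: (le_trans (ler_wpM2l _ h)); first by rewrite mulr_ge0// ltW.
  by have := ler_wpM2l (ltW q0) JL; have := ler_wpM2l (ltW q0) L1; lra.
Qed.

(* The factor normalised so that [|1 + e p^-s|^2 = (1 + |p^-s|^2) (1 + e theta)]
   for a sign [e] and [s = 1/2 + sg + it]. *)
Definition theta {R : realType} (sg t : R) (p : nat) : R :=
  2 * expR (- ((2^-1 + sg) * ln p%:R)) * cos (t * ln p%:R) / (1 + prime_weight sg p).

Lemma prime_weight_sqr (R : realType) (sg : R) p : (0 < p)%N ->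
  prime_weight sg p = expR (- ((2^-1 + sg) * ln p%:R)) ^+ 2.
Proof.
move=> p0; rewrite /prime_weight -{1}(expR_ln_nat R p0) -expRN -expRD expr2 -expRD.
by congr expR; field.
Qed.

Lemma prime_weight_lt (R : realType) (sg : R) p : 0 <= sg -> (16 <= p)%N -> prime_weight sg p <= 16^-1.
Proof.
move=> s0 p16; apply: (le_trans (prime_weight_le p s0)).
by rewrite lef_pV2 ?posrE ?ltr0n// ?ler_nat// (leq_trans _ p16).
Qed.

Lemma theta_le (R : realType) (sg t : R) p : 0 <= sg -> (16 <= p)%N ->
  `|theta sg t p| <= 2 * expR (- ((2^-1 + sg) * ln p%:R)) /\ `|theta sg t p| <= 2^-1.
Proof.
move=> s0 p16; have p0 : (0 < p)%N by rewrite (leq_trans _ p16).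
have w0 := prime_weight_ge0 sg p; have w1 := prime_weight_lt s0 p16.
have E := prime_weight_sqr sg p0.
set r := expR _ in E *; have r0 : 0 <= r by exact: expR_ge0.
have h : `|theta sg t p| <= 2 * r.
  rewrite /theta -/r normrM normfV (@ger0_norm _ (1 + _)); last lra.
  rewrite ler_pdivrMr; last lra.
  rewrite normrM (@ger0_norm _ (2 * r)); last by rewrite mulr_ge0.
  apply: ler_pM => //; [by rewrite mulr_ge0|by apply: (le_trans (cos_max _)); lra].
split => //; apply: (le_trans h).
(* From [p = 16] on the weight is at most 1/16, hence its square root at most 1/4: the origin of the
   condition [16 <= p]. *)
have : r <= 4^-1.
  rewrite -(@ler_pXn2r _ 2) ?nnegrE// -E; apply: (le_trans w1).
  by rewrite expr2 -invfM -natrM.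
lra.
Qed.

(** * Correlations of the increments at two ordinates *)

Lemma theta_prod_approx (R : realType) (sg t t' : R) p : 0 <= sg -> (16 <= p)%N ->
  `|theta sg t p * theta sg t' p -
    2 * (prime_weight sg p * cos ((t - t') * ln p%:R) + prime_weight sg p * cos ((t + t') * ln p%:R))|
  <= 8 * p%:R^-1 ^+ 2.
Proof.
move=> s0 p16; have p0 : (0 < p)%N by rewrite (leq_trans _ p16).
have w0 := prime_weight_ge0 sg p; have w1 := prime_weight_lt s0 p16.
have wp := prime_weight_le p s0.
have E := prime_weight_sqr sg p0.
have e1 : cos ((t - t') * ln p%:R) = cos (t * ln p%:R) * cos (t' * ln p%:R) +
    sin (t * ln p%:R) * sin (t' * ln p%:R) by rewrite mulrBl cosB.
have e2 : cos ((t + t') * ln p%:R) = cos (t * ln p%:R) * cos (t' * ln p%:R) -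
    sin (t * ln p%:R) * sin (t' * ln p%:R) by rewrite mulrDl cosD.
rewrite e1 e2 /theta.
set r := expR _ in E *; set c := cos _; set c' := cos _; set w := prime_weight sg p in w0 w1 wp E *.
have cc : `|c * c'| <= 1 by rewrite normrM mulr_ile1 ?normr_ge0 ?cos_max.
have D0 : 0 < (1 + w) ^+ 2 by rewrite exprn_gt0//; lra.
rewrite (_ : _ - _ = - (4 * w * (c * c')) * ((2 * w + w ^+ 2) / (1 + w) ^+ 2)); last first.
  by rewrite E; field; rewrite gt_eqF// -E; lra.
have f0 : 0 <= (2 * w + w ^+ 2) / (1 + w) ^+ 2 by apply: divr_ge0; [nra|exact: ltW].
rewrite normrM normrN normrM (@ger0_norm _ (4 * w)) ?mulr_ge0// (ger0_norm f0).
have f1 : (2 * w + w ^+ 2) / (1 + w) ^+ 2 <= 2 * w by rewrite ler_pdivrMr//; nra.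
apply: (@le_trans _ _ (4 * w * (2 * w))).
  apply: ler_pM => //; first by rewrite mulr_ge0// mulr_ge0.
  by rewrite ler_piMr// mulr_ge0.
rewrite (_ : 4 * w * (2 * w) = 8 * w ^+ 2); last by ring.
by rewrite ler_wpM2l// ler_pXn2r ?nnegrE ?invr_ge0.
Qed.

Lemma sum_theta_prod (R : realType) (sg t t' : R) (m n : nat) : 0 <= sg -> (16 <= m)%N ->
  `|\sum_(m <= p < n | prime p) theta sg t p * theta sg t' p -
    2 * (\sum_(m <= p < n | prime p) prime_weight sg p * cos ((t - t') * ln p%:R) +
         \sum_(m <= p < n | prime p) prime_weight sg p * cos ((t + t') * ln p%:R))| <= 16.
Proof.
move=> s0 m16; rewrite -big_split /= mulr_sumr -sumrB.
apply: (le_trans (ler_norm_sum _ _ _)).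
apply: (@le_trans _ _ (\sum_(m <= p < n) 8 * p%:R^-1 ^+ 2)).
  rewrite big_mkcond big_nat [leRHS]big_nat; apply: ler_sum => p /andP[mp _].
  case: ifP => _; first by apply: theta_prod_approx => //; exact: leq_trans mp.
  by rewrite mulr_ge0 ?sqr_ge0.
rewrite -mulr_sumr; case: (leqP n m) => nm; first by rewrite big_geq// mulr0.
have := sum_inv_sqr_le2 R n; rewrite (@big_cat_nat _ _ _ m)//=; last 2 first.
- by rewrite (leq_trans _ m16).
- by rewrite ltnW// ltnS ltnW.
rewrite (@big_cat_nat _ _ _ n m)//= ?(ltnW nm)//.
have : 0 <= \sum_(1 <= i < m) i%:R^-1 ^+ 2 :> R by rewrite sumr_ge0// => i _; rewrite sqr_ge0.
have : 0 <= \sum_(n <= i < n.+1) i%:R^-1 ^+ 2 :> R by rewrite sumr_ge0// => i _; rewrite sqr_ge0.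
lra.
Qed.

(** The interval [[1/40, 1/20]] contains the sums of two grid ordinates: its lower end bounds
    [1 / v], its upper end is the range of [twisted_prime_sum]. *)
Lemma sum_cos_bounded (R : realType) : exists2 C : R, 0 <= C & forall (sg v : R) (m n : nat),
  0 <= sg -> 40^-1 <= v <= 20^-1 -> (2 <= m)%N ->
  `|\sum_(m <= p < n | prime p) prime_weight sg p * cos (v * ln p%:R)| <= C.
Proof.
exists (2 * (608 * 40) * 2).
  by apply: mulr_ge0; [apply: mulr_ge0; [exact: ler0n|apply: mulr_ge0; exact: ler0n]|exact: ler0n].
move=> sg v m n s0 /andP[v1 v2] m2.
have v0 : 0 < v <= 20^-1 by rewrite v2 andbT; apply: lt_le_trans v1; rewrite invr_gt0 ltr0n.
have vp : 0 < v by case/andP: v0.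
apply: (le_trans (sum_weight_cos n s0 v0 m2)).
have lm := ln_ge_half R m2; have l0 : 0 < ln m%:R :> R by apply: lt_le_trans lm; rewrite invr_gt0.
apply: ler_pM.
- by apply: mulr_ge0; [exact: ler0n|apply: divr_ge0; [exact: ler0n|exact: ltW]].
- by rewrite invr_ge0 ltW.
- apply: ler_wpM2l; first exact: ler0n.
  apply: ler_wpM2l; first exact: ler0n.
  by rewrite -[leRHS]invrK lef_pV2 ?posrE ?invr_gt0 ?ltr0n.
- by rewrite -[leRHS]invrK lef_pV2 ?posrE ?invr_gt0 ?ltr0n.
Qed.

(** Ordinates at distance [u = gap / q] decorrelate at the primes with [ln p >= 1 / u], since the
    oscillating sum is [O (1 / (u ln m))]. For [j = k] there is no oscillation, but then the
    condition puts [m] beyond the cut-off [exp q] of the weights. The term in [t + t'] is bounded in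
    both cases. *)
Lemma grid_two_point (R : realType) : exists2 C : R, 0 <= C & forall (J j k m n : nat),
  (j < J)%N -> (k < J)%N -> (16 <= m)%N -> (80 * J)%:R * (gap j k)%:R^-1 <= ln m%:R :> R ->
  `|\sum_(m <= p < n | prime p) theta (grid_sigma J) (grid_t J j) p * theta (grid_sigma J) (grid_t J k) p| <= C.
Proof.
have [C0 C00 hC0] := sum_cos_bounded R.
have [C1 C10 C1E] : exists2 C1 : R, 0 <= C1 & 2 * 608 <= C1 /\ 60 <= C1.
  exists (2 * 608); first by apply: mulr_ge0; exact: ler0n.
  by split => //; rewrite -natrM ler_nat.
case: C1E => C1a C1b.
exists (2 * (C1 + C0) + 16).
  by apply: addr_ge0; [apply: mulr_ge0; [exact: ler0n|exact: addr_ge0]|exact: ler0n].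
move=> J j k m n jJ kJ m16 hm.
have J0 : (0 < J)%N by rewrite (leq_trans _ jJ).
have /andP[g0 g1] := grid_sigma_bounds R J0; have /andP[t0 t1] := grid_t_bounds R jJ.
have /andP[t0' t1'] := grid_t_bounds R kJ.
have m2 : (2 <= m)%N by rewrite (leq_trans _ m16).
have qs : (80 * J)%:R * grid_sigma J = 1 :> R by rewrite divff// pnatr_eq0 muln_eq0 -lt0n J0.
set sg := grid_sigma J in g0 g1 qs *.
have S := @sum_theta_prod R sg (grid_t J j) (grid_t J k) m n (ltW g0) m16.
have hv : 40^-1 <= (grid_t J j + grid_t J k : R) <= 20^-1 by apply/andP; split; lra.
have V := hC0 sg _ m n (ltW g0) hv m2.
suff U : `|\sum_(m <= p < n | prime p) prime_weight sg p * cos ((grid_t J j - grid_t J k) * ln p%:R)| <= C1.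
  move: S U V; set A := \sum_(m <= p < n | prime p) _ * theta _ _ _; set B := \sum_(m <= p < n | prime p) _.
  set D := \sum_(m <= p < n | prime p) _.
  rewrite !ler_norml => /andP[? ?] /andP[? ?] /andP[? ?]; apply/andP; split; lra.
have tjk : grid_t J j - grid_t J k = (j%:R - k%:R) * sg :> R.
  by rewrite /grid_t -/sg; move: (80^-1 : R) => c; ring.
rewrite tjk; case: (eqVneq j k) => [jk|jk].
  have q4 : (4 <= 80 * J)%N := leq_trans (isT : (4 <= 80)%N) (leq_pmulr 80 J0).
  rewrite jk subrr mul0r (eq_bigr (fun p => prime_weight sg p)); last first.
    by move=> p _; rewrite mul0r cos0 mulr1.
  rewrite ger0_norm; last by rewrite sumr_ge0// => p _; exact: prime_weight_ge0.
  apply: le_trans C1b; apply: sum_weight_tail => //.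
  by move: hm; rewrite jk /gap subnn invr1 mulr1.
have gE : (gap j k)%:R = `|j%:R - k%:R| :> R.
  rewrite -natr_dist /gap (maxn_idPr _)// addn_gt0 !subn_gt0 orbC -neq_ltn.
  exact: jk.
set u := `|(j%:R - k%:R) * sg|.
have uE : u = (gap j k)%:R * sg by rewrite /u normrM (gtr0_norm g0) gE.
have gp : (0 : R) < (gap j k)%:R by rewrite ltr0n gap_gt0.
have u0 : 0 < u by rewrite uE mulr_gt0.
have u1 : u <= 20^-1 by rewrite /u -tjk ler_norml; apply/andP; split; lra.
rewrite (eq_bigr (fun p => prime_weight sg p * cos (u * ln p%:R))); last first.
  move=> p _; rewrite /u; case: (ger0P ((j%:R - k%:R) * sg)) => _ //.
  by rewrite mulNr cosN.
have u01 : 0 < u <= 20^-1 by rewrite u0.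
apply: (le_trans (sum_weight_cos n (ltW g0) u01 m2)); apply: le_trans C1a.
have lm := ln_ge_half R m2; have l0 : 0 < ln m%:R :> R by apply: lt_le_trans lm; rewrite invr_gt0.
have ul : 1 <= u * ln m%:R.
  have h : (80 * J)%:R * sg <= ln m%:R * (gap j k)%:R * sg.
    by rewrite ler_wpM2r ?(ltW g0)// -ler_pdivrMr.
  by rewrite qs in h; rewrite uE mulrAC (mulrC (gap j k)%:R).
rewrite (_ : 2 * (608 / u) / ln m%:R = 2 * 608 * (u * ln m%:R)^-1); last first.
  by rewrite invfM !mulrA.
apply: ler_piMr; first by apply: mulr_ge0; exact: ler0n.
by rewrite invf_le1// mulr_gt0.
Qed.

(** The two-point estimate asks for all suffixes of the list, and these are again lists of primes in
    an interval. *)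
Lemma drop_primes_in (a b i : nat) : (a <= b)%N ->
  exists2 a', (a <= a')%N & drop i (primes_in a b) = primes_in a' b.
Proof.
elim: i a => [|i IH] a ab; first by exists a; rewrite ?drop0.
move: (IH a ab) => [a' aa' e]; rewrite -addn1 addnC -drop_drop e.
have [n] := ubnP (b - a'); elim: n a' aa' {e} => // n IHn a' aa' hn.
case: (leqP b a') => ba.
  by exists a' => //; rewrite /primes_in /index_iota (eqP (ba : _ == 0%N)).
have -> : primes_in a' b = (if prime a' then [:: a'] else [::]) ++ primes_in a'.+1 b.
  rewrite (@primes_in_cat a' a'.+1 b)//; congr (_ ++ _).
  by rewrite /primes_in /index_iota subSnn /=; case: ifP.
case: ifP => pa /=; first by exists a'.+1; rewrite ?drop0// leqW.
by apply: IHn; [rewrite leqW|rewrite subnS prednK ?subn_gt0].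
Qed.

Lemma big_primes_in (R : realType) (a b : nat) (F : nat -> R) :
  \sum_(p <- primes_in a b) F p = \sum_(a <= p < b | prime p) F p.
Proof. by rewrite big_filter. Qed.

Lemma sum_theta_cube (R : realType) (sg t : R) (m n : nat) : 0 <= sg -> (16 <= m)%N ->
  \sum_(m <= p < n | prime p) 3 * `|theta sg t p| ^+ 3 <= 72.
Proof.
move=> s0 m16; case: (leqP n m) => nm; first by rewrite big_geq.
apply: (@le_trans _ _ (24 * \sum_(1 <= p < n.+1) (p%:R * Num.sqrt p%:R)^-1)); last first.
  by have := sum_inv_32_le R n; lra.
have pos p : 0 <= (p%:R * Num.sqrt p%:R)^-1 :> R by rewrite invr_ge0 mulr_ge0 ?sqrtr_ge0.
apply: (@le_trans _ _ (24 * \sum_(m <= p < n) (p%:R * Num.sqrt p%:R)^-1)); last first.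
  rewrite ler_wpM2l// (@big_cat_nat _ _ _ m 1 n.+1)//=; last 2 first.
  - by rewrite (leq_trans _ m16).
  - by rewrite ltnW// ltnS ltnW.
  rewrite (@big_cat_nat _ _ _ n m n.+1)//= ?(ltnW nm)//.
  have : 0 <= \sum_(1 <= p < m) (p%:R * Num.sqrt p%:R)^-1 :> R by rewrite sumr_ge0.
  have : 0 <= \sum_(n <= p < n.+1) (p%:R * Num.sqrt p%:R)^-1 :> R by rewrite sumr_ge0.
  lra.
rewrite big_mkcond mulr_sumr big_nat [leRHS]big_nat; apply: ler_sum => p /andP[mp _].
case: ifP => _; last by rewrite mulr_ge0.
have p16 := leq_trans m16 mp; have p0 : (0 < p)%N by rewrite (leq_trans _ p16).
have [h _] := theta_le t s0 p16; have E := prime_weight_sqr sg p0.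
set r := expR _ in h E; have r0 : 0 <= r by exact: expR_ge0.
have pr : (0 : R) < p%:R by rewrite ltr0n.
have sp : 0 < Num.sqrt p%:R :> R by rewrite sqrtr_gt0.
have rr : r ^+ 2 <= p%:R^-1 by rewrite -E; exact: prime_weight_le.
have r1 : r <= (Num.sqrt p%:R)^-1.
  by rewrite -(@ler_pXn2r _ 2) ?nnegrE ?invr_ge0 ?(ltW sp)// exprVn sqr_sqrtr ?(ltW pr).
have h3 : `|theta sg t p| ^+ 3 <= (2 * r) ^+ 3 by rewrite ler_pXn2r ?nnegrE ?mulr_ge0.
have h4 : r ^+ 3 <= (p%:R * Num.sqrt p%:R)^-1.
  by rewrite exprSr invfM; apply: ler_pM => //; rewrite exprn_ge0.
move: h3; rewrite exprMn (_ : 2 ^+ 3 = 8); last by ring.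
lra.
Qed.

Lemma sum_theta_fourth (R : realType) (sg t : R) (m n : nat) : 0 <= sg -> (16 <= m)%N ->
  \sum_(m <= p < n | prime p) theta sg t p ^+ 4 <= 32.
Proof.
move=> s0 m16; case: (leqP n m) => nm; first by rewrite big_geq.
apply: (@le_trans _ _ (16 * \sum_(1 <= p < n.+1) p%:R^-1 ^+ 2)); last first.
  by have := sum_inv_sqr_le2 R n; lra.
apply: (@le_trans _ _ (16 * \sum_(m <= p < n) p%:R^-1 ^+ 2)); last first.
  rewrite ler_wpM2l// (@big_cat_nat _ _ _ m 1 n.+1)//=; last 2 first.
  - by rewrite (leq_trans _ m16).
  - by rewrite ltnW// ltnS ltnW.
  rewrite (@big_cat_nat _ _ _ n m n.+1)//= ?(ltnW nm)//.
  have : 0 <= \sum_(1 <= p < m) p%:R^-1 ^+ 2 :> R by rewrite sumr_ge0// => i _; rewrite sqr_ge0.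
  have : 0 <= \sum_(n <= p < n.+1) p%:R^-1 ^+ 2 :> R by rewrite sumr_ge0// => i _; rewrite sqr_ge0.
  lra.
rewrite big_mkcond mulr_sumr big_nat [leRHS]big_nat; apply: ler_sum => p /andP[mp _].
case: ifP => _; last by rewrite mulr_ge0 ?sqr_ge0.
have p16 := leq_trans m16 mp; have p0 : (0 < p)%N by rewrite (leq_trans _ p16).
have [h _] := theta_le t s0 p16; have E := prime_weight_sqr sg p0.
set r := expR _ in h E; have r0 : 0 <= r by exact: expR_ge0.
have rr : r ^+ 2 <= p%:R^-1 by rewrite -E; exact: prime_weight_le.
have -> : theta sg t p ^+ 4 = (`|theta sg t p| ^+ 2) ^+ 2.
  by rewrite real_normK ?num_real// -exprM.
have h2 : `|theta sg t p| ^+ 2 <= 4 * p%:R^-1.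
  apply: (le_trans (_ : _ <= (2 * r) ^+ 2)); first by rewrite ler_pXn2r ?nnegrE ?mulr_ge0.
  by rewrite exprMn (_ : 2 ^+ 2 = 4); [rewrite ler_wpM2l|ring].
have : (`|theta sg t p| ^+ 2) ^+ 2 <= (4 * p%:R^-1) ^+ 2.
  by rewrite ler_pXn2r ?nnegrE ?sqr_ge0 ?mulr_ge0 ?invr_ge0.
by rewrite (_ : 16 * p%:R^-1 ^+ 2 = (4 * p%:R^-1) ^+ 2); [|ring].
Qed.

(** The walks separate at about [exp (q / gap)]; when this falls below [q], the cut is at [q] and no
    step is shared. *)
Lemma grid_cut (R : realType) (J j k N : nat) : (j < J)%N -> (k < J)%N ->
  (80 * J)%:R + 1 <= ln N%:R :> R ->
  exists c : nat, [/\ (80 * J <= c <= N.+1)%N, (80 * J)%:R * (gap j k)%:R^-1 <= ln c%:R :> R &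
    c = (80 * J)%N \/ ln c%:R <= (80 * J)%:R * (gap j k)%:R^-1 + 1 :> R].
Proof.
move=> jJ kJ hN; have J0 : (0 < J)%N by rewrite (leq_trans _ jJ).
have q0 : (0 : R) < (80 * J)%:R by rewrite ltr0n muln_gt0 J0.
have gp : (0 : R) < (gap j k)%:R by rewrite ltr0n gap_gt0.
have x0 : 0 < (80 * J)%:R * (gap j k)%:R^-1 :> R by rewrite divr_gt0.
have [m [m2 m1 m3]] := exists_nat_ln x0.
have N0 : (0 < N)%N by case: N hN => //; rewrite ln0//; move: q0; set q := _%:R; lra.
have N0r : (0 : R) < N%:R by rewrite ltr0n.
have m0r : (0 : R) < m%:R by rewrite ltr0n (leq_trans _ m2).
have gq : (80 * J)%:R * (gap j k)%:R^-1 <= (80 * J)%:R :> R.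
  by rewrite ler_piMr ?(ltW q0)// invf_le1// ler1n gap_gt0.
have mN : (m <= N)%N.
  rewrite -(ler_nat R) -ler_ln ?posrE//; apply: (le_trans m3); apply: le_trans hN.
  by rewrite lerD2r.
have qN : (80 * J <= N)%N.
  rewrite -(ler_nat R) -ler_ln ?posrE//; apply: le_trans hN.
  by apply: (le_trans (ln_le_sub1 q0)); rewrite lerD2l; lra.
exists (maxn (80 * J) m); split.
- by rewrite leq_maxl geq_max !leqW.
- apply: (le_trans m1); rewrite ler_ln ?posrE//; first by rewrite ler_nat leq_maxr.
  by rewrite ltr0n leq_max (leq_trans _ m2) ?orbT.
- case: (leqP m (80 * J)) => mq; by [left|right].
Qed.

(** Half of [theta ^+ 2] is [prime_weight * (1 + cos (2 t ln p))] up to a summable error; the cosine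
    sum is bounded because [2 t] stays away from 0, and Mertens gives the rest. *)
Lemma sum_theta_sqr_exp (R : realType) : exists2 C : R, 0 <= C & forall J j m c : nat,
  (j < J)%N -> (16 <= m <= c)%N ->
  expR (\sum_(m <= p < c | prime p) theta (grid_sigma J) (grid_t J j) p ^+ 2 / 2)
  <= C * (ln c%:R / ln m%:R).
Proof.
have [C0 C00 hC0] := sum_cos_bounded R.
exists (expR (72 + C0)); first exact: expR_ge0.
move=> J j q c jJ /andP[q16 qc]; have J0 : (0 < J)%N by rewrite (leq_trans _ jJ).
have /andP[g0 g1] := grid_sigma_bounds R J0; have /andP[t0 t1] := grid_t_bounds R jJ.
have q2 : (2 <= q)%N := leq_trans (isT : (2 <= 16)%N) q16.
set sg := grid_sigma J in g0 g1 *.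
have S := @sum_theta_prod R sg (grid_t J j) (grid_t J j) q c (ltW g0) q16.
have hv : 40^-1 <= (grid_t J j + grid_t J j : R) <= 20^-1 by apply/andP; split; lra.
have V := hC0 sg _ q c (ltW g0) hv q2.
have qc2 : (2 <= q <= c)%N by rewrite q2.
have W := sum_weight_le (ltW g0) qc2.
have e0 : \sum_(q <= p < c | prime p) prime_weight sg p * cos ((grid_t J j - grid_t J j) * ln p%:R) =
   \sum_(q <= p < c | prime p) prime_weight sg p.
  by apply: eq_bigr => p _; rewrite subrr mul0r cos0 mulr1.
have e1 : \sum_(q <= p < c | prime p) theta sg (grid_t J j) p ^+ 2 / 2 =
   (\sum_(q <= p < c | prime p) theta sg (grid_t J j) p * theta sg (grid_t J j) p) / 2.
  by rewrite mulr_suml.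
have lq : 0 < ln q%:R :> R by apply: lt_le_trans (ln_ge_half R q2); rewrite invr_gt0.
have lc : 0 < ln c%:R :> R by apply: lt_le_trans (ln_ge_half R (leq_trans q2 qc)); rewrite invr_gt0.
have -> : ln c%:R / ln q%:R = expR (ln (ln c%:R) - ln (ln q%:R)) :> R.
  by rewrite -ln_div ?posrE// lnK// posrE divr_gt0.
rewrite -expRD ler_expR e1; rewrite e0 in S.
move: S V W; move: (\sum_(_ <= _ < _ | _) _ * theta _ _ _) (\sum_(_ <= _ < _ | _) prime_weight _ _)
  (\sum_(_ <= _ < _ | _) _ * cos _) => a b d.
by rewrite !ler_norml => /andP[? ?] /andP[? ?] ?; lra.
Qed.

Definition grid_thetas {R : realType} (J a b j : nat) : seq R :=
  map (theta (grid_sigma J) (grid_t J j)) (primes_in a b).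

Definition grid_walk {R : realType} (J N j : nat) (es : seq R) : R :=
  walk_weight (grid_thetas J (80 * J) N.+1 j) es * height (grid_thetas J (80 * J) N.+1 j) es 1.

Lemma small_theta (R : realType) (sg t : R) (a b : nat) : 0 <= sg -> (16 <= a)%N ->
  small (map (theta sg t) (primes_in a b)).
Proof.
move=> s0 a16; apply/allP => x /mapP[p]; rewrite mem_primes_in => /and3P[_ ap _] ->.
by have [_] := theta_le t s0 (leq_trans a16 ap).
Qed.

(** The shared steps cost [ln c / ln q], about [q / (gap * ln q)], by [sum_theta_sqr_exp]; if there
    are none, the term 1 takes over. *)
Lemma grid_pair (R : realType) : exists2 C : R, 0 <= C & forall J N j k : nat,
  (j < J)%N -> (k < J)%N -> (80 * J)%:R + 1 <= ln N%:R :> R ->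
  sign_mean (size (primes_in (80 * J) N.+1)) (fun es => grid_walk J N j es * grid_walk J N k es)
  <= C * (1 + (80 * J)%:R / ln (80 * J)%:R * (gap j k)%:R^-1).
Proof.
have [C1 C10 hC1] := grid_two_point R.
have [C2 C20 hC2] := sum_theta_sqr_exp R.
have C0 : 0 <= C1 + 72 by rewrite addr_ge0.
have [K K0 hK] := two_point_le C0.
exists (K * (2 * (1 + 2 * C2))); first by rewrite !mulr_ge0// addr_ge0// mulr_ge0.
move=> J N j k jJ kJ hN; have J0 : (0 < J)%N by rewrite (leq_trans _ jJ).
have /andP[g0 g1] := grid_sigma_bounds R J0.
have q16 : (16 <= 80 * J)%N := leq_trans (isT : (16 <= 80)%N) (leq_pmulr 80 J0).
have q2 : (2 <= 80 * J)%N := leq_trans (isT : (2 <= 80)%N) (leq_pmulr 80 J0).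
have [c [/andP[qc cN] c1 c2]] := grid_cut jJ kJ hN.
set sg := grid_sigma J in g0 g1; set q := (80 * J)%N in q16 q2 qc c1 c2 *.
pose tj := theta sg (grid_t J j); pose tk := theta sg (grid_t J k).
pose pr p := (tj p, tk p).
pose l1 := map pr (primes_in q c); pose l2 := map pr (primes_in c N.+1).
have f1 : map fst (l1 ++ l2) = map tj (primes_in q N.+1).
  by rewrite -map_cat -primes_in_cat// -map_comp.
have f2 : map snd (l1 ++ l2) = map tk (primes_in q N.+1).
  by rewrite -map_cat -primes_in_cat// -map_comp.
have sz : size (primes_in q N.+1) = size (l1 ++ l2).
  by rewrite -(size_map tj) -f1 size_map.
have c16 := leq_trans q16 qc.
have fourth : \sum_(x <- l2) (x.1 ^+ 4 + x.2 ^+ 4) <= C1 + 72.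
  rewrite big_map big_primes_in big_split /=.
  have := @sum_theta_fourth R sg (grid_t J j) c N.+1 (ltW g0) c16.
  have := @sum_theta_fourth R sg (grid_t J k) c N.+1 (ltW g0) c16.
  rewrite -/tj -/tk; lra.
have far i : `|\sum_(x <- drop i l2) x.1 * x.2| <= C1 + 72.
  rewrite /l2 -map_drop big_map; have [c' cc' ->] := drop_primes_in i cN.
  rewrite big_primes_in; apply: (@le_trans _ _ C1); last by lra.
  apply: hC1 => //; first exact: leq_trans cc'.
  apply: (le_trans c1); have c0 : (0 : R) < c%:R by rewrite ltr0n (leq_trans _ c16).
  by rewrite ler_ln ?posrE ?(lt_le_trans c0)// ler_nat.
have cube t : \sum_(p <- primes_in q c) (3 * `|theta sg t p| ^+ 3) <= C1 + 72.
  by rewrite big_primes_in; have := @sum_theta_cube R sg t q c (ltW g0) q16; lra.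
have := hK l1 l2; rewrite f1 f2 -sz.
move=> /(_ (small_theta _ _ (ltW g0) q16) (small_theta _ _ (ltW g0) q16) far fourth).
rewrite !big_map !big_primes_in; move: cube => /[dup] /(_ (grid_t J j)) cj /(_ (grid_t J k)) ck.
rewrite !big_primes_in in cj ck; move=> /(_ cj ck).
move/le_trans; apply; rewrite -mulrA ler_wpM2l//.
have B i : (i < J)%N -> expR (\sum_(q <= p < c | prime p) theta sg (grid_t J i) p ^+ 2 / 2) <=
    (1 + 2 * C2) * (1 + q%:R / ln q%:R * (gap j k)%:R^-1).
  move=> iJ.
  have L1 : 2^-1 <= ln q%:R :> R := ln_ge_half R q2.
  have Lp : 0 < ln q%:R :> R by apply: lt_le_trans L1; rewrite invr_gt0.
  have gi : 0 <= q%:R / ln q%:R * (gap j k)%:R^-1 :> R.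
    by rewrite mulr_ge0 ?invr_ge0// divr_ge0 ?(ltW Lp).
  case: c2 => [cq|c2].
    rewrite big_geq ?cq// expR0 -[leLHS]mulr1.
    by apply: ler_pM => //; rewrite lerDl// mulr_ge0.
  apply: (le_trans (hC2 J i q c iJ _)); first by rewrite q16.
  apply: (@le_trans _ _ (C2 * (2 * (1 + q%:R / ln q%:R * (gap j k)%:R^-1)))); last first.
    by rewrite mulrA (mulrC C2) ler_wpM2r//; lra.
  rewrite ler_wpM2l// ler_pdivrMr//; apply: (le_trans c2).
  have a0 : 0 <= q%:R * (gap j k)%:R^-1 :> R by rewrite divr_ge0.
  rewrite (_ : 2 * (1 + q%:R / ln q%:R * (gap j k)%:R^-1) * ln q%:R =
    2 * ln q%:R + 2 * (q%:R * (gap j k)%:R^-1)); first by lra.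
  by field; rewrite pnatr_eq0 -lt0n gap_gt0 gt_eqF.
have := B j jJ; have := B k kJ; rewrite -/tj -/tk.
by move=> h1 h2; rewrite -[leRHS]mulrA mulr_natl mulr2n; exact: lerD.
Qed.

Lemma ln_grid_ge1 (R : realType) (J : nat) : (0 < J)%N -> 1 <= ln (80 * J)%:R :> R.
Proof.
move=> J0; apply: (@le_trans _ _ (ln 4)).
  by rewrite (_ : 4 = 2 ^+ 2) ?lnXn//; [have := ln2_ge R; lra|ring].
rewrite ler_ln ?posrE ?ltr0n ?muln_gt0//.
by rewrite (ler_nat R 4) (leq_trans (isT : (4 <= 80)%N))// leq_pmulr.
Qed.

(** * Moments of the killed walk averaged over the grid *)

Definition grid_mean {R : realType} (J : nat) (F : nat -> R) : R :=
  J%:R^-1 * \sum_(0 <= j < J) F j.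

Lemma grid_mean_le (R : realType) (J : nat) (F : nat -> R) (B : R) : (0 < J)%N ->
  (forall j, (j < J)%N -> F j <= B) -> grid_mean J F <= B.
Proof.
move=> J0 h; have Jr : (0 : R) < J%:R by rewrite ltr0n.
rewrite /grid_mean mulrC ler_pdivrMr// mulr_natr -[J in leRHS]subn0 -sumr_const_nat.
by rewrite big_nat [leRHS]big_nat; apply: ler_sum => j /andP[_]; exact: h.
Qed.

Lemma grid_mean_ge (R : realType) (J : nat) (F : nat -> R) (B : R) : (0 < J)%N ->
  (forall j, (j < J)%N -> B <= F j) -> B <= grid_mean J F.
Proof.
move=> J0 h; have Jr : (0 : R) < J%:R by rewrite ltr0n.
rewrite /grid_mean mulrC ler_pdivlMr// mulr_natr -[J in leLHS]subn0 -sumr_const_nat.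
by rewrite big_nat [leRHS]big_nat; apply: ler_sum => j /andP[_]; exact: h.
Qed.

Lemma sign_mean_grid (R : realType) m (J : nat) (F : nat -> seq R -> R) :
  sign_mean m (fun es => grid_mean J (F^~ es)) = grid_mean J (fun j => sign_mean m (F j)).
Proof. by rewrite /grid_mean sign_meanZ sign_mean_sum. Qed.

Lemma grid_mean_sqr (R : realType) (J : nat) (x : nat -> R) :
  grid_mean J x ^+ 2 = grid_mean J (fun j => grid_mean J (fun k => x j * x k)).
Proof.
rewrite /grid_mean; set c := J%:R^-1; set S := \sum_(0 <= j < J) x j.
rewrite (eq_bigr (fun j => x j * (c * S))); first by rewrite -mulr_suml -/S; ring.
by move=> j _; rewrite -mulr_sumr -/S; ring.
Qed.

Lemma grid_mean_gap (R : realType) (J j : nat) : (0 < J)%N -> (j < J)%N ->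
  grid_mean J (fun k => (gap j k)%:R^-1) <= J%:R^-1 * (5 * ln (80 * J)%:R) :> R.
Proof.
move=> J0 jJ; have Jr : (0 : R) < J%:R by rewrite ltr0n.
have Jr' : (0 : R) < (80 * J)%:R by rewrite ltr0n muln_gt0.
rewrite /grid_mean ler_wpM2l ?invr_ge0//; apply: (le_trans (sum_gap_le R jJ)).
have L1 := ln_grid_ge1 R J0.
have : ln J%:R <= ln (80 * J)%:R :> R by rewrite ler_ln ?posrE// ler_nat leq_pmull.
move: L1; move: (ln _) (ln _) => x y; lra.
Qed.

Lemma mean_grid_walk_ge (R : realType) (J N : nat) : (0 < J)%N ->
  1 <= sign_mean (size (primes_in (80 * J) N.+1)) (fun es => grid_mean J (fun j => grid_walk J N j es)) :> R.
Proof.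
move=> J0; rewrite (sign_mean_grid _ J (fun j es => grid_walk J N j es)).
have /andP[g0 g1] := grid_sigma_bounds R J0.
have q16 : (16 <= 80 * J)%N := leq_trans (isT : (16 <= 80)%N) (leq_pmulr 80 J0).
apply: grid_mean_ge => // j jJ; rewrite /grid_walk.
have := mean_height_ge 1 (@small_theta R (grid_sigma J) (grid_t J j) (80 * J) N.+1 (ltW g0) q16).
by rewrite size_map.
Qed.

(** The mean of [1 / gap] over the grid is [O (ln q / J)]; its logarithm cancels the [1 / ln q]
    gained by starting the walk at [q = 80 J] rather than at a fixed prime. *)
Lemma mean_grid_walk_sqr (R : realType) : exists2 C : R, 0 < C & forall J N : nat,
  (0 < J)%N -> (80 * J)%:R + 1 <= ln N%:R :> R ->
  sign_mean (size (primes_in (80 * J) N.+1))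
    (fun es => grid_mean J (fun j => grid_walk J N j es) ^+ 2) <= C.
Proof.
have [C C0 hC] := grid_pair R.
exists (C * 401 + 1); first exact: (ltr_wpDl (mulr_ge0 C0 (ler0n R 401)) ltr01).
move=> J N J0 hN; have Jr : (0 : R) < J%:R by rewrite ltr0n.
set n := size _; set L : R := ln (80 * J)%:R.
have L1 : 1 <= L := ln_grid_ge1 R J0.
have Lp : 0 < L by lra.
have E : sign_mean n (fun es : seq R => grid_mean J (fun j => grid_walk J N j es) ^+ 2) =
  grid_mean J (fun j => grid_mean J (fun k =>
    sign_mean n (fun es : seq R => grid_walk J N j es * grid_walk J N k es))).
  transitivity (sign_mean n (fun es : seq R => grid_mean J (fun j => grid_mean J (fun k =>
      grid_walk J N j es * grid_walk J N k es)))).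
    by apply: eq_sign_mean => es _ _; exact: grid_mean_sqr.
  rewrite (sign_mean_grid _ J (fun j es => grid_mean J (fun k => grid_walk J N j es * grid_walk J N k es))).
  congr (_ * _); apply: eq_bigr => j _.
  exact: (sign_mean_grid _ J (fun k es => grid_walk J N j es * grid_walk J N k es)).
rewrite E; apply: grid_mean_le => // j jJ.
apply: (@le_trans _ _ (grid_mean J (fun k => C * (1 + (80 * J)%:R / L * (gap j k)%:R^-1)))).
  rewrite /grid_mean ler_wpM2l ?invr_ge0//.
  by rewrite big_nat [leRHS]big_nat; apply: ler_sum => k /andP[_ kJ]; exact: hC.
have -> : grid_mean J (fun k => C * (1 + (80 * J)%:R / L * (gap j k)%:R^-1)) =
   C * (1 + (80 * J)%:R / L * grid_mean J (fun k => (gap j k)%:R^-1)).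
  rewrite /grid_mean -mulr_sumr big_split /= -mulr_sumr sumr_const_nat subn0 -mulr_natr.
  by field; rewrite !gt_eqF.
apply: (@le_trans _ _ (C * 401)); last by rewrite lerDl.
apply: ler_wpM2l => //.
have q0 : 0 <= (80 * J)%:R / L by rewrite divr_ge0// ltW.
apply: (le_trans (lerD (lexx _) (ler_wpM2l q0 (grid_mean_gap R J0 jJ)))).
rewrite -/L natrM (_ : 80 * J%:R / L * (J%:R^-1 * (5 * L)) = 400); first by lra.
by field; rewrite !gt_eqF.
Qed.

Lemma mean_grid_height_sqr (R : realType) : exists2 C : R, 0 < C & forall J N j : nat, (j < J)%N ->
  sign_mean (size (primes_in (80 * J) N.+1)) (fun es =>
    walk_weight (grid_thetas J (80 * J) N.+1 j) es *
    height (grid_thetas J (80 * J) N.+1 j) es 1 ^+ 2) <= C * ln (80 * J)%:R.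
Proof.
(* The initial height contributes 1 and the variances at most [4 * (L + 200)], where
   [L = ln (80 * J) >= 1]. *)
exists 805; first by rewrite ltr0n.
move=> J N j jJ; have J0 : (0 < J)%N by rewrite (leq_trans _ jJ).
have /andP[g0 g1] := grid_sigma_bounds R J0.
have q16 : (16 <= 80 * J)%N := leq_trans (isT : (16 <= 80)%N) (leq_pmulr 80 J0).
have q4 : (4 <= 80 * J)%N := leq_trans (isT : (4 <= 80)%N) (leq_pmulr 80 J0).
have L1 := ln_grid_ge1 R J0.
have := mean_height_sqr_le 1 (@small_theta R (grid_sigma J) (grid_t J j) (80 * J) N.+1 (ltW g0) q16).
rewrite size_map => h; apply: (le_trans h); rewrite big_map big_primes_in expr1n.
have h2 : \sum_(80 * J <= p < N.+1 | prime p) theta (grid_sigma J) (grid_t J j) p ^+ 2 <=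
   4 * \sum_(80 * J <= p < N.+1 | prime p) prime_weight (grid_sigma J) p :> R.
  rewrite mulr_sumr big_nat_cond [leRHS]big_nat_cond; apply: ler_sum => p /andP[/andP[qp _] _].
  have p16 := leq_trans q16 qp; have p0 : (0 < p)%N by rewrite (leq_trans _ p16).
  have [h1 _] := theta_le (grid_t J j) (ltW g0) p16.
  rewrite (prime_weight_sqr _ p0) -(real_normK (num_real (theta _ _ _))).
  rewrite (_ : 4 * expR (- ((2^-1 + grid_sigma J) * ln p%:R)) ^+ 2 =
    (2 * expR (- ((2^-1 + grid_sigma J) * ln p%:R))) ^+ 2); last by ring.
  by rewrite ler_pXn2r ?nnegrE// mulr_ge0// expR_ge0.
have h3 := @sum_weight_total R (80 * J) N.+1 q4; rewrite -/(grid_sigma J) in h3.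
move: h2 h3 L1; move: (ln _) (\sum_(_ <= _ < _ | _) _ ^+ 2) (\sum_(_ <= _ < _ | _) prime_weight _ _) => x y z.
lra.
Qed.

(** The mean of [(1 + e * th)^-1] is [(1 - th ^+ 2)^-1]. The bound is written with a square so that
    [sum_theta_sqr_exp] applies to it. *)
Lemma sign_mean_inv_weight (R : realType) (ths : seq R) : small ths ->
  sign_mean (size ths) (fun es => (walk_weight ths es)^-1)
  <= expR (\sum_(th <- ths) th ^+ 2 / 2) ^+ 2 * expR (\sum_(th <- ths) 2 * th ^+ 4).
Proof.
elim: ths => [|th ths IH] /=; first by rewrite !big_nil expR0 expr1n mul1r invr1.
case/andP => hth hs; have {}IH := IH hs.
move: hth; rewrite ler_norml => /andP[h1 h2].
under eq_sign_mean => es _ _ do rewrite invfM.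
under [X in _ + X]eq_sign_mean => es _ _ do rewrite invfM.
rewrite !sign_meanZ !big_cons -mulrDl mulrAC.
have -> : ((1 + 1 * th)^-1 + (1 + -1 * th)^-1) / 2 = (1 - th ^+ 2)^-1.
  by field; apply/and3P; split; rewrite gt_eqF//; nra.
have f : (1 - th ^+ 2)^-1 <= expR (th ^+ 2 + 2 * th ^+ 4).
  apply: le_trans (expR_ge1Dx _); have t2 : th ^+ 2 <= 4^-1 by nra.
  have t0 := sqr_ge0 th.
  rewrite -div1r ler_pdivrMr; last lra.
  rewrite (_ : th ^+ 4 = (th ^+ 2) ^+ 2); last by rewrite -exprM.
  nra.
have m0 : 0 <= sign_mean (size ths) (fun es => (walk_weight ths es)^-1).
  by apply: sign_mean_ge0 => es he _; rewrite invr_ge0 walk_weight_ge0.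
have f0 : 0 <= (1 - th ^+ 2)^-1 by rewrite invr_ge0; nra.
apply: (le_trans (ler_pM f0 m0 f IH)).
rewrite !expRD exprMn (_ : expR (th ^+ 2) = expR (th ^+ 2 / 2) ^+ 2); last first.
  by rewrite [RHS]expr2 -expRD -splitr.
by rewrite le_eqVlt; apply/orP; left; apply/eqP; ring.
Qed.

(** Between [m] and [q = 80 J] the sum of [theta ^+ 2] is at most [2 ln (ln q)] up to a constant, so
    the inverse weight costs two logarithms. *)
Lemma mean_inv_weight (R : realType) : exists2 C : R, 0 < C & forall J j m : nat, (j < J)%N ->
  (16 <= m <= 80 * J)%N ->
  sign_mean (size (primes_in m (80 * J)))
    (fun es => (walk_weight (grid_thetas J m (80 * J) j) es)^-1)
  <= C * ln (80 * J)%:R ^+ 2.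
Proof.
have [C2 C20 hC2] := sum_theta_sqr_exp R.
exists ((2 * C2) ^+ 2 * expR 64 + 1).
  by apply: ltr_wpDl => //; apply: mulr_ge0; [exact: sqr_ge0|exact: expR_ge0].
move=> J j m jJ mq; have J0 : (0 < J)%N by rewrite (leq_trans _ jJ).
have /andP[g0 g1] := grid_sigma_bounds R J0; have /andP[m16 mJ] := mq.
have L1 := ln_grid_ge1 R J0.
have := sign_mean_inv_weight (@small_theta R (grid_sigma J) (grid_t J j) m (80 * J) (ltW g0) m16).
rewrite size_map => h; apply: (le_trans h); rewrite !big_map !big_primes_in.
have h1 := hC2 J j m (80 * J)%N jJ mq.
have h2 : expR (\sum_(m <= p < 80 * J | prime p) 2 * theta (grid_sigma J) (grid_t J j) p ^+ 4) <= expR 64 :> R.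
  rewrite ler_expR -mulr_sumr.
  by have := @sum_theta_fourth R (grid_sigma J) (grid_t J j) m (80 * J) (ltW g0) m16; lra.
have m2 : (2 <= m)%N := leq_trans (isT : (2 <= 16)%N) m16.
have lm := ln_ge_half R m2; have l0 : 0 < ln m%:R :> R by apply: lt_le_trans lm; rewrite invr_gt0.
have h3 : expR (\sum_(m <= p < 80 * J | prime p) theta (grid_sigma J) (grid_t J j) p ^+ 2 / 2) <=
   2 * C2 * ln (80 * J)%:R :> R.
  apply: (le_trans h1); move: L1; move: (ln (80 * J)%:R) => L L1.
  rewrite (_ : 2 * C2 * L = C2 * (L * 2)); last by ring.
  rewrite ler_wpM2l// ler_wpM2l//; first by rewrite (le_trans _ L1).
  by rewrite -[leRHS]invrK lef_pV2 ?posrE ?invr_gt0.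
have h4 : expR (\sum_(m <= p < 80 * J | prime p) theta (grid_sigma J) (grid_t J j) p ^+ 2 / 2) ^+ 2 <=
   (2 * C2 * ln (80 * J)%:R) ^+ 2 :> R.
  by rewrite ler_pXn2r ?nnegrE ?expR_ge0// (le_trans _ h3)// expR_ge0.
apply: (le_trans (ler_pM (sqr_ge0 _) (expR_ge0 _) h4 h2)).
by rewrite exprMn mulrAC ler_wpM2r ?sqr_ge0// lerDl.
Qed.

(** * Euler products on the grid and the walk weights *)

Arguments cnorm : simpl never.

Lemma euler_prod_cat (R : realType) (s : R[i]%C) (ps1 ps2 : seq nat) (es1 es2 : seq R) :
  size es1 = size ps1 ->
  euler_prod s (ps1 ++ ps2) (es1 ++ es2) = euler_prod s ps1 es1 * euler_prod s ps2 es2.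
Proof.
elim: ps1 es1 => [|p ps1 IH] [|e es1] //=; first by rewrite mul1r.
by case=> sz; rewrite IH// mulrA.
Qed.

Lemma euler_factor_sqr (R : realType) (sg t e : R) (p : nat) : (0 < p)%N -> 0 <= sg ->
  (e == 1) || (e == -1) ->
  cnorm (1 + real_complex R e * npow p (Complex (2^-1 + sg) t)) ^+ 2 =
  (1 + prime_weight sg p) * (1 + e * theta sg t p).
Proof.
move=> p0 s0 he; have w0 := prime_weight_ge0 sg p.
have e2 : e ^+ 2 = 1 by case/orP: he => /eqP ->; rewrite ?expr1n ?sqrrN ?expr1n.
have -> : npow p (Complex (2^-1 + sg) t) = Complex (expR (- ((2^-1 + sg) * ln p%:R)) * cos (t * ln p%:R))
   (- (expR (- ((2^-1 + sg) * ln p%:R)) * sin (t * ln p%:R))).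
  by rewrite /npow /cexp ReN ImN Re_mul_real Im_mul_real /= cosN sinN mulrN.
rewrite /theta; have E := prime_weight_sqr sg p0; have D := cos2Dsin2 (t * ln p%:R).
move: w0 E D; set r := expR _; set c := cos _; set d := sin _; set w := prime_weight sg p => w0 E D.
rewrite cnorm_sqr /= !mul0r subr0 addr0 add0r.
have -> : (1 + w) * (1 + e * (2 * r * c / (1 + w))) = 1 + w + e * (2 * r * c).
  by field; rewrite gt_eqF//; lra.
rewrite (_ : (1 + e * (r * c)) ^+ 2 + (e * - (r * d)) ^+ 2 =
   1 + e * (2 * r * c) + e ^+ 2 * r ^+ 2 * (c ^+ 2 + d ^+ 2)); last by ring.
by rewrite D e2 E; ring.
Qed.

Lemma euler_prod_sqr (R : realType) (sg t : R) (ps : seq nat) (es : seq R) :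
  all prime ps -> 0 <= sg -> signs es -> size es = size ps ->
  cnorm (euler_prod (Complex (2^-1 + sg) t) ps es) ^+ 2 =
  \prod_(p <- ps) (1 + prime_weight sg p) * walk_weight (map (theta sg t) ps) es.
Proof.
move=> hps s0; elim: ps hps es => [|p ps IH] /= hps [|e es] //=.
  by rewrite cnorm1 expr1n big_nil mulr1.
case/andP: hps => pp hps /andP[he hes] [sz].
rewrite cnormM exprMn euler_factor_sqr ?prime_gt0// IH// big_cons; ring.
Qed.

(** The worst factor is [1 - 2 ^ (- 1/2) > 1/4]. The loss is exponential in the number of primes,
    but the bound is applied only to the primes below [m], which is fixed before [J]. *)
Lemma euler_prod_lower (R : realType) (sg t : R) (ps : seq nat) (es : seq R) :
  all prime ps -> 0 <= sg -> signs es -> size es = size ps ->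
  4^-1 ^+ size ps <= cnorm (euler_prod (Complex (2^-1 + sg) t) ps es).
Proof.
move=> hps s0; elim: ps hps es => [|p ps IH] /= hps [|e es] //=.
  by rewrite cnorm1 expr0.
case/andP: hps => pp hps /andP[he hes] [sz].
rewrite cnormM exprS; apply: ler_pM; rewrite ?exprn_ge0 ?invr_ge0//; last exact: IH.
have h : cnorm (real_complex R e * npow p (Complex (2^-1 + sg) t)) <= 3 / 4.
  rewrite cnormM cnorm_real cnorm_npow /=.
  have -> : `|e| = 1 by case/orP: he => /eqP ->; rewrite ?normrN normr1.
  rewrite mul1r.
  have l2 : ln 2 <= ln p%:R :> R.
    have p0 : (0 : R) < p%:R by rewrite ltr0n prime_gt0.
    by rewrite ler_ln ?posrE// (ler_nat R 2) prime_gt1.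
  apply: (@le_trans _ _ (expR (- (2^-1 * ln 2)))).
    by rewrite ler_expR lerN2; have := ln2_ge R; nra.
  rewrite -(@ler_pXn2r _ 2) ?nnegrE ?expR_ge0 ?divr_ge0// -expRM_natr mulNr mulrAC mulVf// mul1r.
  rewrite expRN lnK ?posrE//; lra.
have := cnormB (1 + real_complex R e * npow p (Complex (2^-1 + sg) t))
   (real_complex R e * npow p (Complex (2^-1 + sg) t)).
rewrite addrK cnorm1; lra.
Qed.

Lemma prod_weight_ge (R : realType) : exists2 c : R, 0 < c & forall J N : nat, (0 < J)%N ->
  (80 * J)%:R + 1 <= ln N.+1%:R :> R ->
  c * ((80 * J)%:R / ln (80 * J)%:R) <= \prod_(p <- primes_in (80 * J) N.+1) (1 + prime_weight (grid_sigma J) p).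
Proof.
(* 100 comes from [sum_weight_ge], and 2 from the squares in [1 + x >= expR (x - x ^+ 2)]. *)
exists (expR (- 102)); first exact: expR_gt0.
move=> J N J0 hN; have q4 : (4 <= 80 * J)%N := leq_trans (isT : (4 <= 80)%N) (leq_pmulr 80 J0).
have /andP[g0 g1] := grid_sigma_bounds R J0.
have L1 := ln_grid_ge1 R J0; have Lp : 0 < ln (80 * J)%:R :> R by lra.
have qp : (0 : R) < (80 * J)%:R by rewrite ltr0n (leq_trans _ q4).
have h := sum_weight_ge q4 hN; rewrite -/(grid_sigma J) in h.
apply: (@le_trans _ _ (expR (\sum_(p <- primes_in (80 * J) N.+1)
   (prime_weight (grid_sigma J) p - prime_weight (grid_sigma J : R) p ^+ 2)))).
  have -> : (80 * J)%:R / ln (80 * J)%:R = expR (ln (80 * J)%:R - ln (ln (80 * J)%:R)) :> R.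
    by rewrite -ln_div ?posrE// lnK// posrE divr_gt0.
  rewrite -expRD ler_expR big_primes_in sumrB.
  have h2 : \sum_(80 * J <= p < N.+1 | prime p) prime_weight (grid_sigma J) p ^+ 2 <= 2 :> R.
    apply: le_trans (sum_inv_sqr_le2 R (maxn N (80 * J))).
    apply: (@le_trans _ _ (\sum_(80 * J <= p < N.+1) p%:R^-1 ^+ 2)).
      rewrite big_mkcond; apply: ler_sum => p _; case: ifP => _; last exact: sqr_ge0.
      by rewrite ler_pXn2r ?nnegrE ?prime_weight_ge0 ?invr_ge0// prime_weight_le// ltW.
    case: (leqP N.+1 (80 * J)) => qN.
      by rewrite big_geq// sumr_ge0// => p _; exact: sqr_ge0.
    rewrite [leRHS](@big_cat_nat _ _ _ (80 * J))//=; last 2 first.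
    - by rewrite (leq_trans _ q4).
    - by rewrite ltnW// ltnS leq_maxr.
    rewrite [X in _ <= _ + X](@big_cat_nat _ _ _ N.+1)//= ?(ltnW qN)// ?ltnS ?leq_maxl//.
    rewrite addrCA lerDl addr_ge0// sumr_ge0// => p _; exact: sqr_ge0.
  move: h h2; move: (ln _) (ln (ln _)) (\sum_(_ <= _ < _ | _) prime_weight _ _)
    (\sum_(_ <= _ < _ | _) prime_weight _ _ ^+ 2) => x y z u; lra.
rewrite expR_sum; apply: ler_prod => p _; rewrite expR_ge0/=.
have := prime_weight_ge0 (grid_sigma J : R) p; set x := prime_weight _ _ => x0.
rewrite (_ : x - x ^+ 2 = - (- x + x ^+ 2)); last by ring.
have x1 : 0 < 1 + x by lra.
rewrite expRN -[leRHS]invrK lef_pV2 ?posrE ?expR_gt0 ?invr_gt0//.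
apply: le_trans (expR_ge1Dx _); rewrite -div1r ler_pdivrMr//; nra.
Qed.

Lemma sum_zeta_le (R : realType) (d : R) (N : nat) : 0 < d ->
  \sum_(1 <= n < N.+1) n%:R^-1 * expR (- (d * ln n%:R)) <= 1 + d^-1.
Proof.
move=> d0; case: N => [|N]; first by rewrite big_geq// addr_ge0// invr_ge0 ltW.
rewrite big_ltn// ln1 mulr0 oppr0 expR0 invr1 mulr1 lerD2l.
rewrite -(ler_pM2l d0) divff ?gt_eqF// mulr_sumr big_add1 /=.
apply: (@le_trans _ _ (\sum_(1 <= n < N.+1) (- expR (- (d * ln n.+1%:R)) - - expR (- (d * ln n%:R))))).
  rewrite big_nat [leRHS]big_nat; apply: ler_sum => n /andP[n0 _].
  have [d1 d2 d3 _] := ln_succ_bounds R n0.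
  set b := ln n.+1%:R in d1 d2 d3 *; set a := ln n%:R in d1 d2 d3 *.
  have e : expR (- (d * a)) = expR (- (d * b)) * expR (d * (b - a)).
    by rewrite -expRD; congr expR; ring.
  rewrite e opprK.
  have := expR_ge1Dx (d * (b - a)); have e0 := expR_gt0 (- (d * b)).
  set x := expR (- (d * b)) in e0 *; set y := expR (d * (b - a)) => hy.
  apply: (@le_trans _ _ (x * (d * (b - a)))); last by nra.
  rewrite (_ : d * (n.+1%:R^-1 * x) = x * (d * n.+1%:R^-1)); last by ring.
  by apply: ler_wpM2l; [exact: ltW|apply: ler_wpM2l; [exact: ltW|exact: d3]].
rewrite (telescope_sumr (fun n : nat => - expR (- (d * ln n%:R))))//.
by rewrite ln1 mulr0 oppr0 expR0 opprK addrC gerDl oppr_le0 expR_ge0.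
Qed.

(** * Consequences of a bound on the partial sums *)

Definition partial_sum {R : realType} (e : nat -> R) (n : nat) : R :=
  \sum_(1 <= k < n.+1) sqf_mult e k.

(** Stopping at [N] makes this a condition on the finitely many signs at primes up to [N]; it gets
    stronger as [N] grows, which the iteration over ranges of primes uses. *)
Definition bounded_upto {R : realType} (C A : R) (x0 N : nat) (e : nat -> R) : Prop :=
  forall n, (x0 <= n <= N)%N ->
    `|partial_sum e n| <= C * (Num.sqrt n%:R * ln (ln n%:R) `^ (- A)).

Lemma partial_sum_le (R : realType) (e : nat -> R) (N n : nat) :
  (forall p, prime p -> (p <= N)%N -> `|e p| <= 1) -> (n <= N)%N -> `|partial_sum e n| <= n%:R.
Proof.
move=> he nN; rewrite /partial_sum; apply: (le_trans (ler_norm_sum _ _ _)).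
apply: (@le_trans _ _ (\sum_(1 <= k < n.+1) 1)); last by rewrite sumr_const_nat subn1.
rewrite big_nat [leRHS]big_nat; apply: ler_sum => k /andP[k0 kn].
rewrite /sqf_mult; case: ifP => _; last by rewrite normr0.
rewrite normr_prod big_seq.
suff /andP[] : 0 <= \prod_(p <- primes k | p \in primes k) `|e p| <= 1 by [].
apply: (big_ind (fun x : R => 0 <= x <= 1)) => [|x y /andP[x0 x1] /andP[y0 y1]|p]; first by rewrite ler01 lexx.
  by rewrite mulr_ge0//= mulr_ile1.
rewrite mem_primes => /and3P[pp _ pk].
by rewrite normr_ge0 he// (leq_trans (dvdn_leq k0 pk))// (leq_trans _ nN).
Qed.

Lemma lnln_ge1 (R : realType) (n : nat) : (256 <= n)%N -> 1 <= ln (ln n%:R) :> R.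
Proof.
move=> n256; have n0 : (0 : R) < n%:R by rewrite ltr0n (leq_trans _ n256).
have l4 : 4 <= ln n%:R :> R.
  (* [256 = 2 ^ 8] and [ln 2 >= 1/2] give 4, which exceeds [expR 1]. *)
  apply: (@le_trans _ _ (ln (2 ^+ 8))).
    by rewrite lnXn//; have := ln2_ge R; lra.
  rewrite ler_ln ?posrE ?exprn_gt0//; apply: (@le_trans _ _ 256%:R); last by rewrite ler_nat.
  by rewrite -natrX ler_nat.
have e4 : expR 1 <= 4 :> R.
  have h : expR 2^-1 <= 2 :> R.
    by apply: (le_trans (expR_le_quad (lexx _))); rewrite expr2; lra.
  have -> : expR 1 = expR 2^-1 * expR 2^-1 :> R by rewrite -expRD; congr expR; lra.
  have := expR_ge0 (2^-1 : R); nra.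
rewrite -[leLHS]expRK ler_ln ?posrE ?expR_gt0//; [exact: le_trans e4 l4|lra].
Qed.

(** Three ranges, with [q = 80 J]. Below [x0] the trivial bound gives at most 1 per term. While
    [ln n <= sqrt q] the factor in [A] is only bounded by 1, but the sum of [1 / n] is about
    [sqrt q]. Beyond, [ln (ln n) >= ln q / 2], and the cut-off [n ^ (- 1 / q)] limits the sum to
    about [q]. *)
Lemma weighted_square_sum_le (R : realType) (C A : R) (x0 N J : nat) (e : nat -> R) :
  0 <= C -> 0 < A -> (256 <= x0)%N -> (0 < J)%N ->
  (forall p, prime p -> (p <= N)%N -> `|e p| <= 1) -> bounded_upto C A x0 N e ->
  \sum_(1 <= n < N.+1) expR (- ((2 + grid_sigma J) * ln n%:R)) * partial_sum e n ^+ 2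
  <= x0%:R + 4 * C ^+ 2 * (1 + Num.sqrt (80 * J)%:R) +
     (C * (ln (80 * J)%:R / 2) `^ (- A)) ^+ 2 * (1 + (80 * J)%:R).
Proof.
move=> C0 A0 x256 J0 he hb.
have /andP[g0 g1] := grid_sigma_bounds R J0; set sg := grid_sigma J in g0 g1 *.
have qp : (0 : R) < (80 * J)%:R by rewrite ltr0n muln_gt0.
set q : R := (80 * J)%:R in qp *.
have sq0 : 0 < Num.sqrt q by rewrite sqrtr_gt0.
set eta := C * _; have eta0 : 0 <= eta by rewrite mulr_ge0 ?powR_ge0.
have S1 := @sum_zeta_le R (Num.sqrt q)^-1 N; rewrite invr_gt0 sq0 invrK in S1; have {}S1 := S1 isT.
have S2 := sum_zeta_le N g0; rewrite /sg /grid_sigma invrK -/q in S2.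
apply: (@le_trans _ _ (\sum_(1 <= n < N.+1) ((n < x0)%:R +
   4 * C ^+ 2 * (n%:R^-1 * expR (- ((Num.sqrt q)^-1 * ln n%:R))) +
   eta ^+ 2 * (n%:R^-1 * expR (- (q^-1 * ln n%:R)))))); last first.
  rewrite !big_split /= -!mulr_sumr; apply: lerD; first apply: lerD.
  - case: (leqP x0 N) => xN.
      rewrite (@big_cat_nat _ _ _ x0)//=; last 2 first.
      + by rewrite (leq_trans _ x256).
      + exact: leqW.
      rewrite [X in _ + X]big_nat [X in _ + X]big1 ?addr0; last first.
        by move=> n /andP[xn _]; rewrite ltnNge xn.
      apply: (@le_trans _ _ (\sum_(1 <= n < x0) 1)).
        by apply: ler_sum => n _; case: (n < x0)%N.
      by rewrite sumr_const_nat ler_nat leq_subr.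
    apply: (@le_trans _ _ (\sum_(1 <= n < N.+1) 1)).
      by apply: ler_sum => n _; case: (n < x0)%N.
    by rewrite sumr_const_nat subn1 ler_nat ltnW.
  - by rewrite ler_wpM2l// mulr_ge0// sqr_ge0.
  - by rewrite ler_wpM2l ?sqr_ge0.
rewrite big_nat [leRHS]big_nat; apply: ler_sum => n /andP[n0 nN].
have n0r : (0 : R) < n%:R by rewrite ltr0n.
have l0 := ln_nat_ge0 R n.
have E : expR (- ((2 + sg) * ln n%:R)) = n%:R^-1 ^+ 2 * expR (- (sg * ln n%:R)).
  rewrite -{2}(expR_ln_nat R n0) -expRN -expRM_natr -expRD; congr expR; ring.
rewrite E; set x := n%:R^-1; have x0' : 0 < x by rewrite invr_gt0.
have xn : x * n%:R = 1 by rewrite mulVf// gt_eqF.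
have es1 : expR (- (sg * ln n%:R)) <= 1 by rewrite expR_le1 oppr_le0 mulr_ge0// ltW.
have es0 := expR_ge0 (- (sg * ln n%:R)).
have t2 : 0 <= 4 * C ^+ 2 * (x * expR (- ((Num.sqrt q)^-1 * ln n%:R))).
  by rewrite mulr_ge0 ?mulr_ge0 ?sqr_ge0 ?expR_ge0// ltW.
have t3 : 0 <= eta ^+ 2 * (x * expR (- (q^-1 * ln n%:R))).
  apply: mulr_ge0; first exact: sqr_ge0.
  by apply: mulr_ge0; [exact: ltW|exact: expR_ge0].
case: (ltnP n x0) => nx.
  have h := partial_sum_le he (nN : (n <= N)%N).
  have h2 : partial_sum e n ^+ 2 <= n%:R ^+ 2.
    by rewrite -(real_normK (num_real (partial_sum e n))) ler_pXn2r ?nnegrE.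
  have : x ^+ 2 * expR (- (sg * ln n%:R)) * partial_sum e n ^+ 2 <= x ^+ 2 * 1 * n%:R ^+ 2.
    apply: ler_pM => //; [|exact: sqr_ge0|]; last by apply: ler_wpM2l => //; exact: sqr_ge0.
    by apply: mulr_ge0; [exact: sqr_ge0|].
  rewrite mulr1 -exprMn xn expr1n; move: t2 t3.
  by move=> t2' t3' h3; apply: (le_trans h3); rewrite -addrA lerDl addr_ge0.
rewrite add0r.
have hb' := hb n; rewrite nx /= in hb'; have {}hb' := hb' nN.
have ll1 := lnln_ge1 R (leq_trans x256 nx).
set P := ln (ln n%:R) `^ (- A) in hb'.
have P0 : 0 <= P by exact: powR_ge0.
have hsq : partial_sum e n ^+ 2 <= (C * P) ^+ 2 * n%:R.
  rewrite -(real_normK (num_real (partial_sum e n))).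
  rewrite (_ : (C * P) ^+ 2 * n%:R = (C * (Num.sqrt n%:R * P)) ^+ 2); last first.
    by rewrite !exprMn sqr_sqrtr ?(ltW n0r)//; ring.
  by rewrite ler_pXn2r ?nnegrE//; apply: mulr_ge0 => //; apply: mulr_ge0 => //; exact: sqrtr_ge0.
have main : x ^+ 2 * expR (- (sg * ln n%:R)) * partial_sum e n ^+ 2 <=
   (C * P) ^+ 2 * (x * expR (- (sg * ln n%:R))).
  apply: (le_trans (ler_wpM2l _ hsq)); first by apply: mulr_ge0; [exact: sqr_ge0|].
  rewrite [leLHS](_ : _ = (C * P) ^+ 2 * (x * expR (- (sg * ln n%:R))) * (x * n%:R)); last by ring.
  by rewrite xn mulr1.
apply: (le_trans main).
case: (leP (ln n%:R) (Num.sqrt q)) => hl.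
  apply: (@le_trans _ _ (4 * C ^+ 2 * (x * expR (- ((Num.sqrt q)^-1 * ln n%:R))))); last by rewrite lerDl.
  have P1 : P <= 1.
    rewrite /P powRN invf_le1 ?powR_gt0//; last by lra.
    by rewrite -[leLHS](powRr0 (ln (ln n%:R))); apply: ler_powR => //; exact: ltW.
  (* On this range the smooth cut-off at [exp (sqrt q)] is at least [expR (- 1)], hence the factor 4
     in the statement. *)
  have e4 : 4^-1 <= expR (- ((Num.sqrt q)^-1 * ln n%:R)).
    have h : expR 2^-1 <= 2 :> R.
      by apply: (le_trans (expR_le_quad (lexx _))); rewrite expr2; lra.
    have h1 : expR 1 <= 4 :> R.
      have -> : expR 1 = expR 2^-1 * expR 2^-1 :> R by rewrite -expRD; congr expR; lra.
  have := expR_ge0 (2^-1 : R); nra.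
    rewrite expRN lef_pV2 ?posrE ?expR_gt0//; apply: le_trans h1; rewrite ler_expR.
    by rewrite mulrC ler_pdivrMr// mul1r.
  rewrite (_ : 4 * C ^+ 2 * _ = C ^+ 2 * (x * (4 * expR (- ((Num.sqrt q)^-1 * ln n%:R))))); last by ring.
  apply: ler_pM; rewrite ?sqr_ge0 ?mulr_ge0 ?(ltW x0')//.
    by rewrite exprMn ler_piMr ?sqr_ge0// -[leRHS](expr1n _ 2) ler_pXn2r ?nnegrE.
  rewrite ler_wpM2l ?(ltW x0')//; lra.
apply: (@le_trans _ _ (eta ^+ 2 * (x * expR (- (q^-1 * ln n%:R))))); last by rewrite lerDr.
have L1 := ln_grid_ge1 R J0.
have Pe : P <= (ln q / 2) `^ (- A).
  have hh : ln q / 2 <= ln (ln n%:R).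
    have -> : ln q / 2 = ln (Num.sqrt q).
      by rewrite -{1}(sqr_sqrtr (ltW qp)) lnXn// -[_ *+ 2]mulr_natr mulfK.
    by rewrite ler_ln ?posrE ?(lt_trans sq0 hl)// ltW.
  have Lp : 0 < ln q / 2 by rewrite divr_gt0// (lt_le_trans _ L1).
  rewrite /P !powRN lef_pV2 ?posrE ?powR_gt0//; last by lra.
  by rewrite ge0_ler_powR ?nnegrE ?(ltW A0) ?(ltW Lp)//; lra.
have CP0 : 0 <= C * P by exact: mulr_ge0.
have hCP : C * P <= eta by exact: ler_wpM2l.
have xe0 : 0 <= x * expR (- (sg * ln n%:R)) by apply: mulr_ge0; [exact: ltW|].
apply: ler_pM => //; first exact: sqr_ge0.
  by rewrite ler_pXn2r ?nnegrE.
Qed.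

(** After summation by parts the boundary term is bounded by the hypothesis at [N], and the rest is
    the large sieve divided by [J], whence the factor 80. *)
Lemma grid_mean_sum_le (R : realType) (C A : R) (x0 N J : nat) (e : nat -> R) :
  0 <= C -> 0 < A -> (256 <= x0)%N -> (x0 <= N)%N -> (0 < J)%N ->
  bounded_upto C A x0 N e ->
  grid_mean J (fun j => cnorm (\sum_(1 <= n < N.+1) real_complex R (sqf_mult e n) * npow n (grid_s J j)) ^+ 2)
  <= 2 * C ^+ 2 + 2 * (65 * 80) * (ln (80 * J)%:R *
    \sum_(1 <= n < N.+1) expR (- ((2 + grid_sigma J) * ln n%:R)) * partial_sum e n ^+ 2).
Proof.
move=> C0 A0 x256 xN J0 hb; have Jr : (0 : R) < J%:R by rewrite ltr0n.
have /andP[g0 g1] := grid_sigma_bounds R J0.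
set Om := \sum_(1 <= n < N.+1) expR _ * _.
pose V j := \sum_(1 <= n < N.+1) real_complex R (partial_sum e n) * (npow n (grid_s J j) - npow n.+1 (grid_s J j)).
have Vb : grid_mean J (fun j => cnorm (V j) ^+ 2) <= 65 * 80 * (ln (80 * J)%:R * Om).
  have := grid_sieve N (partial_sum e) J0; rewrite -/Om => h.
  rewrite /grid_mean -(ler_pM2l Jr) mulVKf ?gt_eqF//; apply: (le_trans h).
  by rewrite natrM le_eqVlt; apply/orP; left; apply/eqP; ring.
have last : partial_sum e N ^+ 2 <= C ^+ 2 * N%:R.
  have := hb N; rewrite xN leqnn => /(_ isT) h.
  have ll1 := lnln_ge1 R (leq_trans x256 xN).
  have P1 : ln (ln N%:R) `^ (- A) <= 1 :> R.
    rewrite powRN invf_le1 ?powR_gt0//; last by lra.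
    by rewrite -[leLHS](powRr0 (ln (ln N%:R))); apply: ler_powR => //; exact: ltW.
  have h' : `|partial_sum e N| <= C * Num.sqrt N%:R.
    by apply: (le_trans h); rewrite ler_wpM2l// ler_piMr// sqrtr_ge0.
  rewrite -(real_normK (num_real (partial_sum e N))).
  rewrite (_ : C ^+ 2 * N%:R = (C * Num.sqrt N%:R) ^+ 2); last by rewrite exprMn sqr_sqrtr.
  by rewrite ler_pXn2r ?nnegrE// mulr_ge0// sqrtr_ge0.
apply: (@le_trans _ _ (grid_mean J (fun j => 2 * C ^+ 2 + 2 * cnorm (V j) ^+ 2))); last first.
  rewrite /grid_mean big_split /= sumr_const_nat subn0 -mulr_sumr mulrDr -(mulr_natl (2 * C ^+ 2)) mulKf ?gt_eqF//.
  by rewrite lerD2l mulrCA -[leRHS]mulrA ler_wpM2l.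
rewrite /grid_mean ler_wpM2l ?invr_ge0//; apply: ler_sum => j _.
rewrite abel_npow -/(V j) -/(partial_sum e N).
set a := real_complex R _ * _.
have pa := cnorm_parallelogram a (V j).
have a2 : cnorm a ^+ 2 <= C ^+ 2.
  rewrite /a cnormM cnorm_real exprMn real_normK ?num_real//.
  apply: (@le_trans _ _ (C ^+ 2 * N%:R * N.+1%:R^-1)).
    apply: ler_pM; rewrite ?sqr_ge0//.
    rewrite cnorm_npow /= -expRM_natr -(expR_ln_nat R (isT : (0 < N.+1)%N)) -expRN expRK ler_expR.
    have := ln_nat_ge0 R N.+1; nra.
  by rewrite -mulrA ler_piMr ?sqr_ge0// ler_pdivrMr ?ltr0n// mul1r ler_nat.
have := sqr_ge0 (cnorm (a - V j)); lra.
Qed.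

(** Each term receives half of [q]. Since [q = sqrt q * expR (L / 2)], a sixth power of [L / 2]
    suffices for the first; in the second, [L ^+ 5 * (L / 2) ^ (- 2 A)] is a negative power of [L]
    exactly when [A > 5/2]. *)
Lemma log_powers_le (R : realType) (A K q : R) : 5 / 2 < A -> 0 <= K -> 0 < q -> 1 <= ln q ->
  720 * (128 * K) <= ln q -> 2 * (64 * K + 1) `^ (2 * A - 5)^-1 <= ln q ->
  K * (ln q ^+ 5 * (Num.sqrt q + ((ln q / 2) `^ (- A)) ^+ 2 * q)) <= q.
Proof.
move=> hA K0 qp; set L := ln q; set z := _ `^ _ => L1 LK Lz'.
have z0 : 0 <= z by exact: powR_ge0.
have Lz : z <= L / 2 by lra.
have y0 : 0 < L / 2 by lra.
have sq : Num.sqrt q = expR (L / 2).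
  have -> : q = expR (L / 2) ^+ 2 by rewrite expr2 -expRD -splitr lnK.
  by rewrite sqrtr_sqr ger0_norm ?expR_ge0.
have qq : q = expR (L / 2) * expR (L / 2) by rewrite -expRD -splitr lnK.
have p1 : K * (L ^+ 5 * Num.sqrt q) <= q / 2.
  have h := @expR_ge1Dxn R (L / 2) 5 (ltW y0).
  rewrite sq qq; have e0 := expR_gt0 (L / 2).
  rewrite (_ : K * _ = K * L ^+ 5 * expR (L / 2)); last by ring.
  rewrite [leRHS]mulrAC; apply: ler_wpM2r; first exact: ltW.
  have h6 : (L / 2) ^+ 6 / 720 <= expR (L / 2).
    by move: h; have -> : (6`! = 720)%N by []; lra.
  have p2 : (0 : R) < 2 by rewrite ltr0n.
  have p720 : (0 : R) < 720 by rewrite ltr0n.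
  rewrite (ler_pdivlMr _ _ p2); apply: le_trans h6; rewrite (ler_pdivlMr _ _ p720).
  rewrite (_ : K * L ^+ 5 * 2 * 720 = L ^+ 5 * (720 * (128 * K)) / 64); last by field.
  rewrite (_ : (L / 2) ^+ 6 = L ^+ 5 * L / 64); last by field.
  by rewrite ler_wpM2r ?invr_ge0// ler_wpM2l// exprn_ge0//; lra.
have p2 : K * (L ^+ 5 * ((L / 2) `^ (- A)) ^+ 2) <= 2^-1.
  have yn : L / 2 != 0 by rewrite gt_eqF.
  have -> : K * (L ^+ 5 * ((L / 2) `^ (- A)) ^+ 2) = 32 * K * ((L / 2) `^ (2 * A - 5))^-1.
    rewrite -powRN (_ : - (2 * A - 5) = 5%:R + (- A + - A)); last by ring.
    rewrite powRD ?yn ?implybT// [(L / 2) `^ (- A + - A)]powRD ?yn ?implybT// powR_mulrn ?(ltW y0)//.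
    by field.
  have B0 : 0 < 2 * A - 5 by lra.
  have h : 64 * K + 1 <= (L / 2) `^ (2 * A - 5).
    rewrite -[leLHS](_ : z `^ (2 * A - 5) = _); last first.
      by rewrite -powRrM mulVf ?gt_eqF// powRr1//; lra.
    by apply: ge0_ler_powR; rewrite ?nnegrE ?(ltW B0) ?(ltW y0).
  rewrite ler_pdivrMr; last by apply: lt_le_trans h; lra.
  lra.
have : K * (L ^+ 5 * ((L / 2) `^ (- A)) ^+ 2) * q <= 2^-1 * q by apply: ler_wpM2r => //; exact: ltW.
move: p1; rewrite !mulrDr !mulrA; lra.
Qed.

Lemma grid_size_exists (R : realType) (A K : R) (J0 : nat) : 5 / 2 < A -> 0 <= K ->
  exists J : nat, [/\ (J0 <= J)%N, (0 < J)%N &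
    K * (ln (80 * J)%:R ^+ 5 * (Num.sqrt (80 * J)%:R + ((ln (80 * J)%:R / 2) `^ (- A)) ^+ 2 * (80 * J)%:R))
    <= (80 * J)%:R].
Proof.
move=> hA K0; set z : R := (64 * K + 1) `^ (2 * A - 5)^-1.
have z0 : 0 <= z by exact: powR_ge0.
have J00 := ler0n R J0.
(* The summands are the thresholds of [log_powers_le], and one that ensures [J >= J0]. *)
have [|J [J1 hJ _]] := @exists_nat_ln R (1 + J0%:R + 720 * (128 * K) + 2 * z); first by lra.
have J0J : (0 < J)%N by rewrite (leq_trans _ J1).
have Jr : (0 : R) < J%:R by rewrite ltr0n.
have hL : ln J%:R <= ln (80 * J)%:R :> R.
  by rewrite ler_ln ?posrE ?ltr0n ?muln_gt0// ler_nat leq_pmull.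
exists J; split => //.
  rewrite -(ler_nat R); have := ln_le_sub1 Jr; lra.
have qp : (0 : R) < (80 * J)%:R by rewrite ltr0n muln_gt0.
apply: log_powers_le => //; rewrite -?/z; apply: le_trans hL; lra.
Qed.

(** A given prefix has probability [2 ^ (- m)], so a mean over all signs controls the mean after any
    fixed prefix. *)
Lemma sign_mean_prefix (R : realType) (m n : nat) (l0 : seq R) (f : seq R -> R) :
  (forall es, signs es -> size es = (m + n)%N -> 0 <= f es) -> signs l0 -> size l0 = m ->
  sign_mean n (fun l => f (l0 ++ l)) <= 2 ^+ m * sign_mean (m + n) f.
Proof.
elim: m l0 f => [|m IH] [|e l0] f hf //=; first by rewrite expr0 mul1r.
case/andP => he hl0 [sl0].
have pos e' : (e' == 1) || (e' == -1) -> 0 <= sign_mean (m + n) (fun es => f (e' :: es)).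
  by move=> he'; apply: sign_mean_ge0 => es h1 h2; apply: hf; rewrite /= ?he' ?h1 ?h2.
have := IH l0 (fun es => f (e :: es)) _ hl0 sl0 => /(_ _)/le_trans; apply.
  by move=> es h1 h2; apply: hf; rewrite /= ?he ?h1 ?h2.
rewrite exprSr -mulrA ler_wpM2l ?exprn_ge0// mulrCA divff// mulr1.
have p1 := pos 1; have p2 := pos (-1); rewrite !eqxx ?orbT in p1 p2.
by case/orP: he => /eqP ->; rewrite ?lerDl ?lerDr ?p1 ?p2.
Qed.

Lemma walk_weight_gt0 (R : realType) (ths es : seq R) : small ths -> signs es -> 0 < walk_weight ths es.
Proof.
elim: ths es => [|th ths IH] [|e es] //= /andP[ht hs] /andP[he hes].
rewrite mulr_gt0 ?IH//; move: ht; rewrite ler_norml => /andP[a b].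
by case/orP: he => /eqP ->; lra.
Qed.

Lemma walk_young (R : realType) (w1 w2 h b : R) : 0 < w1 -> 0 <= w2 -> 0 < b ->
  w2 * h <= b * (w1 * w2) + (4 * b)^-1 * (w1^-1 * (w2 * h ^+ 2)).
Proof.
move=> w10 w20 b0; rewrite -subr_ge0.
have -> : b * (w1 * w2) + (4 * b)^-1 * (w1^-1 * (w2 * h ^+ 2)) - w2 * h =
   w2 * ((b * w1 - h / 2) ^+ 2 * (b * w1)^-1).
  by field; rewrite !gt_eqF.
by rewrite mulr_ge0// mulr_ge0 ?sqr_ge0// invr_ge0 mulr_ge0 ?ltW.
Qed.

(** Rankin's bound with exponent [1 / q], [q = 80 J], is a negative power of [N + 1] times the
    product of the [1 + p ^ (- 1 - 1 / q)], which is bounded in [N]; any target is thus reached once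
    [N] is large in terms of [J]. *)
Lemma mean_remainder (R : realType) (J : nat) (k : R) : (0 < J)%N ->
  exists N0 : nat, forall N : nat, (N0 <= N)%N ->
  sign_mean (size (primes_in 0 N.+1)) (fun es => grid_mean J (fun j =>
    cnorm (euler_prod (grid_s J j) (primes_in 0 N.+1) es - smooth_sum (grid_s J j) (primes_in 0 N.+1) es N) ^+ 2))
  <= expR (- k) :> R.
Proof.
move=> J0; have /andP[g0 g1] := grid_sigma_bounds R J0.
have q0 : (0 : R) < (80 * J)%:R by rewrite ltr0n muln_gt0.
(* With this [q'] the power [p ^ (- 1 - 1 / q)] is a [prime_weight] at [1 / q']. *)
set q' := (2 * (80 * J))%N.
have q4 : (4 <= q')%N by apply: (leq_trans (isT : (4 <= 80)%N)); rewrite /q' mulnA (leq_trans _ (leq_pmulr _ J0)).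
pose B : R := q'%:R + (ln q'%:R + 200).
have B0 : 0 <= B.
  by apply: addr_ge0; [exact: ler0n|apply: addr_ge0; [exact: ln_nat_ge0|exact: ler0n]].
have [|N0 [N01 hN0 _]] := @exists_nat_ln R ((80 * J)%:R * (B + `|k| + 1)).
  by apply: mulr_gt0 => //; apply: ltr_wpDl => //; apply: addr_ge0.
exists N0 => N N0N.
rewrite sign_mean_grid; apply: grid_mean_le => // j jJ.
have := @rankin R (grid_s J j) (grid_sigma J) (primes_in 0 N.+1) N (ltW g0) (primes_in_all _ _) => /le_trans; apply.
have -> : grid_sigma J - 2 * Re (grid_s J j) = - (1 + grid_sigma J) :> R.
  by rewrite /grid_s /=; field.
have lN : (80 * J)%:R * (B + `|k| + 1) <= ln N.+1%:R :> R.
  apply: (le_trans hN0); rewrite ler_ln ?posrE ?ltr0n// ?(leq_trans _ N01)//.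
  by rewrite ler_nat (leq_trans N0N).
have hP : \prod_(p <- primes_in 0 N.+1) (1 + expR (- (1 + grid_sigma J) * ln p%:R)) <= expR B :> R.
  apply: (@le_trans _ _ (\prod_(p <- primes_in 0 N.+1) expR (prime_weight q'%:R^-1 p))).
    rewrite big_seq [leRHS]big_seq; apply: ler_prod => p; rewrite mem_primes_in => /andP[pp _].
    have -> : expR (- (1 + grid_sigma J) * ln p%:R) = prime_weight q'%:R^-1 p :> R.
      rewrite /prime_weight -{2}(expR_ln_nat R (prime_gt0 pp)) -expRN -expRD; congr expR.
      rewrite /grid_sigma (_ : q'%:R = 2 * (80 * J)%:R :> R); last by rewrite -natrM.
      by move: q0; move: (80 * J)%:R (ln p%:R) => r l r0; field; rewrite gt_eqF.
    by rewrite expR_ge1Dx andbT addr_ge0// prime_weight_ge0.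
  rewrite -expR_sum ler_expR big_primes_in.
  have le1 n : \sum_(0 <= p < n | prime p) prime_weight q'%:R^-1 p <= n%:R :> R.
    apply: (@le_trans _ _ (\sum_(0 <= p < n) 1)); last by rewrite sumr_const_nat subn0.
    rewrite big_mkcond; apply: ler_sum => p _; case: ifP => // pp.
    apply: (le_trans (prime_weight_le _ _)); first by rewrite invr_ge0.
    by rewrite invf_le1 ?ltr0n ?prime_gt0// ler1n prime_gt0.
  case: (leqP q' N.+1) => hq.
    rewrite (@big_cat_nat _ _ _ q')//=; apply: lerD; last exact: sum_weight_total.
    exact: le1.
  by apply: (le_trans (le1 _)); apply: ler_wpDr; [apply: addr_ge0 => //; exact: ln_nat_ge0|rewrite ler_nat ltnW].
apply: (@le_trans _ _ (expR (- (grid_sigma J * ln N.+1%:R)) * expR B)).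
  by rewrite ler_wpM2l ?expR_ge0.
rewrite -expRD ler_expR.
have : grid_sigma J * ((80 * J)%:R * (B + `|k| + 1)) <= grid_sigma J * ln N.+1%:R by rewrite ler_wpM2l// ltW.
rewrite /grid_sigma mulKf ?gt_eqF//; have := ler_norm k; lra.
Qed.

Lemma grid_meanD (R : realType) (J : nat) (F G : nat -> R) :
  grid_mean J (fun j => F j + G j) = grid_mean J F + grid_mean J G.
Proof. by rewrite /grid_mean big_split mulrDr. Qed.

Lemma grid_meanZ (R : realType) (J : nat) (a : R) (F : nat -> R) :
  grid_mean J (fun j => a * F j) = a * grid_mean J F.
Proof. by rewrite /grid_mean -mulr_sumr mulrCA. Qed.

Lemma ler_grid_mean (R : realType) (J : nat) (F G : nat -> R) :
  (forall j, (j < J)%N -> F j <= G j) -> grid_mean J F <= grid_mean J G.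
Proof.
move=> h; rewrite /grid_mean ler_wpM2l ?invr_ge0//.
by rewrite big_nat [leRHS]big_nat; apply: ler_sum => j /= /h.
Qed.

Definition sgn_fun {R : realType} (ps : seq nat) (es : seq R) (p : nat) : R :=
  nth 0 es (index p ps).

Lemma map_sgn_fun (R : realType) (ps : seq nat) (es : seq R) : uniq ps -> size es = size ps ->
  map (sgn_fun ps es) ps = es.
Proof.
move=> u sz; apply: (@eq_from_nth _ 0); rewrite size_map ?sz// => i ip.
by rewrite (nth_map 0%N)// /sgn_fun index_uniq.
Qed.

Lemma normr_sgn_fun (R : realType) (ps : seq nat) (es : seq R) p : signs es ->
  `|sgn_fun ps es p| <= 1.
Proof.
move=> he; rewrite /sgn_fun; case: (ltnP (index p ps) (size es)) => h.
  by have /orP[/eqP ->|/eqP ->] := allP he _ (mem_nth 0 h); rewrite ?normrN normr1.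
by rewrite nth_default// normr0.
Qed.

(** The squared Euler product factors into the primes below [m], bounded below for all signs, the
    range up to [80 * J], whose deterministic factor is at least 1, and the range above. It is at
    most twice the sum of the squares of the truncated series, controlled by the hypothesis, and of
    the remainder. *)
Lemma bounded_walk_mean_le (R : realType) : exists2 c : R, 0 < c &
  forall (C A : R) (x0 m J N : nat) (l0 l1 l2 : seq R),
  0 <= C -> 0 < A -> (256 <= x0 <= N)%N -> (16 <= m <= 80 * J)%N -> (0 < J)%N -> (80 * J <= N.+1)%N ->
  (80 * J)%:R + 1 <= ln N.+1%:R :> R ->
  signs l0 -> signs l1 -> signs l2 ->
  size l0 = size (primes_in 0 m) -> size l1 = size (primes_in m (80 * J)) ->
  size l2 = size (primes_in (80 * J) N.+1) ->
  bounded_upto C A x0 N (sgn_fun (primes_in 0 N.+1) (l0 ++ (l1 ++ l2))) ->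
  (4^-1 ^+ size (primes_in 0 m)) ^+ 2 * (c * ((80 * J)%:R / ln (80 * J)%:R)) *
    grid_mean J (fun j => walk_weight (grid_thetas J m (80 * J) j) l1 *
                          walk_weight (grid_thetas J (80 * J) N.+1 j) l2)
  <= 2 * (2 * C ^+ 2 + 2 * (65 * 80) * (ln (80 * J)%:R *
       (x0%:R + 4 * C ^+ 2 * (1 + Num.sqrt (80 * J)%:R) +
         (C * (ln (80 * J)%:R / 2) `^ (- A)) ^+ 2 * (1 + (80 * J)%:R)))) +
     2 * grid_mean J (fun j => cnorm (euler_prod (grid_s J j) (primes_in 0 N.+1) (l0 ++ (l1 ++ l2)) -
           smooth_sum (grid_s J j) (primes_in 0 N.+1) (l0 ++ (l1 ++ l2)) N) ^+ 2).
Proof.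
have [c c0 hc] := prod_weight_ge R; exists c => // C A x0 m J N l0 l1 l2.
move=> C0 A0 /andP[x256 xN] /andP[m16 mq] J0 qN lN s0 s1 s2 z0 z1 z2 hb.
have /andP[g0 g1] := grid_sigma_bounds R J0.
set l := l0 ++ (l1 ++ l2) in hb *; set ps := primes_in 0 N.+1 in hb *.
have psE : ps = primes_in 0 m ++ (primes_in m (80 * J) ++ primes_in (80 * J) N.+1).
  by rewrite -primes_in_cat// -primes_in_cat// (leq_trans mq).
have sl : size l = size ps by rewrite psE !size_cat z0 z1 z2.
have sg : signs l by rewrite /signs !all_cat; apply/and3P.
have hS := grid_mean_sum_le C0 A0 x256 xN J0 hb.
have hO := weighted_square_sum_le C0 A0 x256 J0 (fun p _ _ => normr_sgn_fun ps p sg) hb.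
have L0 : 0 <= ln (80 * J)%:R :> R by exact: ln_nat_ge0.
have {}hS := le_trans hS (lerD (lexx (2 * C ^+ 2)) (ler_wpM2l (_ : 0 <= 2 * (65 * 80)) (ler_wpM2l L0 hO))).
rewrite -[leLHS]grid_meanZ.
apply: (@le_trans _ _ (grid_mean J (fun j => 2 * cnorm (\sum_(1 <= n < N.+1) real_complex R (sqf_mult (sgn_fun ps l) n) * npow n (grid_s J j)) ^+ 2 +
   2 * cnorm (euler_prod (grid_s J j) ps l - smooth_sum (grid_s J j) ps l N) ^+ 2))); last first.
  rewrite grid_meanD !grid_meanZ lerD2r ler_wpM2l//; apply: hS.
  by rewrite mulr_ge0// mulr_ge0.
apply: ler_grid_mean => j jJ.
apply: (@le_trans _ _ (cnorm (euler_prod (grid_s J j) ps l) ^+ 2)).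
  rewrite psE /l !euler_prod_cat// !cnormM !exprMn.
  rewrite [cnorm (euler_prod _ (primes_in m _) _) ^+ 2]euler_prod_sqr ?primes_in_all ?(ltW g0)//.
  rewrite [cnorm (euler_prod _ (primes_in (80 * J) _) _) ^+ 2]euler_prod_sqr ?primes_in_all ?(ltW g0)//.
  have w1 : 0 <= walk_weight (grid_thetas J m (80 * J) j) l1.
    by apply: walk_weight_ge0 => //; exact: small_theta (ltW g0) m16.
  have w2 : 0 <= walk_weight (grid_thetas J (80 * J) N.+1 j) l2.
    by apply: walk_weight_ge0 => //; apply: small_theta (ltW g0) _; exact: leq_trans mq.
  have h0 : (4^-1 ^+ size (primes_in 0 m)) ^+ 2 <= cnorm (euler_prod (grid_s J j) (primes_in 0 m) l0) ^+ 2.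
    rewrite ler_pXn2r ?nnegrE ?cnorm_ge0 ?exprn_ge0 ?invr_ge0//.
    exact: euler_prod_lower (primes_in_all _ _) (ltW g0) s0 z0.
  have h1 : 1 <= \prod_(p <- primes_in m (80 * J)) (1 + prime_weight (grid_sigma J) p) :> R.
    apply: (big_ind (fun x : R => 1 <= x)) => [//|x y hx hy|p _]; first by rewrite mulr_ege1.
    by rewrite lerDl prime_weight_ge0.
  have h2 := hc J N J0 lN.
  have q0 : 0 <= c * ((80 * J)%:R / ln (80 * J)%:R) by rewrite mulr_ge0 ?(ltW c0)// divr_ge0.
  rewrite -[leLHS]mulrA; apply: ler_pM => //.
    by rewrite mulr_ge0// mulr_ge0.
  rewrite mulrCA; apply: ler_pM => //; first by rewrite mulr_ge0.
    by rewrite ler_peMl.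
  by rewrite ler_wpM2r.
rewrite -smooth_sum_full map_sgn_fun ?primes_in_uniq//.
set a := euler_prod _ _ _; set b := smooth_sum _ _ _ _.
have := cnorm_parallelogram (a - b) b; rewrite subrK.
have := sqr_ge0 (cnorm (a - b - b)); lra.
Qed.

(** * The bound fails with positive conditional probability *)

Lemma sign_mean_drop (R : realType) (m n : nat) (g : seq R -> R) :
  sign_mean (m + n) (fun l => g (drop m l)) = sign_mean n g.
Proof.
rewrite sign_mean_add (@eq_sign_mean _ _ _ (fun=> sign_mean n g)) ?sign_mean_cst// => es1 _ sz.
by apply: eq_sign_mean => es2 _ _; rewrite drop_size_cat.
Qed.

Lemma sign_mean_split (R : realType) (m n : nat) (f g : seq R -> R) :
  sign_mean (m + n) (fun l => f (take m l) * g (drop m l)) = sign_mean m f * sign_mean n g.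
Proof.
rewrite sign_mean_add -sign_meanZr; apply: eq_sign_mean => es1 _ sz.
by rewrite -sign_meanZ; apply: eq_sign_mean => es2 _ _; rewrite drop_size_cat// take_size_cat.
Qed.

(** The constant must not depend on [q], which is chosen after it; as [L], [s] and [q] are at least
    1, every term fits below [L * (s + P ^+ 2 * q)]. The extra 2 makes room for the remainder of the
    Euler product. *)
Lemma error_budget (R : realType) (x C s P L q : R) : 0 <= x -> 1 <= s -> 1 <= L -> 1 <= q ->
  2 * (2 * C ^+ 2 + 2 * (65 * 80) * (L * (x + 4 * C ^+ 2 * (1 + s) + (C * P) ^+ 2 * (1 + q)))) + 2
  <= (4 * C ^+ 2 + 2 + 4 * (65 * 80) * (x + 8 * C ^+ 2) + 8 * (65 * 80) * C ^+ 2) * (L * (s + P ^+ 2 * q)).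
Proof.
move=> x0 s1 L1 q1; set c := C ^+ 2; have c0 : 0 <= c by exact: sqr_ge0.
rewrite exprMn -/c; set p := P ^+ 2; have p0 : 0 <= p by exact: sqr_ge0.
clearbody c p.
have L0 : 0 <= L by lra.
have q0 : 0 <= q by lra.
have pq0 : 0 <= p * q by exact: mulr_ge0.
have Ls : 1 <= L * s by rewrite mulr_ege1.
have h1 : (4 * c + 2) * 1 <= (4 * c + 2) * (L * s) by rewrite ler_wpM2l//; lra.
have h2 : x <= x * s by rewrite ler_peMr.
have h3 : c * 1 <= c * s by rewrite ler_wpM2l.
have h4 : c * p <= c * p * q by rewrite ler_peMr// mulr_ge0.
have h5 : L * (x + 4 * c * (1 + s) + c * p * (1 + q)) <= L * ((x + 8 * c) * s + 2 * c * (p * q)).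
  by apply: ler_wpM2l => //; nra.
have t1 : 0 <= (4 * c + 2) * (L * (p * q)) by rewrite mulr_ge0 ?mulr_ge0//; lra.
have t2 : 0 <= (x + 8 * c) * (L * (p * q)) by rewrite mulr_ge0 ?mulr_ge0//; lra.
have t3 : 0 <= c * (L * s) by rewrite mulr_ge0// mulr_ge0//; lra.
move: h1 h5 t1 t2 t3; lra.
Qed.

(** A second-moment argument in the style of Paley and Zygmund, made linear. On the event, [Z] is at
    most [1/8 + D / 8 + Bq / (4 b)]; off it, [Z <= lam / 2 * Z ^+ 2 + C3]. Taking means, [1 <= 1/8 +
    1/8 + 1/4 + 1/4 + C3 * (1 - p)], where [p] is the probability of the event. The resulting
    constant depends on the second moment alone, so it is uniform in [m], [x0] and [l0], as the
    iteration requires. *)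
Lemma exit_probability (R : realType) : exists2 c : R, 0 < c &
  forall (A C : R) (x0 m : nat), 5 / 2 < A -> 0 <= C -> (256 <= x0)%N -> (16 <= m)%N ->
  exists N : nat, [/\ (m <= N.+1)%N, (x0 <= N)%N & forall l0 : seq R,
    signs l0 -> size l0 = size (primes_in 0 m) ->
    sign_mean (size (primes_in m N.+1)) (fun l =>
      (`[< bounded_upto C A x0 N (sgn_fun (primes_in 0 N.+1) (l0 ++ l)) >])%:R) <= 1 - c].
Proof.
have [c1 c10 hwalk] := bounded_walk_mean_le R.
have [C3 C30 h3] := mean_grid_walk_sqr R.
have [C4 C40 h4] := mean_inv_weight R.
have [C5 C50 h5] := mean_grid_height_sqr R.
exists (4 * C3)^-1; first by rewrite invr_gt0 mulr_gt0.
move=> A C x0 m hA C0 x256 m16.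
have A0 : 0 < A by lra.
set n0 := size (primes_in 0 m).
set kap : R := (4^-1 ^+ n0) ^+ 2.
have kap0 : 0 < kap by rewrite !exprn_gt0// invr_gt0.
set K1 : R := 4 * C ^+ 2 + 2 + 4 * (65 * 80) * (x0%:R + 8 * C ^+ 2) + 8 * (65 * 80) * C ^+ 2.
have K10 : 0 <= K1.
  by rewrite /K1; have := sqr_ge0 C; have := ler0n R x0; lra.
(* With [b = C4 * C5 * L ^+ 3], this constant makes [8 * b] times the error budget at most
   [kap * c1 * q / L]. *)
have [|J [mJ J0 hJ]] := @grid_size_exists R A (8 * (C4 * C5) * K1 / (kap * c1)) m hA.
  by rewrite divr_ge0 ?mulr_ge0// ltW// mulr_gt0.
have /andP[g0 g1] := grid_sigma_bounds R J0.
(* The target [expR (- n0)] beats the factor [2 ^+ n0] lost in passing to a fixed prefix [l0]. *)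
have [N0 hN0] := @mean_remainder R J n0%:R J0.
have qn0 : (0 < 80 * J)%N by rewrite muln_gt0.
have [|Q [Q1 hQ _]] := @exists_nat_ln R ((80 * J)%:R + 1); first by rewrite ltr_wpDl.
pose N := (N0 + x0 + m + 80 * J + Q)%N.
have mN : (m <= N)%N by rewrite /N -!addnA; do 2 apply: leq_trans (leq_addl _ _); exact: leq_addr.
have xN : (x0 <= N)%N by rewrite /N -!addnA; apply: leq_trans (leq_addl _ _); exact: leq_addr.
have N0N : (N0 <= N)%N by rewrite /N -!addnA; exact: leq_addr.
have qN : (80 * J <= N)%N by rewrite /N -addnA; apply: leq_trans (leq_addl _ _); exact: leq_addr.
have QN : (Q <= N)%N by exact: leq_addl.
have m80 : (m <= 80 * J)%N by apply: leq_trans mJ _; rewrite leq_pmull.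
have lnN n : (Q <= n)%N -> (80 * J)%:R + 1 <= ln n%:R :> R.
  move=> Qn; apply: (le_trans hQ); rewrite ler_ln ?posrE ?ltr0n ?ler_nat//; first exact: ltnW.
  by apply: leq_trans Qn; exact: ltnW.
have {hN0} hD := hN0 N N0N.
exists N; split => //; first exact: leqW.
move=> l0 s0 z0.
set n1 := size (primes_in m (80 * J)); set n2 := size (primes_in (80 * J) N.+1).
have nE : size (primes_in m N.+1) = (n1 + n2)%N by rewrite -size_cat -primes_in_cat// leqW.
have nE0 : size (primes_in 0 N.+1) = (n0 + (n1 + n2))%N.
  by rewrite -nE -size_cat -primes_in_cat// leqW.
rewrite nE; set g := (fun l => _ : R).
have L1 := ln_grid_ge1 R J0.
have q1 : 1 <= (80 * J)%:R :> R by rewrite ler1n.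
set q : R := (80 * J)%:R in hJ lnN q1 L1 *; set L := ln q in hJ L1 *.
have L0 : 0 < L by lra.
have sq1 : 1 <= Num.sqrt q by rewrite -[leLHS]sqrtr1 ler_sqrt.
pose W1 j l := walk_weight (grid_thetas J m (80 * J) j) (take n1 l) : R.
pose W2 j l := walk_weight (grid_thetas J (80 * J) N.+1 j) (drop n1 l) : R.
pose H j l := height (grid_thetas J (80 * J) N.+1 j) (drop n1 l) 1 : R.
pose Z l := grid_mean J (fun j => grid_walk J N j (drop n1 l)) : R.
pose Bq l := grid_mean J (fun j => (W1 j l)^-1 * (W2 j l * H j l ^+ 2)) : R.
pose D l := grid_mean J (fun j => cnorm (euler_prod (grid_s J j) (primes_in 0 N.+1) (l0 ++ l) -
           smooth_sum (grid_s J j) (primes_in 0 N.+1) (l0 ++ l) N) ^+ 2) : R.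
pose b := C4 * C5 * L ^+ 3.
have b0 : 0 < b by rewrite /b !mulr_gt0// exprn_gt0.
have EZ : 1 <= sign_mean (n1 + n2) Z.
  by rewrite /Z (sign_mean_drop n1 n2 (fun l => grid_mean J (fun j => grid_walk J N j l))); exact: mean_grid_walk_ge.
have EZ2 : sign_mean (n1 + n2) (fun l => Z l ^+ 2) <= C3.
  rewrite /Z (sign_mean_drop n1 n2 (fun l => grid_mean J (fun j => grid_walk J N j l) ^+ 2)).
  by apply: h3 => //; exact: lnN.
have EB : sign_mean (n1 + n2) Bq <= b.
  rewrite /Bq sign_mean_grid; apply: grid_mean_le => // j jJ.
  rewrite /W1 /W2 /H (sign_mean_split n1 n2 (fun l => (walk_weight (grid_thetas J m (80 * J) j) l)^-1)
    (fun l => walk_weight (grid_thetas J (80 * J) N.+1 j) l * height (grid_thetas J (80 * J) N.+1 j) l 1 ^+ 2)).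
  have -> : b = C4 * L ^+ 2 * (C5 * L) by rewrite /b; ring.
  apply: ler_pM.
  - apply: sign_mean_ge0 => es hs _; rewrite invr_ge0; apply: walk_weight_ge0 => //.
    exact: small_theta (ltW g0) m16.
  - apply: sign_mean_ge0 => es hs _; apply: mulr_ge0; last exact: sqr_ge0.
    by apply: walk_weight_ge0 => //; apply: small_theta (ltW g0) _; exact: leq_trans m80.
  - by apply: h4 => //; rewrite m16.
  - exact: h5.
have ED : sign_mean (n1 + n2) D <= 1.
  pose F l := grid_mean J (fun j => cnorm (euler_prod (grid_s J j) (primes_in 0 N.+1) l -
           smooth_sum (grid_s J j) (primes_in 0 N.+1) l N) ^+ 2) : R.
  apply: (@le_trans _ _ (2 ^+ n0 * sign_mean (n0 + (n1 + n2)) F)).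
    have F0 es : signs es -> size es = (n0 + (n1 + n2))%N -> 0 <= F es.
      by move=> _ _; apply: grid_mean_ge => // j _; exact: sqr_ge0.
    exact: (sign_mean_prefix F0 s0 z0).
  rewrite -nE0; apply: (@le_trans _ _ (2 ^+ n0 * expR (- n0%:R))); first by rewrite ler_wpM2l ?exprn_ge0.
  rewrite expRN ler_pdivrMr ?expR_gt0// mul1r -[n0%:R]mulr1 mulrC expRM_natr.
  by apply: lerXn2r; rewrite ?nnegrE ?expR_ge0//; exact: (@expR_ge1Dx R 1).
(* Then [lam / 2 * C3 = 1/4] and [(2 * lam)^-1 = C3]. *)
pose lam := (2 * C3)^-1.
have lam0 : 0 < lam by rewrite invr_gt0 mulr_gt0.
have pw l : signs l -> size l = (n1 + n2)%N ->
   Z l <= 8^-1 + (8^-1 * D l + ((4 * b)^-1 * Bq l + (lam / 2 * Z l ^+ 2 + (C3 + - C3 * g l)))).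
  move=> sl zl.
  have /andP[st sd] : signs (take n1 l) && signs (drop n1 l) by rewrite /signs -all_cat cat_take_drop.
  have W1p j : 0 < W1 j l by apply: walk_weight_gt0 => //; exact: small_theta (ltW g0) m16.
  have W2p j : 0 <= W2 j l.
    by apply: walk_weight_ge0 => //; apply: small_theta (ltW g0) _; exact: leq_trans m80.
  have D0 : 0 <= D l by apply: grid_mean_ge => // j _; exact: sqr_ge0.
  have B0' : 0 <= Bq l.
    apply: grid_mean_ge => // j _; apply: mulr_ge0; first by rewrite invr_ge0 ltW.
    by apply: mulr_ge0 => //; exact: sqr_ge0.
  have B0 : 0 <= (4 * b)^-1 * Bq l by apply: mulr_ge0 => //; rewrite invr_ge0 mulr_ge0// ltW.
  have Z0 : 0 <= lam / 2 * Z l ^+ 2 by apply: mulr_ge0; [rewrite divr_ge0// ltW|exact: sqr_ge0].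
  rewrite /g; case: asboolP => hb; last first.
    have C3E : C3 = (2 * lam)^-1 by rewrite /lam; field; rewrite gt_eqF.
    have : 0 <= (lam * Z l - 1) ^+ 2 * (2 * lam)^-1.
      by apply: mulr_ge0; [exact: sqr_ge0|rewrite invr_ge0 mulr_ge0// ltW].
    rewrite (_ : _ * _ = lam / 2 * Z l ^+ 2 - Z l + C3); last by rewrite C3E; field; rewrite gt_eqF.
    rewrite mulr0n mulr0 addr0; move: D0 B0; clear; lra.
  rewrite mulr1n mulr1 addrN addr0.
  pose X := grid_mean J (fun j => W1 j l * W2 j l).
  have X0 : 0 <= X by apply: grid_mean_ge => // j _; rewrite mulr_ge0// ltW.
  have zx : Z l <= b * X + (4 * b)^-1 * Bq l.
    rewrite -!grid_meanZ -grid_meanD; apply: ler_grid_mean => j jJ.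
    exact: (@walk_young R (W1 j l) (W2 j l) (H j l) b).
  have m16q : (16 <= m <= 80 * J)%N by rewrite m16.
  have xNN : (256 <= x0 <= N)%N by rewrite x256.
  have z1 : size (take n1 l) = n1 by rewrite size_takel// zl leq_addr.
  have z2 : size (drop n1 l) = n2 by rewrite size_drop zl addKn.
  have hb' : bounded_upto C A x0 N (sgn_fun (primes_in 0 N.+1) (l0 ++ (take n1 l ++ drop n1 l))).
    by rewrite cat_take_drop.
  have QN1 : (Q <= N.+1)%N by exact: leqW.
  have := @hwalk C A x0 m J N l0 _ _ C0 A0 xNN m16q J0 (leqW qN) (lnN _ QN1) s0 st sd z0 z1 z2 hb'.
  have := @error_budget R x0%:R C (Num.sqrt q) ((L / 2) `^ (- A)) L q (ler0n R x0) sq1 L1 q1.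
  rewrite cat_take_drop -/q -/L -/(D l) -/K1 -/n0 -/kap -/X.
  set E := K1 * _; set S := 2 * (2 * _ + _) => hE hX.
  have S0 : 0 <= S.
    rewrite /S; have P0 := sqr_ge0 (C * (L / 2) `^ (- A)); have Cs := sqr_ge0 C.
    have q01 : 0 <= 1 + q by move: q1; clear; lra.
    have s01 : 0 <= 1 + Num.sqrt q by move: sq1; clear; lra.
    have t1 := mulr_ge0 P0 q01.
    have t2 : 0 <= 4 * C ^+ 2 * (1 + Num.sqrt q) := mulr_ge0 (mulr_ge0 (ler0n R 4) Cs) s01.
    have t3 : 0 <= L * (x0%:R + 4 * C ^+ 2 * (1 + Num.sqrt q) + (C * (L / 2) `^ (- A)) ^+ 2 * (1 + q)).
      by apply: mulr_ge0; [exact: ltW|rewrite !addr_ge0].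
    by rewrite mulr_ge0// addr_ge0// mulr_ge0.
  have q0 : 0 < q by apply: lt_le_trans q1.
  have hV : 8 * b * E <= kap * (c1 * (q / L)).
    rewrite (_ : kap * (c1 * (q / L)) = kap * c1 / L * q); last by field; rewrite gt_eqF.
    have V0 : 0 <= kap * c1 / L by rewrite divr_ge0 ?(ltW L0)// mulr_ge0// ltW.
    apply: le_trans (ler_wpM2l V0 hJ).
    rewrite le_eqVlt; apply/orP; left; apply/eqP; rewrite /b /E.
    by field; rewrite !gt_eqF.
  have E2 : 2 <= E by move: hE S0; clear; lra.
  have E0 : 0 < E by move: E2; clear; lra.
  (* [E >= 2] turns the additive [2 * D l] into a multiple of [E], so that [E] can be divided
     out. *)
  have bX : 8 * b * X <= 1 + D l.
    rewrite -(ler_pM2l E0) (_ : E * (8 * b * X) = 8 * b * E * X); last by ring.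
    apply: (le_trans (ler_wpM2r X0 hV)); apply: (le_trans hX).
    have : 2 * D l <= E * D l by rewrite ler_wpM2r.
    by move: hE; clear; lra.
  have {}bX : b * X <= 8^-1 + 8^-1 * D l by move: bX; clear; lra.
  apply: (le_trans zx); rewrite addrA; apply: (le_trans (lerD bX (lexx _))); apply: lerD => //; by rewrite lerDl.
clearbody Z D Bq g.
have := sign_mean_le pw.
rewrite !sign_meanD !sign_meanZ !sign_mean_cst => h.
have hB : (4 * b)^-1 * sign_mean (n1 + n2) Bq <= 4^-1.
  rewrite (_ : 4^-1 = (4 * b)^-1 * b); last by field; rewrite gt_eqF.
  by rewrite ler_wpM2l// invr_ge0 mulr_ge0// ltW.
have hZ : lam / 2 * sign_mean (n1 + n2) (fun l => Z l ^+ 2) <= 4^-1.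
  rewrite (_ : 4^-1 = lam / 2 * C3); last by rewrite /lam; field; rewrite gt_eqF.
  by rewrite ler_wpM2l// divr_ge0// ltW.
have hg : C3 * sign_mean (n1 + n2) g <= C3 * (1 - (4 * C3)^-1).
  rewrite (_ : C3 * (1 - (4 * C3)^-1) = C3 - 4^-1); last by field; rewrite gt_eqF.
  have hh : 1 <= 8^-1 + (8^-1 * 1 + (4^-1 + (4^-1 + (C3 + - C3 * sign_mean (n1 + n2) g)))).
    apply: (le_trans EZ); apply: (le_trans h); apply: lerD => //; apply: lerD; first exact: ler_wpM2l.
    by apply: lerD => //; apply: lerD.
  by move: hh; clear; lra.
by rewrite -(ler_pM2l C30).
Qed.

Lemma eq_bounded_upto (R : realType) (C A : R) (x0 N : nat) (e e' : nat -> R) :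
  (forall p, prime p -> (p <= N)%N -> e p = e' p) ->
  bounded_upto C A x0 N e -> bounded_upto C A x0 N e'.
Proof.
move=> ee hb n hn; have -> : partial_sum e' n = partial_sum e n; last exact: hb.
case/andP: hn => _ nN; rewrite /partial_sum big_nat [RHS]big_nat.
apply: eq_bigr => k /andP[k0 kn]; rewrite /sqf_mult; case: ifP => // _.
rewrite big_seq [RHS]big_seq; apply: eq_bigr => p; rewrite mem_primes => /and3P[pp _ pk].
by rewrite ee// (leq_trans (dvdn_leq k0 pk))// (leq_trans _ nN).
Qed.

Lemma sgn_fun_cat (R : realType) (ps1 ps2 : seq nat) (es1 es2 : seq R) p :
  size es1 = size ps1 -> p \in ps1 -> sgn_fun (ps1 ++ ps2) (es1 ++ es2) p = sgn_fun ps1 es1 p.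
Proof. by move=> sz h; rewrite /sgn_fun index_cat h nth_cat sz index_mem h. Qed.

(** The event up to a larger [N'] implies the event up to [N], which depends only on the signs at
    primes up to [N]; whatever these are, the new primes multiply the probability by at most
    [1 - c]. *)
Lemma bounded_mean_small (R : realType) (A C d : R) (x0 : nat) :
  5 / 2 < A -> 0 <= C -> (256 <= x0)%N -> 0 < d ->
  exists N : nat, sign_mean (size (primes_in 0 N.+1)) (fun l =>
      (`[< bounded_upto C A x0 N (sgn_fun (primes_in 0 N.+1) l) >])%:R) <= d.
Proof.
move=> hA C0 x256 d0; have [c c0 hc] := exit_probability R.
(* A mean of nonnegative values is nonnegative, so one admissible prefix, here all ones, shows
   [c <= 1]. *)
have c1 : 0 <= 1 - c.
  have [N [_ _ h]] := hc A C x0 16%N hA C0 x256 (leqnn _).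
  have s16 : signs (nseq (size (primes_in 0 16)) (1 : R)) by apply/allP => x /nseqP[-> _]; rewrite eqxx.
  by apply: le_trans (h _ s16 (size_nseq _ _)); apply: sign_mean_ge0.
have step k : exists2 N : nat, (15 <= N)%N & sign_mean (size (primes_in 0 N.+1)) (fun l =>
      (`[< bounded_upto C A x0 N (sgn_fun (primes_in 0 N.+1) l) >])%:R) <= (1 - c) ^+ k.
  elim: k => [|k [N N15 IH]].
    (* 15 makes [N.+1 = 16], the least start that [exit_probability] accepts. *)
    exists 15%N => //; rewrite expr0 -[leRHS](sign_mean_cst (size (primes_in 0 16))).
    by apply: sign_mean_le => l _ _; case: asboolP.
  have [N' [NN' xN' h]] := hc A C x0 N.+1 hA C0 x256 N15.
  exists N'; first by apply: leq_trans N15 _.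
  rewrite exprS; apply: le_trans (ler_wpM2l c1 IH); rewrite -sign_meanZ.
  rewrite {1}(primes_in_cat (leq0n N.+1) NN') size_cat sign_mean_add.
  apply: sign_mean_le => l0 s0 z0; case: asboolP => hb; first by rewrite mulr1; exact: h.
  rewrite mulr0 -[leRHS](sign_mean_cst (size (primes_in N.+1 N'.+1))).
  apply: sign_mean_le => l _ _; case: asboolP => // hb'; case: hb.
  have {hb'} : bounded_upto C A x0 N (sgn_fun (primes_in 0 N'.+1) (l0 ++ l)).
    by move=> n /andP[xn nN]; apply: hb'; rewrite xn (leq_trans nN).
  apply: eq_bounded_upto => p pp pN.
  by rewrite (primes_in_cat (leq0n N.+1) NN') sgn_fun_cat// mem_primes_in pp.
set k := (Num.truncn (c * d)^-1).+1.
have [N _ hN] := step k; exists N; apply: (le_trans hN).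
have hk : (c * d)^-1 < k%:R.
  exact: truncnS_gt.
have ck0 : 0 < c * k%:R by rewrite mulr_gt0.
(* [(1 - c) ^+ k <= expR (- c k) <= 1 / (c k) <= d]. *)
apply: (@le_trans _ _ (expR (- (c * k%:R)))).
  rewrite -mulNr expRM_natr; apply: lerXn2r; rewrite ?nnegrE ?expR_ge0//.
  exact: (@expR_ge1Dx R (- c)).
rewrite expRN -[leRHS]invrK lef_pV2 ?posrE ?expR_gt0 ?invr_gt0//.
apply: le_trans (expR_ge1Dx _); move: hk; rewrite invfM ltr_pdivrMl// => hk.
by rewrite ler_wpDl// ltW.
Qed.

(** * Transfer to the probability space *)

Lemma probability_sign_pattern (d : measure_display) (T : measurableType d) (R : realType)
    (P : probability T R) (eps : nat -> {RV P >-> R}) (ps : seq nat) (es : seq R) :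
  (forall p, prime p -> rademacher (eps p)) -> independent_on [set p : nat | prime p] eps ->
  uniq ps -> all prime ps -> signs es -> size es = size ps ->
  measurable [set w | map (fun p => eps p w) ps = es] /\
  P [set w | map (fun p => eps p w) ps = es] = (2^-1 ^+ size ps)%:E.
Proof.
move=> rad ind ups pps ses zes.
have memJ p : [set` seq_fset tt ps] p <-> p \in ps by rewrite /mkset seq_fsetE.
have E : [set w | map (fun p => eps p w) ps = es] =
    \bigcap_(p in [set` seq_fset tt ps]) (eps p @^-1` [set sgn_fun ps es p]).
  apply/seteqP; split => w /= hw.
    by move=> p /memJ pin; rewrite /= -hw /sgn_fun (nth_map 0%N) ?index_mem// nth_index.
  rewrite -[RHS](map_sgn_fun ups zes); apply/eq_in_map => p pin.
  by apply: (hw p); apply/memJ.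
have hsub : [set` seq_fset tt ps] `<=` [set p : nat | prime p].
  by move=> p /memJ /(allP pps).
split.
  rewrite E; apply: fin_bigcap_measurable; first exact: finite_fset.
  by move=> p _; rewrite -[X in measurable X]setTI; exact: measurable_funP.
rewrite E; have -> := ind _ (fun p => [set sgn_fun ps es p]) hsub (fun p _ => measurable_set1 _).
rewrite (perm_big ps); last by have := seq_fset_perm tt ps; rewrite (undup_id ups).
rewrite big_seq (eq_bigr (fun=> (2^-1)%:E)); last first.
  move=> p pin; have [r1 r2] := rad p (allP pps p pin).
  have pi : (index p ps < size es)%N by rewrite zes index_mem.
  by have /orP[/eqP h|/eqP h] := allP ses _ (mem_nth 0 pi); rewrite /sgn_fun h.
rewrite -big_seq; elim: (ps) => [|p qs IH]; first by rewrite big_nil expr0.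
by rewrite big_cons IH exprS EFinM.
Qed.

(** The signs already read are carried as the prefix [qs], [l], and the event splits according to
    the next sign. Measurability comes from the finite union of sign patterns, and subadditivity
    gives the bound. *)
Lemma probability_signs_le (d : measure_display) (T : measurableType d) (R : realType)
    (P : probability T R) (eps : nat -> {RV P >-> R}) (qs ps : seq nat) (l : seq R)
    (phi : seq R -> bool) :
  (forall p, prime p -> rademacher (eps p)) -> independent_on [set p : nat | prime p] eps ->
  uniq (qs ++ ps) -> all prime (qs ++ ps) -> signs l -> size l = size qs ->
  let E := [set w | [/\ map (fun p => eps p w) qs = l, signs (map (fun p => eps p w) ps) &
                        phi (map (fun p => eps p w) ps)]] in
  measurable E /\ (P E <= (2^-1 ^+ size qs * sign_mean (size ps) (fun es => (phi es)%:R))%:E)%E.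
Proof.
move=> rad ind; elim: ps qs l phi => [|p ps IH] qs l phi /=.
  rewrite cats0 => uqs pqs sl zl.
  have [mC PC] := probability_sign_pattern rad ind uqs pqs sl zl.
  case: (phi [::]).
    by rewrite (_ : [set w | _] = [set w | map (fun p => eps p w) qs = l]) ?PC ?mulr1//;
      apply/seteqP; split => [w /= []|w /= ->].
  rewrite (_ : [set w | _] = set0) ?measure0 ?mulr0//.
  by apply/seteqP; split => [w /= []|].
move=> u pp sl zl.
have uE x : uniq (rcons qs p ++ ps) /\ all prime (rcons qs p ++ ps) /\ (((x == 1 :> R) || (x == -1)) -> signs (rcons l x)) /\
    size (rcons l x) = size (rcons qs p) :> nat.
  by rewrite cat_rcons !size_rcons zl /signs all_rcons; split => //; split => //; split => // ->.
have [u1 [p1 [s1 z1]]] := uE 1; have [_ [_ [s2 z2]]] := uE (-1).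
have {}s1 : signs (rcons l 1) by rewrite s1// eqxx.
have {}s2 : signs (rcons l (-1)) by rewrite s2// eqxx orbT.
have [m1 P1] := IH _ _ (fun es => phi (1 :: es)) u1 p1 s1 z1.
have [m2 P2] := IH _ _ (fun es => phi (-1 :: es)) u1 p1 s2 z2.
set E := [set w | _].
have EU : E = [set w | [/\ map (fun p => eps p w) (rcons qs p) = rcons l 1, signs (map (fun p => eps p w) ps) &
      phi (1 :: map (fun p => eps p w) ps)]] `|`
   [set w | [/\ map (fun p => eps p w) (rcons qs p) = rcons l (-1), signs (map (fun p => eps p w) ps) &
      phi (-1 :: map (fun p => eps p w) ps)]].
  apply/seteqP; split => w; rewrite /E /= !map_rcons.
    by move=> [-> /andP[/orP[/eqP ->|/eqP ->] hs] hp]; [left|right].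
  by case=> -[/rcons_inj[-> ->] hs hp]; split; rewrite // eqxx ?orbT.
split; first by rewrite EU; exact: measurableU.
rewrite EU; apply: (le_trans (@measureU2 _ _ _ P _ _ m1 m2)).
apply: (le_trans (leeD P1 P2)); rewrite -EFinD lee_fin size_rcons exprSr -mulrDr -mulrA.
by rewrite [2^-1 * _]mulrC.
Qed.

Lemma rademacher_not_sign (d : measure_display) (T : measurableType d) (R : realType)
    (P : probability T R) (X : {RV P >-> R}) :
  rademacher X -> P.-negligible [set w | ~~ ((X w == 1) || (X w == -1))].
Proof.
move=> [r1 r2].
have m x : measurable (X @^-1` [set x]).
  by rewrite -[Y in measurable Y]setTI; exact: measurable_funP.
have mU : measurable (X @^-1` [set 1] `|` X @^-1` [set -1]) by exact: measurableU.
exists (~` (X @^-1` [set 1] `|` X @^-1` [set -1])); split.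
- exact: measurableC.
- have PU : P (X @^-1` [set 1] `|` X @^-1` [set -1]) = adde (P (X @^-1` [set 1])) (P (X @^-1` [set -1])).
    apply: measureU => //; apply/seteqP; split => // w [/= -> h].
    by have : (1 : R) = -1 by []; lra.
  have h : 2^-1 + 2^-1 = 1 :> R by lra.
  by rewrite probability_setC// PU r1 r2 -EFinD h subrr.
- by move=> w /= /negP h [] h'; apply: h; rewrite h' eqxx ?orbT.
Qed.

(** The events up to [F k] have probability at most [1 / (k + 1)], so their intersection is null,
    and it contains the set in question; it is measurable because each of them is a condition on
    finitely many signs. *)
Lemma bounded_negligible (d : measure_display) (T : measurableType d) (R : realType)
    (P : probability T R) (eps : nat -> {RV P >-> R}) (A C : R) (x0 : nat) :
  (forall p, prime p -> rademacher (eps p)) -> independent_on [set p : nat | prime p] eps ->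
  5 / 2 < A -> 0 <= C -> (256 <= x0)%N ->
  P.-negligible [set w | (forall p, prime p -> (eps p w == 1) || (eps p w == -1)) /\
    forall N, bounded_upto C A x0 N (fun p => eps p w)].
Proof.
move=> rad ind hA C0 x256.
have /choice[F hF] : forall k : nat, exists N : nat, sign_mean (size (primes_in 0 N.+1)) (fun l =>
      (`[< bounded_upto C A x0 N (sgn_fun (primes_in 0 N.+1) l) >])%:R) <= k.+1%:R^-1 :> R.
  by move=> k; apply: bounded_mean_small.
pose E k := [set w | [/\ map (fun p => eps p w) [::] = [::],
   signs (map (fun p => eps p w) (primes_in 0 (F k).+1)) &
   `[< bounded_upto C A x0 (F k) (sgn_fun (primes_in 0 (F k).+1) (map (fun p => eps p w) (primes_in 0 (F k).+1))) >]]].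
have hE k : measurable (E k) /\ (P (E k) <= (k.+1%:R^-1)%:E)%E.
  have [m h] := @probability_signs_le _ _ _ P eps [::] (primes_in 0 (F k).+1) [::]
    (fun l => `[< bounded_upto C A x0 (F k) (sgn_fun (primes_in 0 (F k).+1) l) >]) rad ind
    (primes_in_uniq _ _) (primes_in_all _ _) isT erefl.
  by split => //; apply: (le_trans h); rewrite expr0 mul1r lee_fin.
have mI : measurable (\bigcap_k E k) by apply: bigcapT_measurable => k; case: (hE k).
exists (\bigcap_k E k); split => //.
  apply/eqP; rewrite -measure_le0; apply/lee_addgt0Pr => e e0.
  set k := Num.truncn e^-1; rewrite add0e.
  apply: (@le_trans _ _ (P (E k))).
    by apply: le_measure; [exact: mem_set|exact: mem_set (hE k).1|exact: bigcap_inf].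
  apply: (le_trans (hE k).2); rewrite lee_fin invf_ple ?posrE//; apply: ltW; exact: truncnS_gt.
move=> w /= [hs hb] k _; split => //.
  by apply/allP => x /mapP[p]; rewrite mem_primes_in => /andP[pp _] ->; exact: hs.
apply/asboolP; apply: eq_bounded_upto (hb (F k)) => p pp pN.
have pin : p \in primes_in 0 (F k).+1 by rewrite mem_primes_in pp.
by rewrite /sgn_fun (nth_map 0%N) ?index_mem// nth_index.
Qed.

Lemma summatory_nat (T : Type) (R : realType) (eps : nat -> T -> R) (w : T) (n : nat) :
  summatory (rademacher_mult eps w) n%:R = partial_sum (fun p => eps p w) n.
Proof. by rewrite /summatory natrK. Qed.

Theorem corollary3 (d : measure_display) (T : measurableType d) (R : realType)
    (P : probability T R) (eps : nat -> {RV P >-> R})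
    (eps_rademacher : forall p : nat, prime p -> rademacher (eps p))
    (eps_independent : independent_on [set p : nat | prime p] eps)
    (A : R) (hA : 5 / 2 < A) :
  {ae P, forall w : T,
    let M := summatory (rademacher_mult eps w) in
    ~ ((M : R -> R^o) =O_ (pinfty_nbhs R)
         ((fun x => Num.sqrt x * ln (ln x) `^ (- A)) : R -> R^o))
    /\ limf_esup (fun x : R => (`|M x| * ln (ln x) `^ A / Num.sqrt x)%:E)
         (pinfty_nbhs R) = +oo%E}.
Proof.
pose N1 := \bigcup_p [set w | prime p /\ ~~ ((eps p w == 1) || (eps p w == -1))].
(* One integer [k] serves as the constant and as part of the threshold, so that countably many
   events cover all constants and thresholds; 256 ensures [ln (ln n) >= 1]. *)
pose N2 := \bigcup_k [set w | (forall p, prime p -> (eps p w == 1) || (eps p w == -1)) /\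
    forall N, bounded_upto k%:R A (k + 256) N (fun p => eps p w)].
have nN : P.-negligible (N1 `|` N2).
  apply: negligibleU; apply: negligible_bigcup => k.
    case pk : (prime k); last by apply: (negligibleS _ (negligible_set0 _)) => w /= [].
    by apply: negligibleS (rademacher_not_sign (eps_rademacher k pk)) => w /= [].
  exact: bounded_negligible eps_rademacher eps_independent hA _ (leq_addl _ _).
apply: negligibleS nN => w /= hw; apply: contrapT => hN; apply: hw.
have sgn p : prime p -> (eps p w == 1) || (eps p w == -1).
  by move=> pp; apply/negPn/negP => h; apply: hN; left; exists p.
set M := summatory (rademacher_mult eps w).
have large (k : nat) : exists2 n : nat, (k + 256 <= n)%N &
    k%:R * (Num.sqrt n%:R * ln (ln n%:R) `^ (- A)) < `|M n%:R|.
  apply: contrapT => h; apply: hN; right; exists k => //; split => // N n /andP[kn _].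
  rewrite leNgt; apply/negP => h'; apply: h; exists n => //.
  by rewrite /M summatory_nat.
split.
  move=> /eqO_exP[C C0 [b [_ hb]]].
  (* [k] exceeds both the constant [C] and the threshold [b], so a single integer given by [large]
     contradicts the bound. *)
  set k := (Num.truncn (C + `|b|)).+1.
  have hk : C + `|b| < k%:R by exact: truncnS_gt.
  have [n kn hn] := large k.
  have bn : b < n%:R.
    apply: le_lt_trans (ler_norm b) _; apply: (@lt_le_trans _ _ k%:R); last first.
      by rewrite ler_nat (leq_trans (leq_addr _ _) kn).
    by apply: le_lt_trans hk; rewrite lerDr ltW.
  have := hb _ bn; rewrite leNgt => /negP; apply; apply: le_lt_trans hn.
  have g0 : 0 <= Num.sqrt n%:R * ln (ln n%:R) `^ (- A) :> R by rewrite mulr_ge0 ?powR_ge0.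
  rewrite [leLHS](_ : _ = C * (Num.sqrt n%:R * ln (ln n%:R) `^ (- A))); last first.
    by congr (_ * _); exact: ger0_norm.
  by rewrite ler_wpM2r// ltW// (le_lt_trans _ hk)// lerDl.
(* The upper limit is an infimum of suprema over neighbourhoods of infinity; an integer point from
   [large] makes each supremum exceed any given [C]. *)
apply/ereal_inf_pinfty => _ [V [b [_ hb]] <-]; apply/eqyP => C C0.
set k := (Num.truncn (C + `|b|)).+1.
have hk : C + `|b| < k%:R by exact: truncnS_gt.
have [n kn hn] := large k.
have bn : b < n%:R.
  apply: le_lt_trans (ler_norm b) _; apply: (@lt_le_trans _ _ k%:R); last first.
    by rewrite ler_nat (leq_trans (leq_addr _ _) kn).
  by apply: le_lt_trans hk; rewrite lerDr ltW.
apply: (@le_trans _ _ (`|M n%:R| * ln (ln n%:R) `^ A / Num.sqrt n%:R)%:E); last first.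
  by apply: ereal_sup_ubound; exists n%:R => //; exact: hb.
have n256 : (256 <= n)%N by rewrite (leq_trans (leq_addl _ _) kn).
have l1 := lnln_ge1 R n256.
have lA : 0 < ln (ln n%:R) `^ A :> R by rewrite powR_gt0// (lt_le_trans _ l1).
have sn : 0 < Num.sqrt n%:R :> R by rewrite sqrtr_gt0 ltr0n (leq_trans _ n256).
rewrite lee_fin ler_pdivlMr// -ler_pdivrMr// -powRN -mulrA.
apply: ltW; apply: le_lt_trans hn; rewrite ler_wpM2r ?mulr_ge0 ?powR_ge0//.
by rewrite ltW// (le_lt_trans _ hk)// lerDl.
Qed.
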